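(* Let $\Omega\subset\mathbb C^d$ be a bounded domain such that $(\Omega,K_\Omega)$ is a complete metric space and is Gromov hyperbolic. Assume that $\partial\Omega$ does not contain nontrivial analytic discs. Then $\Omega$ is visible if and only if there exist $A\geq 1$ and $B\geq 0$ such that $\Omega$ has a frame of $(A,B)$-quasi-geodesics.
   Context: $K_\Omega$ is the Kobayashi distance of $\Omega$ and $k_\Omega$ the infinitesimal Kobayashi pseudometric. No regularity of $\partial\Omega$ is assumed. $|\cdot|$ and $\mathrm{dist}$ refer to the Euclidean norm and distance, and $\partial\Omega$ is the Euclidean boundary. Geodesics: a geodesic is a curve $\gamma:I\to\Omega$ ($I\subset\mathbb R$ an interval) with $K_\Omega(\gamma(s),\gamma(t))=|s-t|$ for all $s,t\in I$. It is a geodesic segment if $I$ is compact, a geodesic ray if $I=[a,+\infty)$, a geodesic line if $I=\mathbb R$. For $x,y\in\Omega$, $[x,y]_\Omega$ denotes (the image of) any geodesic segment joining $x$ and $y$; when $(\Omega,K_\Omega)$ is complete such segments exist. Gromov hyperbolic: there is $\delta>0$ such that for every geodesic triangle (union of three geodesic segments joining three points of $\Omega$) every point of a side is at $K_\Omega$-distance at most $\delta$ from the union of the other two sides. Analytic discs: $\partial\Omega$ contains no nontrivial analytic discs if there is no nonconstant holomorphic map from the unit disc of $\mathbb C$ to $\mathbb C^d$ with image contained in $\partial\Omega$. Visible: $\Omega$ is visible if for all $p,q\in\partial\Omega$ with $p\neq q$ there exist neighborhoods $V_p$ of $p$ and $V_q$ of $q$ with $V_p\cap V_q=\emptyset$ and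 a compact set $K\subset\Omega$ such that every geodesic segment joining a point $x\in V_p\cap\Omega$ to a point $y\in V_q\cap\Omega$ intersects $K$. Quasi-geodesics: for $A\ge 1$, $B\ge 0$, an absolutely continuous curve $\gamma:[a,b]\to\Omega$ is an $(A,B)$-quasi-geodesic (segment) if for all $a\le s<t\le b$ one has $\int_s^t k_\Omega(\gamma(\tau);\gamma'(\tau))\,d\tau\le A\,K_\Omega(\gamma(s),\gamma(t))+B$. An $(A,B)$-quasi-geodesic ray is an absolutely continuous curve $\gamma:[0,+\infty)\to\Omega$ whose restriction to every compact interval is an $(A,B)$-quasi-geodesic. Uniform convergence: let $\gamma_k$ be curves defined on $[0,R_k]$, $R_k\in(0,+\infty]$. The sequence $\{\gamma_k\}$ converges uniformly to a curve $\gamma$ defined on $[0,a]$, $a\in(0,+\infty]$, if $a=\lim_{k\to\infty}R_k$ and for every $\theta>0$ there is $k_0$ such that for every $k\ge k_0$ and every $t\in[0,R_k]$ one has $|\gamma_k(t)-\gamma(t)|\le\theta$ (in particular $\gamma(t)$ must be defined for these $t$). Here a ray that has a limit at $+\infty$ is regarded as defined on $[0,+\infty]$ with value at $+\infty$ equal to that limit (a point of $\partial\Omega$). Frame of $(A,B)$-quasi-geodesics: a family $\mathcal F$ of curves such that (1) for every $\gamma\in\mathcal F$ there is $R_\gamma\in(0,+\infty]$ such that, if $R_\gamma<+\infty$, $\gamma:[0,R_\gamma]\to\Omega$ is an $(A,B)$-quasi-geodesic segment, and if $R_\gamma=+\infty$, $\gamma:[0,+\infty)\to\Omega$ is an $(A,B)$-quasi-geodesic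 ray; (2) if $\gamma\in\mathcal F$ is a ray ($R_\gamma=+\infty$) there is $p_\gamma\in\partial\Omega$ with $\lim_{t\to+\infty}\gamma(t)=p_\gamma$; (3) there is a compact set $K\subset\Omega$ with $\gamma(0)\in K$ for every $\gamma\in\mathcal F$; (4) every sequence $\{\gamma_k\}\subset\mathcal F$ has a subsequence $\{\gamma_{k_m}\}$ converging uniformly to some $\gamma\in\mathcal F$, that is, $R_\gamma=\lim_{m\to\infty}R_{\gamma_{k_m}}$ and for every $\theta>0$ there is $m_0$ such that for every $m\ge m_0$ and every $t\in[0,R_{\gamma_{k_m}}]$ the value $\gamma(t)$ is defined and $|\gamma_{k_m}(t)-\gamma(t)|\le\theta$ (rays in $\mathcal F$ being regarded as defined on $[0,+\infty]$, with value at $+\infty$ equal to their limit); (5) there are $\epsilon>0$ and $\delta>0$ such that for every $z\in\Omega$ with $\mathrm{dist}(z,\partial\Omega)<\epsilon$ there are $\gamma\in\mathcal F$ and a point $w\in\Omega$ in the image of $\gamma$ with $K_\Omega(z,w)<\delta$. *)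

(* Defs.v *)
(* R is any model of the real numbers, C is R[i] and C^d is 'rV[R[i]]_d. *)
From HB Require Import structures.
From mathcomp Require Import all_boot all_order all_algebra complex.
From mathcomp Require Import all_classical all_reals all_analysis.
Import Order.TTheory GRing.Theory Num.Theory numFieldNormedType.Exports.

Set Implicit Arguments.
Unset Strict Implicit.
Unset Printing Implicit Defensive.

Local Open Scope classical_set_scope.
Local Open Scope ring_scope.
Local Open Scope complex_scope.

(* Puts the usual topology of C on R[i] itself; without this instance only the
   alias R[i]^o carries it, and 'rV[R[i]]_d is not seen as a topological
   space. *)
HB.instance Definition _ (R : realType) := NormedModule.copy R[i] R[i]^o.

(* The norms that the library puts on R[i] and on 'rV[R[i]]_d are R[i]-valued,
   and the latter is the sup norm: cabs and enorm are the R-valued modulus and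
   the Euclidean norm. They induce the same topologies. *)
Definition cabs (R : realType) (z : R[i]) : R :=
  Num.sqrt (complex.Re z ^+ 2 + complex.Im z ^+ 2).

Definition enorm (R : realType) (d : nat) (z : 'rV[R[i]]_d) : R :=
  Num.sqrt (\sum_(i < d) cabs (z ord0 i) ^+ 2).

(* Extended-real valued, so that the distance to the empty set is +oo. *)
Definition dist_to_set (R : realType) (d : nat) (z : 'rV[R[i]]_d)
    (S : set 'rV[R[i]]_d) : \bar R :=
  ereal_inf [set (enorm (z - q))%:E | q in S].

Definition domain (R : realType) (d : nat) (Omega : set 'rV[R[i]]_d) : Prop :=
  [/\ open Omega, connected Omega & Omega !=set0].

Definition boundary (T : topologicalType) (S : set T) : set T :=
  closure S `\` interior S.

Definition unit_disc (R : realType) : set R[i] := [set z | cabs z < 1].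

(* Functions are total; only the values on the disc matter. Here derivable is
   complex differentiability, the scalar field being R[i]. *)
Definition holomorphic_disc (R : realType) (d : nat) (S : set 'rV[R[i]]_d)
    (phi : R[i] -> 'rV[R[i]]_d) : Prop :=
  (forall z, unit_disc z -> derivable phi z 1) /\
  (forall z, unit_disc z -> S (phi z)).

Definition no_nontrivial_analytic_discs (R : realType) (d : nat)
    (S : set 'rV[R[i]]_d) : Prop :=
  ~ exists phi : R[i] -> 'rV[R[i]]_d, holomorphic_disc S phi /\
      exists z w, [/\ unit_disc z, unit_disc w & phi z <> phi w].

(* Normalized so that the associated metric is |dz| / (1 - |z|^2), in
   accordance with kobayashi_metric. *)
Definition poincare_dist (R : realType) (a b : R[i]) : R :=
  let m := cabs ((a - b) / (1 - b^*%C * a)) in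
  2^-1 * ln ((1 + m) / (1 - m)).

Definition disc_chain (R : realType) (d : nat) (Omega : set 'rV[R[i]]_d)
    (x y : 'rV[R[i]]_d) (L : R) : Prop :=
  exists (n : nat) (p : nat -> 'rV[R[i]]_d)
         (phi : nat -> R[i] -> 'rV[R[i]]_d) (a b : nat -> R[i]),
  [/\ p 0%N = x, p n = y,
      forall j, (j < n)%N ->
        [/\ holomorphic_disc Omega (phi j), unit_disc (a j), unit_disc (b j),
            phi j (a j) = p j & phi j (b j) = p j.+1] &
      L = \sum_(j < n) poincare_dist (a j) (b j)].

(* For x and y in a domain Omega the set of lengths is nonempty, so that the
   real-valued infimum is the genuine one. *)
Definition kobayashi (R : realType) (d : nat) (Omega : set 'rV[R[i]]_d)
    (x y : 'rV[R[i]]_d) : R :=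
  inf [set L | disc_chain Omega x y L].

(* The same remark applies, for z in an open set Omega. *)
Definition kobayashi_metric (R : realType) (d : nat) (Omega : set 'rV[R[i]]_d)
    (z v : 'rV[R[i]]_d) : R :=
  inf [set cabs xi | xi in [set xi : R[i] |
    exists phi : R[i] -> 'rV[R[i]]_d,
      [/\ holomorphic_disc Omega phi, phi 0 = z & xi *: derive1 phi 0 = v]]].

Definition metric_on (R : realType) (T : Type) (X : set T)
    (dist : T -> T -> R) : Prop :=
  [/\ forall x y, X x -> X y -> 0 <= dist x y,
      forall x y, X x -> X y -> (dist x y = 0 <-> x = y),
      forall x y, X x -> X y -> dist x y = dist y x &
      forall x y z, X x -> X y -> X z -> dist x z <= dist x y + dist y z].

Definition complete_metric_on (R : realType) (T : Type) (X : set T)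
    (dist : T -> T -> R) : Prop :=
  metric_on X dist /\
  forall u : nat -> T, (forall n, X (u n)) ->
    (forall e : R, 0 < e -> exists N : nat, forall m n : nat,
       (N <= m)%N -> (N <= n)%N -> dist (u m) (u n) < e) ->
    exists2 l, X l & forall e : R, 0 < e -> exists N : nat, forall n : nat,
       (N <= n)%N -> dist (u n) l < e.

Definition geodesic (R : realType) (d : nat) (Omega : set 'rV[R[i]]_d)
    (I : set R) (gamma : R -> 'rV[R[i]]_d) : Prop :=
  (forall t, I t -> Omega (gamma t)) /\
  (forall s t, I s -> I t ->
     kobayashi Omega (gamma s) (gamma t) = `|s - t|).

(* S is the image of a geodesic segment joining x to y. *)
Definition geodesic_segment (R : realType) (d : nat) (Omega : set 'rV[R[i]]_d)
    (x y : 'rV[R[i]]_d) (S : set 'rV[R[i]]_d) : Prop :=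
  exists (a b : R) (gamma : R -> 'rV[R[i]]_d),
  [/\ a <= b, geodesic Omega `[a, b] gamma, gamma a = x, gamma b = y &
      S = gamma @` `[a, b]].

Definition gromov_hyperbolic (R : realType) (d : nat)
    (Omega : set 'rV[R[i]]_d) : Prop :=
  let slim delta (S T U : set 'rV[R[i]]_d) :=
    forall p, S p -> exists2 q, (T `|` U) q & kobayashi Omega p q <= delta in
  exists2 delta : R, 0 < delta &
    forall (x y z : 'rV[R[i]]_d) (S T U : set 'rV[R[i]]_d),
      Omega x -> Omega y -> Omega z ->
      geodesic_segment Omega x y S ->
      geodesic_segment Omega y z T ->
      geodesic_segment Omega z x U ->
      [/\ slim delta S T U, slim delta T U S & slim delta U S T].

Definition visible (R : realType) (d : nat) (Omega : set 'rV[R[i]]_d) : Prop :=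
  forall p q : 'rV[R[i]]_d, boundary Omega p -> boundary Omega q -> p <> q ->
  exists (Vp Vq K : set 'rV[R[i]]_d),
    [/\ nbhs p Vp, nbhs q Vq, Vp `&` Vq = set0, compact K /\ K `<=` Omega &
        forall x y S, (Vp `&` Omega) x -> (Vq `&` Omega) y ->
          geodesic_segment Omega x y S -> S `&` K !=set0].

Definition abs_continuous (R : realType) (d : nat) (a b : R)
    (gamma : R -> 'rV[R[i]]_d) : Prop :=
  forall e : R, 0 < e -> exists2 delta : R, 0 < delta &
    forall (n : nat) (s t : nat -> R),
      (forall j, (j < n)%N -> [/\ a <= s j, s j <= t j & t j <= b]) ->
      (forall j k, (j < n)%N -> (k < n)%N -> j <> k ->
         t j <= s k \/ t k <= s j) ->
      \sum_(j < n) (t j - s j) < delta ->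
      \sum_(j < n) enorm (gamma (t j) - gamma (s j)) < e.

(* Componentwise derivative in the real parameter: 'rV[R[i]]_d is a normed
   module over R[i] but not over R. *)
Definition velocity (R : realType) (d : nat) (gamma : R -> 'rV[R[i]]_d)
    (t : R) : 'rV[R[i]]_d :=
  \row_(j < d) (derive1 (fun s : R => complex.Re (gamma s ord0 j)) t +i*
                derive1 (fun s : R => complex.Im (gamma s ord0 j)) t).

(* An absolutely continuous curve is differentiable almost everywhere, so the
   value of velocity at the other points is irrelevant. *)
Definition kobayashi_length (R : realType) (d : nat) (Omega : set 'rV[R[i]]_d)
    (gamma : R -> 'rV[R[i]]_d) (s t : R) : \bar R :=
  (\int[@lebesgue_measure R]_(u in `[s, t])
     (kobayashi_metric Omega (gamma u) (velocity gamma u))%:E)%E.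

Definition quasi_geodesic (R : realType) (d : nat) (Omega : set 'rV[R[i]]_d)
    (A B a b : R) (gamma : R -> 'rV[R[i]]_d) : Prop :=
  [/\ forall t, a <= t -> t <= b -> Omega (gamma t),
      abs_continuous a b gamma &
      forall s t, a <= s -> s < t -> t <= b ->
        (kobayashi_length Omega gamma s t <=
           (A * kobayashi Omega (gamma s) (gamma t) + B)%:E)%E].

Definition quasi_geodesic_ray (R : realType) (d : nat)
    (Omega : set 'rV[R[i]]_d) (A B : R) (gamma : R -> 'rV[R[i]]_d) : Prop :=
  forall a b : R, 0 <= a -> a <= b -> quasi_geodesic Omega A B a b gamma.

(* A curve on [0, cend] if cend is finite, on [0, +oo) if cend = +oo; the
   values of cfun elsewhere are irrelevant. *)
Record curve (R : realType) (d : nat) : Type := Curve {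
  cend : \bar R ;
  cfun :> R -> 'rV[R[i]]_d }.

(* A ray is extended to [0, +oo] by its limit. *)
Definition ceval (R : realType) (d : nat) (c : curve R d) (t : \bar R)
    : 'rV[R[i]]_d :=
  if t is r%:E then c r else lim (c r @[r --> +oo]).

(* The clause t <= cend c says that c is defined at t. *)
Definition converges_uniformly (R : realType) (d : nat)
    (c_ : nat -> curve R d) (c : curve R d) : Prop :=
  (cend (c_ k) @[k --> \oo] --> cend c) /\
  forall theta : R, 0 < theta -> exists k0 : nat, forall k : nat, (k0 <= k)%N ->
    forall t : \bar R, (0 <= t)%E -> (t <= cend (c_ k))%E ->
      (t <= cend c)%E /\ enorm (ceval (c_ k) t - ceval c t) <= theta.

Definition frame (R : realType) (d : nat) (Omega : set 'rV[R[i]]_d) (A B : R)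
    (F : set (curve R d)) : Prop :=
  [/\ forall c, F c ->
        [/\ (0 < cend c)%E,
            forall r : R, cend c = r%:E -> quasi_geodesic Omega A B 0 r c &
            cend c = +oo%E -> quasi_geodesic_ray Omega A B c],
      forall c, F c -> cend c = +oo%E ->
        exists2 p, boundary Omega p & c t @[t --> +oo] --> p,
      exists K : set 'rV[R[i]]_d,
        [/\ compact K, K `<=` Omega & forall c, F c -> K (c 0)],
      forall c_ : nat -> curve R d, (forall k, F (c_ k)) ->
        exists (m : nat -> nat) (c : curve R d),
          [/\ forall j k, (j < k)%N -> (m j < m k)%N, F c &
              converges_uniformly (c_ \o m) c] &
      exists eps delta : R, [/\ 0 < eps, 0 < delta &
        forall z, Omega z -> (dist_to_set z (boundary Omega) < eps%:E)%E ->
          exists (c : curve R d) (t : R),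
            [/\ F c, 0 <= t, (t%:E <= cend c)%E, Omega (c t) &
                kobayashi Omega z (c t) < delta]]].

(* Main.v *)
From HB Require Import structures.
Require Import Defs.
From mathcomp Require Import all_boot all_order all_algebra complex.
From mathcomp Require Import all_classical all_reals all_analysis.
From mathcomp Require Import measurable_realfun.
From mathcomp Require Import ring lra zify.
Import Order.TTheory GRing.Theory Num.Theory numFieldNormedType.Exports.
Set Implicit Arguments.
Unset Strict Implicit.
Unset Printing Implicit Defensive.
Local Open Scope classical_set_scope.
Local Open Scope ring_scope.
Local Open Scope complex_scope.

(** Throughout, K is the Kobayashi distance of the bounded domain Omega, o a base
    point, and (x|y) = (K o x + K o y - K x y) / 2 the Gromov product.

    Three facts about K come first. Closed balls are compact and geodesics exist,
    as in the Hopf-Rinow theorem ([K_proper], [geodesic_ex]): any two points are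
    joined by chains of discs of almost minimal length, and running through them
    along radii at hyperbolic unit speed gives paths of almost minimal length
    ([unit_speed_path_ex]). Since the boundary contains no analytic discs, points
    at bounded distance K from each other become Euclidean close when they go
    to the boundary ([no_disc_contraction]): limits of discs are discs, by a
    Cauchy estimate obtained from Goursat's theorem ([holo_taylor], [ultra_disc]).
    Finally K is at most the integral of the infinitesimal metric along absolutely
    continuous curves ([K_le_length]), for which the theory of absolutely
    continuous functions is developed from the Radon-Nikodym and Lebesgue
    differentiation theorems ([abs_cont_FTC]).

    Suppose that a frame exists and that visibility fails at p and q. Then there
    are x near p and y near q with (x|y) arbitrarily large, and curves of the
    frame that end near x and near y. Cut into unit steps they are discrete
    quasi-geodesics, so by the Morse lemma ([morse], [quasi_morse]) they stay near
    geodesics issued from a compact set; and since (x|y) is large, these geodesics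
    pass near each other far away from o ([curves_meet_far]). In the limit two
    rays of the frame, one ending at p and the other at q, contain points at
    bounded distance that go to the boundary. By the contraction property p = q
    ([frame_visible]).

    Conversely, let Omega be visible. Then points with large Gromov product are
    Euclidean close ([visible_close]). Choose L larger than 5 delta, finite nets
    on the spheres of radius n L about o ([sphere_net]), and for every pair of
    points of consecutive nets at distance at most L + 2 one unit speed arc. The
    frame consists of the curves that follow finite or infinite paths of this
    graph ([path_curves]). They are quasi-geodesics because the distance to o
    grows by L along every edge ([crv_quasi]). The four-point inequality shows that
    two points of a path beyond its n-th node have Gromov product at least n L
    up to a constant ([node_gp]), so the tails of all the paths are uniformly small
    ([tail_small]): infinite paths converge, and as each net is finite, a
    diagonal argument gives the compactness of the family
    ([path_curves_compact]). Paths that follow geodesics from o pass near every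
    point ([path_curves_dense]). Fixing the arcs in advance gives the compactness
    without any closedness of the length condition under limits. *)

(** * Moduli, Euclidean norms and ultralimits *)

Section ComplexModulus.
Variable R : realType.
Implicit Types z w : R[i].

Lemma cabsE z : cabs z = ComplexField.Normc.normc z.
Proof. by case: z. Qed.

Lemma normr_cabs z : `|z| = (cabs z)%:C.
Proof. by rewrite normc_def. Qed.

Lemma cabs_ge0 z : 0 <= cabs z.
Proof. exact: sqrtr_ge0. Qed.

Lemma cabs0 : cabs (0 : R[i]) = 0.
Proof. by rewrite /cabs /= expr0n addr0 sqrtr0. Qed.

Lemma cabsM z w : cabs (z * w) = cabs z * cabs w.
Proof. by rewrite !cabsE ComplexField.Normc.normcM. Qed.

Lemma cabsV z : cabs z^-1 = (cabs z)^-1.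
Proof. by rewrite !cabsE ComplexField.Normc.normcV. Qed.

Lemma cabsN z : cabs (- z) = cabs z.
Proof. by rewrite /cabs; case: z => a b /=; rewrite !sqrrN. Qed.

Lemma cabsD z w : cabs (z + w) <= cabs z + cabs w.
Proof.
by have := ler_normD z w; rewrite !normr_cabs -rmorphD lecR.
Qed.

Lemma cabsB z w : cabs (z - w) = cabs (w - z).
Proof. by rewrite -cabsN opprB. Qed.

Lemma cabs_eq0 z : cabs z = 0 -> z = 0.
Proof. by rewrite cabsE => /ComplexField.Normc.eq0_normc. Qed.

Lemma cabs_gt0 z : z != 0 -> 0 < cabs z.
Proof.
move=> z0; rewrite lt_neqAle cabs_ge0 andbT eq_sym.
by apply: contra z0 => /eqP/cabs_eq0 ->.
Qed.

Lemma cabs_sqr z : cabs z ^+ 2 = complex.Re z ^+ 2 + complex.Im z ^+ 2.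
Proof. by rewrite sqr_sqrtr // addr_ge0 // sqr_ge0. Qed.

Lemma cabs_real (r : R) : cabs r%:C = `|r|.
Proof. by rewrite /cabs /= expr0n addr0 sqrtr_sqr. Qed.

Lemma cabs1 : cabs (1 : R[i]) = 1.
Proof. by rewrite (cabs_real 1) normr1. Qed.

Lemma cabsi (r : R) : cabs (Complex 0 r) = `|r|.
Proof. by rewrite /cabs /= expr0n add0r sqrtr_sqr. Qed.

Lemma Re_le_cabs z : `|complex.Re z| <= cabs z.
Proof.
rewrite -[leLHS]sqrtr_sqr; apply: ler_wsqrtr; rewrite lerDl; exact: sqr_ge0.
Qed.

Lemma Im_le_cabs z : `|complex.Im z| <= cabs z.
Proof.
rewrite -[leLHS]sqrtr_sqr; apply: ler_wsqrtr; rewrite lerDr; exact: sqr_ge0.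
Qed.

Lemma cabs_le_ReIm z : cabs z <= `|complex.Re z| + `|complex.Im z|.
Proof.
have -> : z = (complex.Re z)%:C + Complex 0 (complex.Im z).
  by case: z => a b; simpc.
by apply: le_trans (cabsD _ _) _; rewrite cabs_real cabsi /= !addr0 !add0r.
Qed.

Lemma cabsC z : cabs z^*%C = cabs z.
Proof. by rewrite /cabs; case: z => a b /=; rewrite sqrrN. Qed.

Lemma ReD z w : complex.Re (z + w) = complex.Re z + complex.Re w.
Proof. by case: z w => a b [c e]. Qed.
Lemma ImD z w : complex.Im (z + w) = complex.Im z + complex.Im w.
Proof. by case: z w => a b [c e]. Qed.
Lemma ReN z : complex.Re (- z) = - complex.Re z.
Proof. by case: z. Qed.
Lemma ImN z : complex.Im (- z) = - complex.Im z.
Proof. by case: z. Qed.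
Lemma ReB z w : complex.Re (z - w) = complex.Re z - complex.Re w.
Proof. by rewrite ReD ReN. Qed.
Lemma ImB z w : complex.Im (z - w) = complex.Im z - complex.Im w.
Proof. by rewrite ImD ImN. Qed.

Lemma ltc0_real (e : R[i]) : 0 < e -> e = (complex.Re e)%:C /\ 0 < complex.Re e.
Proof. by case: e => a b; rewrite ltcE /= => /andP[/eqP -> ->]. Qed.

End ComplexModulus.

Section EuclideanNorm.
Variables (R : realType) (d : nat).
Implicit Types x y z : 'rV[R[i]]_d.

Lemma enorm_ge0 z : 0 <= enorm z.
Proof. exact: sqrtr_ge0. Qed.

Lemma enorm_sqr z : enorm z ^+ 2 = \sum_(i < d) cabs (z ord0 i) ^+ 2.
Proof. by rewrite sqr_sqrtr //; apply: sumr_ge0 => i _; exact: sqr_ge0. Qed.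

Lemma coord_le_enorm z i : cabs (z ord0 i) <= enorm z.
Proof.
rewrite -(ger0_norm (cabs_ge0 (z ord0 i))) -[leLHS]sqrtr_sqr.
apply: ler_wsqrtr.
rewrite (bigD1 i) //= lerDl; apply: sumr_ge0 => j _; exact: sqr_ge0.
Qed.

Lemma enorm_le_sum z : enorm z <= \sum_(i < d) cabs (z ord0 i).
Proof.
have S0 : 0 <= \sum_(i < d) cabs (z ord0 i).
  by apply: sumr_ge0 => i _; exact: cabs_ge0.
rewrite -[leRHS]ger0_norm // -[leRHS]sqrtr_sqr; apply: ler_wsqrtr.
rewrite expr2 mulr_suml; apply: ler_sum => i _.
rewrite expr2 ler_wpM2l ?cabs_ge0 // (bigD1 i) //= lerDl.
by apply: sumr_ge0 => j _; exact: cabs_ge0.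
Qed.

Lemma enorm0 : enorm (0 : 'rV[R[i]]_d) = 0.
Proof.
apply/eqP; rewrite eq_le enorm_ge0 andbT.
apply: le_trans (enorm_le_sum _) _.
by rewrite big1 // => i _; rewrite mxE cabs0.
Qed.

Lemma enorm_eq0 z : enorm z = 0 -> z = 0.
Proof.
move=> z0; apply/rowP => i; rewrite mxE; apply: cabs_eq0.
by apply/eqP; rewrite eq_le cabs_ge0 andbT -z0 coord_le_enorm.
Qed.

Lemma enormZ (c : R[i]) z : enorm (c *: z) = cabs c * enorm z.
Proof.
rewrite /enorm; under eq_bigr do rewrite mxE cabsM exprMn.
rewrite -mulr_sumr sqrtrM ?sqr_ge0 // sqrtr_sqr ger0_norm ?cabs_ge0 //.
Qed.

Lemma enormN z : enorm (- z) = enorm z.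
Proof. by rewrite -scaleN1r enormZ cabsN cabs1 mul1r. Qed.

Lemma enormB x y : enorm (x - y) = enorm (y - x).
Proof. by rewrite -enormN opprB. Qed.

Lemma enormD x y : enorm (x + y) <= enorm x + enorm y.
Proof.
have [/enorm_eq0 ->|x0] := eqVneq (enorm x) 0; first by rewrite enorm0 !add0r.
have [/enorm_eq0 ->|y0] := eqVneq (enorm y) 0; first by rewrite enorm0 !addr0.
have X : 0 < enorm x by rewrite lt_neqAle eq_sym x0 enorm_ge0.
have Y : 0 < enorm y by rewrite lt_neqAle eq_sym y0 enorm_ge0.
rewrite -(ler_pXn2r (n := 2)) ?nnegrE ?addr_ge0 ?enorm_ge0 //.
rewrite enorm_sqr.
pose s := enorm y / enorm x; have s0 : 0 < s by rewrite divr_gt0.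
have H i : cabs ((x + y) ord0 i) ^+ 2 <=
    (1 + s) * cabs (x ord0 i) ^+ 2 + (1 + s^-1) * cabs (y ord0 i) ^+ 2.
  rewrite mxE; have := cabsD (x ord0 i) (y ord0 i).
  have := cabs_ge0 (x ord0 i + y ord0 i).
  move: (cabs (x ord0 i + y ord0 i)) (cabs (x ord0 i)) (cabs (y ord0 i)).
  move=> u a b u0 uab.
  have -> : (1 + s) * a ^+ 2 + (1 + s^-1) * b ^+ 2 =
     (a + b) ^+ 2 + s * (a - s^-1 * b) ^+ 2.
    by field; rewrite gt_eqF.
  apply: (@le_trans _ _ ((a + b) ^+ 2)).
    by rewrite ler_pXn2r // nnegrE // (le_trans u0).
  by rewrite lerDl mulr_ge0 ?sqr_ge0 // ltW.
apply: le_trans (ler_sum _ (fun i _ => H i)) _.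
rewrite big_split /= -!mulr_sumr -!enorm_sqr /s.
have -> : (1 + enorm y / enorm x) * enorm x ^+ 2 +
  (1 + (enorm y / enorm x)^-1) * enorm y ^+ 2 = (enorm x + enorm y) ^+ 2.
  by field; rewrite !gt_eqF.
by [].
Qed.

Lemma enorm_triangle y x z : enorm (x - z) <= enorm (x - y) + enorm (y - z).
Proof. by rewrite -[x - z](subrKA y) enormD. Qed.

(** The topology on row vectors comes from a sup norm with complex values: this
    is its translation into the Euclidean norm. *)
Lemma nbhs_enorm z (A : set 'rV[R[i]]_d) :
  nbhs z A <-> exists2 e : R, 0 < e & forall w, enorm (w - z) < e -> A w.
Proof.
split=> [/nbhs_ballP[e /= e0 eA]|[e e0 eA]].
  have [eE r0] := ltc0_real e0.
  exists (complex.Re e) => // w zw; apply: eA; split=> // i j.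
  rewrite (ord1 i) -ball_normE /= normr_cabs eE ltcR.
  apply: le_lt_trans zw; rewrite -enormN opprB.
  by have := coord_le_enorm (z - w) j; rewrite !mxE.
pose e' := e / d.+1%:R; have e'0 : 0 < e' by rewrite divr_gt0.
apply/nbhs_ballP; exists (e'%:C) => /=; first by rewrite ltcR.
move=> w [_ zw]; apply: eA.
apply: le_lt_trans (enorm_le_sum _) _.
apply: (@le_lt_trans _ _ (\sum_(i < d) e')).
  apply: ler_sum => i _; have := zw ord0 i.
  by rewrite -ball_normE /= normr_cabs ltcR !mxE -cabsB => /ltW.
rewrite sumr_const card_ord -mulr_natr /e' mulrAC ltr_pdivrMr ?ltr0Sn //.
by rewrite ltr_pM2l // ltr_nat.
Qed.

End EuclideanNorm.

(** Limits along an ultrafilter replace the extraction of subsequences: bounded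
    sequences always have them, simultaneously for all parameters. *)
Section Ultralimits.
Variables (R : realType) (T : Type) (U : set_system T).
Hypothesis UU : UltraFilter U.

Lemma ultra_dichotomy (A : set T) : U A \/ U (~` A).
Proof. exact: in_ultra_setVsetC. Qed.

Lemma ultra_real (f : T -> R) (M : R) : U [set k | `|f k| <= M] ->
  exists l : R, forall e : R, 0 < e -> U [set k | `|f k - l| < e].
Proof.
move=> fM.
have [|l [_ fl]] := @segment_compact R (- M) M (f @ U) _.
  suff : U (f @^-1` `[- M, M]%classic) by [].
  by apply: filterS fM => k /=; rewrite in_itv /= ler_norml.
exists l => e e0; have [//|nU] := ultra_dichotomy [set k | `|f k - l| < e].
have [||y [/= yl]] := fl [set y | ~ (`|y - l| < e)] (ball l e).
- exact: nU.
- exact: nbhsx_ballx.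
- by rewrite /ball /= distrC.
Qed.

Lemma ultra_limit d (f : T -> 'rV[R[i]]_d) (M : R) :
  U [set k | enorm (f k) <= M] ->
  exists l, forall e : R, 0 < e -> U [set k | enorm (f k - l) < e].
Proof.
move=> fM.
have /choice[lr Hr] i : exists l : R, forall e : R, 0 < e ->
    U [set k | `|complex.Re (f k ord0 i) - l| < e].
  apply: (@ultra_real _ M); apply: filterS fM => k /=.
  exact: le_trans (le_trans (Re_le_cabs _) (coord_le_enorm _ _)).
have /choice[li Hi] i : exists l : R, forall e : R, 0 < e ->
    U [set k | `|complex.Im (f k ord0 i) - l| < e].
  apply: (@ultra_real _ M); apply: filterS fM => k /=.
  exact: le_trans (le_trans (Im_le_cabs _) (coord_le_enorm _ _)).
exists (\row_i (Complex (lr i) (li i))) => e e0.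
pose e' := e / d.+1%:R / 2; have e'0 : 0 < e' by rewrite !divr_gt0.
have : U [set k | forall i, `|complex.Re (f k ord0 i) - lr i| < e' /\
                            `|complex.Im (f k ord0 i) - li i| < e'].
  apply: (@filter_forall T 'I_d (fun i k =>
    `|complex.Re (f k ord0 i) - lr i| < e' /\
    `|complex.Im (f k ord0 i) - li i| < e')) => i.
  by apply: filterI; [apply: Hr|apply: Hi].
apply: filterS => k /= H.
apply: le_lt_trans (enorm_le_sum _) _.
apply: (@le_lt_trans _ _ (\sum_(i < d) (2 * e'))).
  apply: ler_sum => i _; apply: le_trans (cabs_le_ReIm _) _; rewrite !mxE.
  have [h1 h2] := H i.
  by rewrite ReB ImB /= mulrDl mul1r lerD // ltW.
rewrite sumr_const card_ord /e'.
rewrite -[_ *+ d]mulr_natr.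
have -> : 2 * (e / d.+1%:R / 2) * d%:R = e * (d%:R / d.+1%:R).
  have : d.+1%:R != 0 :> R by rewrite pnatr_eq0.
  by move: (d.+1%:R : R) (d%:R : R) => u v u0; field.
by rewrite -[ltRHS]mulr1 ltr_pM2l // ltr_pdivrMr ?ltr0Sn // mul1r ltr_nat.
Qed.

Lemma ultra_pair (A B : set T) : U A -> U B -> exists k, A k /\ B k.
Proof. by move=> a b; have [k []] := filter_ex (filterI a b); exists k. Qed.

End Ultralimits.

(** * Complex derivatives *)

Section ComplexDerivative.
Variable R : realType.

Lemma nbhs_cabs (z : R[i]) (A : set R[i]) :
  nbhs z A <-> exists2 e : R, 0 < e & forall w, cabs (w - z) < e -> A w.
Proof.
split=> [/nbhs_ballP[e /= e0 eA]|[e e0 eA]].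
  have [eE r0] := ltc0_real e0.
  exists (complex.Re e) => // w zw; apply: eA.
  by rewrite -ball_normE /= normr_cabs eE ltcR cabsB.
apply/nbhs_ballP; exists (e%:C) => /=; first by rewrite ltcR.
move=> w; rewrite -ball_normE /= normr_cabs ltcR => zw; apply: eA.
by rewrite cabsB.
Qed.

(** The real-valued moduli make this form of complex differentiability easier to
    compute with than the filter of difference quotients. *)
Definition cdiff (f : R[i] -> R[i]) (z a : R[i]) :=
  forall e : R, 0 < e -> exists2 r : R, 0 < r & forall h, cabs h < r ->
    cabs (f (z + h) - f z - a * h) <= e * cabs h.

Definition vdiff d (f : R[i] -> 'rV[R[i]]_d) (z : R[i]) (a : 'rV[R[i]]_d) :=
  forall e : R, 0 < e -> exists2 r : R, 0 < r & forall h, cabs h < r ->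
    enorm (f (z + h) - f z - h *: a) <= e * cabs h.

Lemma derivable_vdiff d (f : R[i] -> 'rV[R[i]]_d) z a :
  (h^-1 *: (f (h *: 1 + z) - f z) @[h --> 0^'] --> a) <-> vdiff f z a.
Proof.
split=> [H e e0|H].
  have : nbhs a [set w | enorm (w - a) < e].
    by apply/nbhs_enorm; exists e.
  move=> /H /= /nbhs_cabs[r r0 rH]; exists r => // h hr.
  have [->|h0] := eqVneq h 0.
    by rewrite addr0 subrr scale0r subr0 enorm0 cabs0 mulr0.
  have := rH h; rewrite subr0 => /(_ hr h0) /=.
  rewrite [h *: 1]mulr1 (addrC h z) => /ltW le.
  have -> : f (z + h) - f z - h *: a = h *: (h^-1 *: (f (z + h) - f z) - a).
    by rewrite scalerBr scalerA divff // scale1r.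
  by rewrite enormZ mulrC ler_wpM2r // cabs_ge0.
move=> A /nbhs_enorm[e e0 eA].
have [r r0 rH] := H (e / 2) (divr_gt0 e0 (ltr0Sn _ 1)).
apply/nbhs_cabs; exists r => // h; rewrite subr0 => hr /= h0.
apply: eA; rewrite [h *: 1]mulr1 (addrC h z).
have -> : h^-1 *: (f (z + h) - f z) - a = h^-1 *: (f (z + h) - f z - h *: a).
  by rewrite [RHS]scalerBr scalerA mulVf // scale1r.
have c0 := cabs_gt0 h0.
rewrite enormZ cabsV ltr_pdivrMl //.
apply: le_lt_trans (rH h hr) _.
by rewrite mulrC ltr_pM2l // ltr_pdivrMr // ltr_pMr // ltr1n.
Qed.

Lemma derivable_cdiff (f : R[i] -> R[i]) z a :
  (h^-1 *: (f (h *: 1 + z) - f z) @[h --> 0^'] --> a) <-> cdiff f z a.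
Proof.
split=> [H e e0|H].
  have : nbhs a [set w | cabs (w - a) < e].
    by apply/nbhs_cabs; exists e.
  move=> /H /= /nbhs_cabs[r r0 rH]; exists r => // h hr.
  have [->|h0] := eqVneq h 0.
    by rewrite addr0 subrr mulr0 subr0 cabs0 mulr0.
  have := rH h; rewrite subr0 => /(_ hr h0) /=.
  rewrite [h *: 1]mulr1 (addrC h z) => /ltW le.
  have -> : f (z + h) - f z - a * h = h * (h^-1 * (f (z + h) - f z) - a).
    by rewrite mulrBr mulrA divff // mul1r (mulrC a).
  by rewrite cabsM mulrC ler_wpM2r // cabs_ge0.
move=> A /nbhs_cabs[e e0 eA].
have [r r0 rH] := H (e / 2) (divr_gt0 e0 (ltr0Sn _ 1)).
apply/nbhs_cabs; exists r => // h; rewrite subr0 => hr /= h0.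
apply: eA; rewrite [h *: 1]mulr1 (addrC h z).
have -> : h^-1 *: (f (z + h) - f z) - a = h^-1 * (f (z + h) - f z - a * h).
  by rewrite mulrBr (mulrC a) mulrA mulVf // mul1r.
have c0 := cabs_gt0 h0.
rewrite cabsM cabsV ltr_pdivrMl //.
apply: le_lt_trans (rH h hr) _.
by rewrite mulrC ltr_pM2l // ltr_pdivrMr // ltr_pMr // ltr1n.
Qed.

Lemma cdiff_derive (f : R[i] -> R[i]) (z a : R[i]) : cdiff f z a -> is_derive z (1 : R[i]) f a.
Proof.
move=> /derivable_cdiff H; apply: DeriveDef; first by apply: cvgP H.
exact: cvg_lim H.
Qed.

Lemma derive_cdiff (f : R[i] -> R[i]) (z a : R[i]) : is_derive z (1 : R[i]) f a -> cdiff f z a.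
Proof.
by case=> H <-; apply/derivable_cdiff; exact: H.
Qed.

Lemma vdiff_derive1 d (f : R[i] -> 'rV[R[i]]_d) z a :
  vdiff f z a -> derivable f z 1 /\ derive1 f z = a.
Proof.
move=> /derivable_vdiff H; split; first by apply: cvgP H.
by rewrite derive1E; exact: cvg_lim H.
Qed.

Lemma derivable_vdiffE d (f : R[i] -> 'rV[R[i]]_d) z :
  derivable f z 1 -> vdiff f z (derive1 f z).
Proof. by rewrite derive1E => H; apply/derivable_vdiff; exact: H. Qed.

Lemma vdiff_coord d (f : R[i] -> 'rV[R[i]]_d) z a i :
  vdiff f z a -> cdiff (fun w => f w ord0 i) z (a ord0 i).
Proof.
move=> H e e0; have [r r0 rH] := H e e0; exists r => // h /rH.
apply: le_trans; apply: le_trans (coord_le_enorm _ i).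
by rewrite !mxE mulrC.
Qed.

Lemma cdiff_continuous (f : R[i] -> R[i]) z a : cdiff f z a ->
  forall e : R, 0 < e -> exists2 r : R, 0 < r & forall h, cabs h < r ->
    cabs (f (z + h) - f z) < e.
Proof.
move=> H e e0; have [r r0 rH] := H 1 ltr01.
have c0 : 0 < 2 + cabs a by rewrite ltr_wpDr ?cabs_ge0.
exists (Num.min r (e / (2 + cabs a))); first by rewrite lt_min r0 divr_gt0.
move=> h; rewrite lt_min ltr_pdivlMr // => /andP[/rH hr he].
apply: le_lt_trans he.
have -> : f (z + h) - f z = (f (z + h) - f z - a * h) + a * h by rewrite subrK.
apply: le_trans (cabsD _ _) _; rewrite cabsM.
have := cabs_ge0 h; nra.
Qed.

End ComplexDerivative.

(** * Integrals of complex-valued functions on a segment *)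

Section PathIntegral.
Variable R : realType.
Local Notation mu := (@lebesgue_measure R).
Implicit Types (g : R -> R[i]) (a b : R).

(** The Lebesgue integral is real-valued, hence the two parts. *)
Definition cint g a b : R[i] :=
  Complex (\int[mu]_(t in `[a, b]) complex.Re (g t))%R
          (\int[mu]_(t in `[a, b]) complex.Im (g t))%R.

Definition ccont g a b := forall x, a <= x -> x <= b -> forall e : R, 0 < e ->
  exists2 r : R, 0 < r & forall y, `|y - x| < r -> cabs (g y - g x) < e.

Lemma ccont_sub g a b a' b' : a <= a' -> b' <= b -> ccont g a b -> ccont g a' b'.
Proof.
by move=> aa bb H x ax xb; apply: H; [exact: le_trans ax|exact: le_trans bb].
Qed.

Lemma ccont_integrable g a b : ccont g a b ->
  mu.-integrable `[a, b] (EFin \o (fun t => complex.Re (g t))) /\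
  mu.-integrable `[a, b] (EFin \o (fun t => complex.Im (g t))).
Proof.
move=> H; split; apply: continuous_compact_integrable;
  try exact: segment_compact; apply: continuous_in_subspaceT => x;
  rewrite inE /= in_itv /= => /andP[ax xb];
  apply/cvgrPdist_lt => e e0; have [r r0 rH] := H x ax xb e e0;
  near=> y; have : `|y - x| < r by near: y; exists r => //= y; rewrite distrC.
- move=> /rH; apply: le_lt_trans; rewrite -ReB; apply: le_trans (Re_le_cabs _) _.
  by rewrite cabsB.
- move=> /rH; apply: le_lt_trans; rewrite -ImB; apply: le_trans (Im_le_cabs _) _.
  by rewrite cabsB.
Unshelve. all: by end_near. Qed.

Lemma cintD g1 g2 a b : ccont g1 a b -> ccont g2 a b ->
  cint (fun t => g1 t + g2 t) a b = cint g1 a b + cint g2 a b.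
Proof.
move=> /ccont_integrable[r1 i1] /ccont_integrable[r2 i2].
rewrite /cint; under eq_Rintegral do rewrite ReD.
rewrite RintegralD //=; under [X in Complex _ X]eq_Rintegral do rewrite ImD.
by rewrite RintegralD.
Qed.

Lemma cintZ c g a b : ccont g a b ->
  cint (fun t => c * g t) a b = c * cint g a b.
Proof.
move=> /ccont_integrable[r1 i1]; case: c => u v.
rewrite /cint.
have E1 t : complex.Re ((Complex u v) * g t) =
   u * complex.Re (g t) - v * complex.Im (g t) by case: (g t).
have E2 t : complex.Im ((Complex u v) * g t) =
   u * complex.Im (g t) + v * complex.Re (g t) by case: (g t).
under eq_Rintegral do rewrite E1.
under [X in Complex _ X]eq_Rintegral do rewrite E2.
have Z r h : mu.-integrable `[a, b] (EFin \o h) ->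
    mu.-integrable `[a, b] (EFin \o (fun t => r * h t)).
  move=> H; rewrite (_ : EFin \o _ = (fun t => r%:E * (EFin \o h) t)%E).
    exact: integrableZl.
  by apply/funext => t /=; rewrite EFinM.
rewrite RintegralB ?RintegralD ?RintegralZl //; exact: Z.
Qed.

Lemma fine_mu_itv a b : a <= b -> fine (mu `[a, b]%classic) = b - a.
Proof.
move=> ab; rewrite lebesgue_measure_itv /= lte_fin; case: ltP => //= ba.
by have -> : a = b; [apply/eqP; rewrite eq_le ab|rewrite subrr].
Qed.

Lemma cint_cst c a b : a <= b -> cint (fun=> c) a b = (b - a)%:C * c.
Proof.
move=> ab; rewrite /cint !Rintegral_cst // fine_mu_itv //.
by case: c => u v /=; simpc; rewrite !(mulrC (b - a)).
Qed.

Lemma cint_cat m g a b : ccont g a b -> a <= m -> m <= b ->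
  cint g a b = cint g a m + cint g m b.
Proof.
move=> /ccont_integrable[r1 i1] am mb; rewrite /cint.
have H h : mu.-integrable `[a, b] (EFin \o h) ->
    \int[mu]_(t in `[a, b]) h t = \int[mu]_(t in `[a, m]) h t + \int[mu]_(t in `[m, b]) h t.
  move=> I; have := Rintegral_itvB I (x := m).
  rewrite !bnd_simp => /(_ am mb) E.
  rewrite -[LHS](subrK (\int[mu]_(t in `[a, m]) h t)) E addrC; congr (_ + _).
  by apply: Rintegral_itv_obnd_cbnd; apply: integrableS I => //; apply: subset_itvr; rewrite bnd_simp.
by rewrite !H //; simpc.
Qed.

(** The factor 2 comes from bounding the two parts separately. *)
Lemma cint_le g a b M : a <= b -> ccont g a b ->
  (forall x, a <= x -> x <= b -> cabs (g x) <= M) ->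
  cabs (cint g a b) <= 2 * M * (b - a).
Proof.
move=> ab cg gM; have [r1 i1] := ccont_integrable cg.
apply: le_trans (cabs_le_ReIm _) _.
have H h : mu.-integrable `[a, b] (EFin \o h) ->
    (forall x, a <= x -> x <= b -> `|h x| <= M) ->
    `|\int[mu]_(t in `[a, b]) h t| <= M * (b - a).
  move=> I hM; apply: le_trans (le_normr_Rintegral _ I) _ => //.
  have -> : M * (b - a) = \int[mu]_(t in `[a, b]) M.
    by rewrite Rintegral_cst // fine_mu_itv.
  apply: le_Rintegral => //.
  - exact: (integrable_norm I).
  - apply: continuous_compact_integrable; first exact: segment_compact.
    by move=> x; exact: cvg_cst.
  - by move=> x /=; rewrite in_itv /= => /andP[]; exact: hM.
rewrite -mulrA mulrDl !mul1r; apply: lerD; apply: H => // x ax xb /=.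
  exact: le_trans (Re_le_cabs _) (gM _ ax xb).
exact: le_trans (Im_le_cabs _) (gM _ ax xb).
Qed.

Lemma eq_cint g1 g2 a b : (forall x, a <= x -> x <= b -> g1 x = g2 x) ->
  cint g1 a b = cint g2 a b.
Proof.
move=> E; rewrite /cint; congr Complex; apply: eq_Rintegral => x;
  by rewrite inE /= in_itv /= => /andP[ax xb]; rewrite E.
Qed.

End PathIntegral.

(** * Contour integrals along rectangles *)

Ltac cplx := apply/eqP; rewrite eq_complex /=; apply/andP; split; apply/eqP; ring.

Section Goursat.
Variable R : realType.
Implicit Types (f : R[i] -> R[i]) (a b c e : R).

(** Counterclockwise along the boundary of the rectangle with sides a, b and
    c, e: bottom, right, top, left. *)
Definition rectint f a b c e : R[i] :=
  cint (fun x => f (Complex x c)) a b + 'i * cint (fun y => f (Complex b y)) c e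
  - cint (fun x => f (Complex x e)) a b - 'i * cint (fun y => f (Complex a y)) c e.

Definition hcont f y a b := ccont (fun x => f (Complex x y)) a b.
Definition vcont f x c e := ccont (fun y => f (Complex x y)) c e.

Definition rdiff f a b c e := forall x y, a <= x -> x <= b -> c <= y -> y <= e ->
  exists k, cdiff f (Complex x y) k.

Lemma rdiff_sub f a b c e a' b' c' e' :
  a <= a' -> b' <= b -> c <= c' -> e' <= e ->
  rdiff f a b c e -> rdiff f a' b' c' e'.
Proof. by move=> aa bb cc ee H x y ax xb cy ye; apply: H; lra. Qed.

Lemma hcont_diff f y a b :
  (forall x, a <= x -> x <= b -> exists k, cdiff f (Complex x y) k) ->
  hcont f y a b.
Proof.
move=> H x ax xb t t0; have [k /cdiff_continuous] := H x ax xb.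
move=> /(_ t t0)[r r0 rH]; exists r => // x' xx'.
have := rH (x' - x)%:C; rewrite cabs_real => /(_ xx').
by rewrite (_ : Complex x y + _ = Complex x' y) //; cplx.
Qed.

Lemma vcont_diff f x c e :
  (forall y, c <= y -> y <= e -> exists k, cdiff f (Complex x y) k) ->
  vcont f x c e.
Proof.
move=> H y cy ye t t0; have [k /cdiff_continuous] := H y cy ye.
move=> /(_ t t0)[r r0 rH]; exists r => // y' yy'.
have := rH (Complex 0 (y' - y)); rewrite cabsi => /(_ yy').
by rewrite (_ : Complex x y + _ = Complex x y') //; cplx.
Qed.

Lemma rectint_splitx f m a b c e : a <= m -> m <= b ->
  hcont f c a b -> hcont f e a b ->
  rectint f a b c e = rectint f a m c e + rectint f m b c e.
Proof.
move=> am mb hc he; rewrite /rectint (cint_cat hc am mb) (cint_cat he am mb).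
by ring.
Qed.

Lemma rectint_splity f m a b c e : c <= m -> m <= e ->
  vcont f a c e -> vcont f b c e ->
  rectint f a b c e = rectint f a b c m + rectint f a b m e.
Proof.
move=> cm me va vb; rewrite /rectint (cint_cat va cm me) (cint_cat vb cm me).
by ring.
Qed.

Lemma rectint_split4 f m n a b c e : a <= m -> m <= b -> c <= n -> n <= e ->
  rdiff f a b c e -> rectint f a b c e =
  rectint f a m c n + rectint f m b c n + (rectint f a m n e + rectint f m b n e).
Proof.
move=> am mb cn ne H.
rewrite (rectint_splity cn ne).
- rewrite (rectint_splitx am mb) ?(rectint_splitx (c := n) am mb) //;
  apply: hcont_diff => x ax xb; apply: H => //; lra.
- by apply: vcont_diff => y cy ye; apply: H; lra.
- by apply: vcont_diff => y cy ye; apply: H; lra.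
Qed.

Lemma rectint_le f a b c e M : a <= b -> c <= e -> rdiff f a b c e ->
  (forall x y, a <= x -> x <= b -> c <= y -> y <= e -> cabs (f (Complex x y)) <= M) ->
  cabs (rectint f a b c e) <= 4 * M * ((b - a) + (e - c)).
Proof.
move=> ab ce H HM; rewrite /rectint.
have i1 : cabs ('i : R[i]) = 1 by rewrite (cabsi 1) normr1.
have h y : c <= y -> y <= e -> cabs (cint (fun x => f (Complex x y)) a b) <= 2 * M * (b - a).
  move=> cy ye; apply: cint_le => //; last by move=> x ax xb; exact: HM.
  by apply: hcont_diff => x ax xb; exact: H.
have v x : a <= x -> x <= b -> cabs ('i * cint (fun y => f (Complex x y)) c e) <= 2 * M * (e - c).
  move=> ax xb; rewrite cabsM i1 mul1r; apply: cint_le => //; last by move=> y cy ye; exact: HM.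
  by apply: vcont_diff => y cy ye; exact: H.
apply: le_trans (cabsD _ _) _; rewrite cabsN.
apply: (@le_trans _ _ (2 * M * (b - a) + 2 * M * (e - c) + 2 * M * (b - a) + 2 * M * (e - c))); last lra.
apply: lerD; last exact: v.
apply: le_trans (cabsD _ _) _; rewrite cabsN.
apply: lerD; last exact: h.
apply: le_trans (cabsD _ _) _.
by apply: lerD; [exact: h|exact: v].
Qed.

(** Affine functions have a primitive. Subtracting the tangent map at a point makes
    the integrand small near it. *)
Lemma rectint_affine f a b c e (k z0 w0 : R[i]) : a <= b -> c <= e ->
  rdiff f a b c e ->
  rectint f a b c e = rectint (fun z => f z - w0 - k * (z - z0)) a b c e.
Proof.
move=> ab ce H.
pose g z := - w0 - k * (z - z0) : R[i].
have gd z : cdiff g z (- k).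
  move=> t t0; exists 1 => // h _.
  rewrite (_ : g _ - _ - _ = 0) ?cabs0 ?mulr_ge0 ?cabs_ge0 // ?ltW //.
  by rewrite /g; ring.
have gh y : hcont g y a b by apply: hcont_diff => x _ _; exists (- k).
have gv x : vcont g x c e by apply: vcont_diff => y _ _; exists (- k).
have fh y : c <= y -> y <= e -> hcont f y a b.
  by move=> cy ye; apply: hcont_diff => x ax xb; exact: H.
have fv x : a <= x -> x <= b -> vcont f x c e.
  by move=> ax xb; apply: vcont_diff => y cy ye; exact: H.
have -> : rectint (fun z => f z - w0 - k * (z - z0)) a b c e =
    rectint f a b c e + rectint g a b c e.
  have -> : (fun z => f z - w0 - k * (z - z0)) = (fun z => f z + g z).
    by apply/funext => z; rewrite /g; ring.
  rewrite /rectint.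
  rewrite (cintD (fh c (lexx _) ce) (gh c)) (cintD (fh e ce (lexx _)) (gh e)).
  rewrite (cintD (fv a (lexx _) ab) (gv a)) (cintD (fv b ab (lexx _)) (gv b)).
  by ring.
suff -> : rectint g a b c e = 0 by rewrite addr0.
rewrite /rectint.
have hz : cint (fun x => g (Complex x c)) a b =
   cint (fun x => g (Complex x e)) a b + (b - a)%:C * (k * Complex 0 (e - c)).
  rewrite -cint_cst // -cintD; first last.
  - by move=> x _ _ t t0; exists 1 => // y _; rewrite subrr cabs0.
  - exact: gh.
  apply: eq_cint => x _ _; rewrite /g.
  have -> : Complex 0 (e - c) = Complex x e - Complex x c by cplx.
  by ring.
have vt : cint (fun y => g (Complex b y)) c e =
   cint (fun y => g (Complex a y)) c e + (e - c)%:C * (- k * (b - a)%:C).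
  rewrite -cint_cst // -cintD; first last.
  - by move=> x _ _ t t0; exists 1 => // y _; rewrite subrr cabs0.
  - exact: gv.
  apply: eq_cint => y _ _; rewrite /g.
  have -> : (b - a)%:C = Complex b y - Complex a y by cplx.
  by ring.
rewrite hz vt.
have -> : Complex 0 (e - c) = 'i * (e - c)%:C by cplx.
by ring.
Qed.

End Goursat.

(** * Goursat's theorem *)

Section GoursatTheorem.
Variable R : realType.
Implicit Types (f : R[i] -> R[i]) (a b c e : R).

Lemma nested_point (u : nat -> R) (l : nat -> R) :
  (forall n, u n <= u n.+1) -> (forall n, u n.+1 + l n.+1 <= u n + l n) ->
  (forall n, 0 <= l n) ->
  exists x, forall n, u n <= x /\ x <= u n + l n.
Proof.
move=> uS lS l0.
have um n k : u n <= u (n + k)%N.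
  by elim: k => [|k]; rewrite ?addn0 // addnS => /le_trans; apply.
have lm n k : u (n + k)%N + l (n + k)%N <= u n + l n.
  by elim: k => [|k]; rewrite ?addn0 // addnS => H; apply: le_trans H; exact: lS.
have ub n m : u m <= u n + l n.
  have [mn|nm] := leqP m n.
    by apply: le_trans (um m (n - m)%N) _; rewrite subnKC // lerDl.
  by have := lm n (m - n)%N; rewrite subnKC ?(ltnW nm) //; have := l0 m; lra.
exists (sup (range u)) => n; split.
  apply: sup_upper_bound; last by exists n.
  by split; [exists (u 0%N), 0%N|exists (u 0%N + l 0%N) => _ [m _ <-]; exact: ub].
by apply: sup_le_ub; [exists (u 0%N), 0%N|move=> _ [m _ <-]; exact: ub].
Qed.

Lemma rectint_quarter f p q w h kap : 0 <= w -> 0 <= h ->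
  rdiff f p (p + 2 * w) q (q + 2 * h) ->
  4 * kap < cabs (rectint f p (p + 2 * w) q (q + 2 * h)) ->
  exists p' q', [/\ p <= p', p' <= p + w, q <= q', q' <= q + h &
    kap < cabs (rectint f p' (p' + w) q' (q' + h))].
Proof.
move=> w0 h0 H; pose p' := p + w; pose q' := q + h.
have pp' : p <= p' by rewrite lerDl.
have qq' : q <= q' by rewrite lerDl.
have Ep : p + 2 * w = p' + w by rewrite /p'; ring.
have Eq : q + 2 * h = q' + h by rewrite /q'; ring.
have pp'' : p' <= p' + w by rewrite lerDl.
have qq'' : q' <= q' + h by rewrite lerDl.
rewrite Ep Eq in H *.
rewrite (rectint_split4 pp' pp'' qq' qq'' H) => B.
have {B} := lt_le_trans B (le_trans (cabsD _ _) (lerD (cabsD _ _) (cabsD _ _))).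
have [L1 _|L1] := ltP kap (cabs (rectint f p p' q q')).
  by exists p, q; split.
have [L2 _|L2] := ltP kap (cabs (rectint f p' (p' + w) q q')).
  by exists p', q; split.
have [L3 _|L3] := ltP kap (cabs (rectint f p p' q' (q' + h))).
  by exists p, q'; split.
have [L4 _|L4] := ltP kap (cabs (rectint f p' (p' + w) q' (q' + h))).
  by exists p', q'; split.
clear - L1 L2 L3 L4.
move: L1 L2 L3 L4; do 4 (move: (cabs (rectint _ _ _ _ _)) => ?); lra.
Qed.

(** Goursat: quadrisection. A rectangle with nonzero contour integral contains
    quarters whose integrals do not shrink faster than their areas, and this
    contradicts complex differentiability at their common point. *)
Lemma goursat f a b c e : a <= b -> c <= e -> rdiff f a b c e ->
  rectint f a b c e = 0.
Proof.
move=> ab ce H; apply/eqP/negPn/negP => J0.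
pose w := b - a; pose h := e - c; pose s n : R := 2^-1 ^+ n.
have w0 : 0 <= w by rewrite subr_ge0.
have h0 : 0 <= h by rewrite subr_ge0.
have s0 n : 0 < s n by rewrite exprn_gt0 // invr_gt0.
have sS n : s n = 2 * s n.+1 by rewrite /s exprS; field.
pose kap := cabs (rectint f a b c e) / 2.
have kap0 : 0 < kap by rewrite divr_gt0 // cabs_gt0.
pose bad n (p : R * R) := [/\ a <= p.1, p.1 + w * s n <= b, c <= p.2,
  p.2 + h * s n <= e & kap * s n ^+ 2 <
  cabs (rectint f p.1 (p.1 + w * s n) p.2 (p.2 + h * s n))].
have step (x : nat * (R * R)) : exists q : R * R, bad x.1 x.2 ->
    [/\ bad x.1.+1 q, x.2.1 <= q.1, q.1 + w * s x.1.+1 <= x.2.1 + w * s x.1,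
      x.2.2 <= q.2 & q.2 + h * s x.1.+1 <= x.2.2 + h * s x.1].
  have [B|nB] := pselect (bad x.1 x.2); last by exists 0.
  move: x B => [n [p q]] /= [/= ap pb cq qe B].
  have ws := mulr_ge0 w0 (ltW (s0 n.+1)); have hs := mulr_ge0 h0 (ltW (s0 n.+1)).
  have Ew : w * s n = 2 * (w * s n.+1) by rewrite sS mulrCA.
  have Eh : h * s n = 2 * (h * s n.+1) by rewrite sS mulrCA.
  have Ek : kap * s n ^+ 2 = 4 * (kap * s n.+1 ^+ 2) by rewrite sS; ring.
  rewrite Ew Eh Ek in pb qe B *.
  have Hr : rdiff f p (p + 2 * (w * s n.+1)) q (q + 2 * (h * s n.+1)).
    exact: rdiff_sub H.
  have [p' [q' [p1 p2 q1 q2 B']]] := rectint_quarter ws hs Hr B.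
  exists (p', q') => _.
  have P2 : p' + w * s n.+1 <= p + 2 * (w * s n.+1).
    by clear - p2; move: p2; move: (w * s n.+1) => X; lra.
  have Q2 : q' + h * s n.+1 <= q + 2 * (h * s n.+1).
    by clear - q2; move: q2; move: (h * s n.+1) => X; lra.
  split => //=; split => //=.
  - exact: le_trans ap p1.
  - exact: le_trans P2 pb.
  - exact: le_trans cq q1.
  - exact: le_trans Q2 qe.
have [F HF] := choice step.
pose u := fix u n := if n is m.+1 then F (m, u m) else (a, c).
have Bu n : bad n (u n).
  elim: n => [|n IH]; last by have [] := HF (n, u n) IH.
  have Ew : a + w * s 0%N = b by rewrite /s expr0 mulr1 /w addrC subrK.
  have Eh : c + h * s 0%N = e by rewrite /s expr0 mulr1 /h addrC subrK.
  rewrite /bad /= Ew Eh; split=> //.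
  by rewrite /s expr0 expr1n mulr1 /kap ltr_pdivrMr ?ltr0Sn // ltr_pMr ?cabs_gt0 // ltr1n.
have [x0 Hx] := @nested_point (fun n => (u n).1) (fun n => w * s n)
  (fun n => let: And5 _ h1 _ _ _ := HF (n, u n) (Bu n) in h1)
  (fun n => let: And5 _ _ h1 _ _ := HF (n, u n) (Bu n) in h1)
  (fun n => mulr_ge0 w0 (ltW (s0 n))).
have [y0 Hy] := @nested_point (fun n => (u n).2) (fun n => h * s n)
  (fun n => let: And5 _ _ _ h1 _ := HF (n, u n) (Bu n) in h1)
  (fun n => let: And5 _ _ _ _ h1 := HF (n, u n) (Bu n) in h1)
  (fun n => mulr_ge0 h0 (ltW (s0 n))).
have [k Hk] : exists k, cdiff f (Complex x0 y0) k.
  have := Hx 0%N; have := Hy 0%N; rewrite /= /s expr0 !mulr1 => -[y1 y2] [x1 x2].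
  by apply: H; rewrite /w /h in x2 y2; lra.
pose W := w + h + 1; have W0 : 0 < W by apply: ltr_wpDl; [exact: addr_ge0|exact: ltr01].
pose ep := kap / (8 * W ^+ 2).
have ep0 : 0 < ep by rewrite divr_gt0 // mulr_gt0 // exprn_gt0.
have [r r0 rH] := Hk ep ep0.
have [n Wn] : exists n, W * s n < r.
  have : (s n : R) @[n --> \oo] --> (0 : R).
    by apply: cvg_expr; rewrite ger0_norm ?invr_ge0 // invf_lt1 // ltr1n.
  move=> /cvgrPdist_lt /(_ (r / W) (divr_gt0 r0 W0)) [N _ HN]; exists N.
  have := HN N (leqnn N); rewrite /= sub0r normrN ger0_norm ?(ltW (s0 _)) //.
  by rewrite ltr_pdivlMr // mulrC.
have [ap pb cq qe] := Bu n; apply/negP; rewrite -leNgt.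
have [x1 x2] := Hx n; have [y1 y2] := Hy n.
move: (u n).1 (u n).2 ap pb cq qe x1 x2 y1 y2 => p q ap pb cq qe x1 x2 y1 y2.
have ws := mulr_ge0 w0 (ltW (s0 n)); have hs := mulr_ge0 h0 (ltW (s0 n)).
have Hr : rdiff f p (p + w * s n) q (q + h * s n) by apply: rdiff_sub H.
rewrite (rectint_affine k (Complex x0 y0) (f (Complex x0 y0))) ?lerDl //.
have Hd : rdiff (fun z => f z - f (Complex x0 y0) - k * (z - Complex x0 y0))
    p (p + w * s n) q (q + h * s n).
  move=> x y ax xb cy ye; have [k' Hk'] := Hr x y ax xb cy ye.
  exists (k' - k) => t t0; have [r' r'0 Hr'] := Hk' t t0; exists r' => // hh /Hr'.
  rewrite (_ : f (Complex x y + hh) - _ - _ - _ - _ =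
     f (Complex x y + hh) - f (Complex x y) - k' * hh) //; ring.
apply: le_trans (rectint_le _ _ Hd (M := ep * (W * s n)) _) _.
- by rewrite lerDl.
- by rewrite lerDl.
- move=> x y ax xb cy ye.
  have dz : cabs (Complex x y - Complex x0 y0) <= W * s n.
    have dx : `|x - x0| <= w * s n.
      by clear - ax xb x1 x2; rewrite ler_norml; apply/andP; split; lra.
    have dy : `|y - y0| <= h * s n.
      by clear - cy ye y1 y2; rewrite ler_norml; apply/andP; split; lra.
    apply: le_trans (cabs_le_ReIm _) _ => /=.
    rewrite /W mulrDl mul1r [(w + h) * _]mulrDl.
    by apply: le_trans (lerD dx dy) _; rewrite lerDl ltW.
  have := rH _ (le_lt_trans dz Wn); rewrite [Complex x0 y0 + _]addrC subrK.
  by move=> /le_trans; apply; rewrite ler_pM2l.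
rewrite !(addrC p) !(addrC q) !addrK.
have -> : 4 * (ep * (W * s n)) * (w * s n + h * s n) =
  (kap * s n ^+ 2) * ((w + h) / (2 * W)).
  by rewrite /ep; field; rewrite gt_eqF.
apply: ler_piMr; first by rewrite mulr_ge0 ?sqr_ge0 // ltW.
rewrite ler_pdivrMr ?mulr_gt0 // mul1r /W.
by have := addr_ge0 w0 h0; move: (w + h) => X; lra.
Qed.

End GoursatTheorem.

(** * Isolated singularities *)

Section Cauchy.
Variable R : realType.
Implicit Types (f g : R[i] -> R[i]) (a b c e : R).

Definition sdiff f z := exists k, cdiff f z k.

Lemma sdiffP f z : sdiff f z <-> derivable f z (1 : R[i]).
Proof.
split=> [[k /cdiff_derive]|/derivableP H]; first by case.
by exists ('D_1 f z); apply: derive_cdiff.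
Qed.

Lemma sdiff_cst k z : sdiff (fun=> k) z.
Proof. by exists 0 => e e0; exists 1 => // h _; rewrite subrr mul0r subr0 cabs0 mulr_ge0 ?cabs_ge0 ?ltW. Qed.

Lemma sdiff_id z : sdiff id z.
Proof. exact/sdiffP/derivable_id. Qed.

Lemma sdiffD f g z : sdiff f z -> sdiff g z -> sdiff (fun w => f w + g w) z.
Proof. move=> /sdiffP df /sdiffP dg; exact/sdiffP/(derivableD df dg). Qed.

Lemma sdiffB f g z : sdiff f z -> sdiff g z -> sdiff (fun w => f w - g w) z.
Proof. move=> /sdiffP df /sdiffP dg; exact/sdiffP/(derivableB df dg). Qed.

Lemma sdiffM f g z : sdiff f z -> sdiff g z -> sdiff (fun w => f w * g w) z.
Proof. move=> /sdiffP df /sdiffP dg; exact/sdiffP/(derivableM df dg). Qed.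

Lemma sdiffV f z : f z != 0 -> sdiff f z -> sdiff (fun w => (f w)^-1) z.
Proof. move=> f0 /sdiffP df; exact/sdiffP/(derivableV f0 df). Qed.

Lemma sdiff_invB w z : z != w -> sdiff (fun x => (x - w)^-1) z.
Proof.
move=> zw; apply: (@sdiffV (fun x => x - w)); first by rewrite subr_eq0.
exact: (sdiffB (sdiff_id z) (sdiff_cst w z)).
Qed.

Definition onedge a b c e x y := [/\ a <= x, x <= b, c <= y, y <= e &
  [\/ x = a, x = b, y = c | y = e]].

(** Only the contour matters for the integral; points inside may be singular. *)
Definition ediff f a b c e :=
  forall x y, onedge a b c e x y -> sdiff f (Complex x y).

Lemma ediff_cont f a b c e : a <= b -> c <= e -> ediff f a b c e ->
  [/\ hcont f c a b, hcont f e a b, vcont f a c e & vcont f b c e].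
Proof.
move=> ab ce H; split; [apply: hcont_diff|apply: hcont_diff|
   apply: vcont_diff|apply: vcont_diff] => x h1 h2; apply: H; split=> //.
- by constructor 3.
- by constructor 4.
- by constructor 1.
- by constructor 2.
Qed.

Lemma rectintD f g a b c e : a <= b -> c <= e ->
  ediff f a b c e -> ediff g a b c e ->
  rectint (fun z => f z + g z) a b c e = rectint f a b c e + rectint g a b c e.
Proof.
move=> ab ce /(ediff_cont ab ce)[f1 f2 f3 f4] /(ediff_cont ab ce)[g1 g2 g3 g4].
rewrite /rectint (cintD f1 g1) (cintD f2 g2) (cintD f3 g3) (cintD f4 g4).
by ring.
Qed.

Lemma rectintZ k f a b c e : a <= b -> c <= e -> ediff f a b c e ->
  rectint (fun z => k * f z) a b c e = k * rectint f a b c e.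
Proof.
move=> ab ce /(ediff_cont ab ce)[f1 f2 f3 f4].
rewrite /rectint (cintZ k f1) (cintZ k f2) (cintZ k f3) (cintZ k f4).
by ring.
Qed.

Lemma eq_rectint f g a b c e : a <= b -> c <= e ->
  (forall x y, onedge a b c e x y -> f (Complex x y) = g (Complex x y)) ->
  rectint f a b c e = rectint g a b c e.
Proof.
move=> ab ce H; rewrite /rectint.
congr (_ + 'i * _ - _ - 'i * _); apply: eq_cint => x h1 h2; apply: H; split=> //.
- by constructor 3.
- by constructor 2.
- by constructor 4.
- by constructor 1.
Qed.

Lemma rectint_le_edge f a b c e M : a <= b -> c <= e -> ediff f a b c e ->
  (forall x y, onedge a b c e x y -> cabs (f (Complex x y)) <= M) ->
  cabs (rectint f a b c e) <= 4 * M * ((b - a) + (e - c)).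
Proof.
move=> ab ce /(ediff_cont ab ce)[f1 f2 f3 f4] HM; rewrite /rectint.
have i1 : cabs ('i : R[i]) = 1 by rewrite (cabsi 1) normr1.
apply: (@le_trans _ _ (2 * M * (b - a) + 2 * M * (e - c) + 2 * M * (b - a) + 2 * M * (e - c))); last lra.
apply: le_trans (cabsD _ _) _; rewrite cabsN.
apply: lerD; last first.
  rewrite cabsM i1 mul1r; apply: cint_le => // y h1 h2; apply: HM; split=> //.
  by constructor 1.
apply: le_trans (cabsD _ _) _; rewrite cabsN.
apply: lerD; last first.
  by apply: cint_le => // y h1 h2; apply: HM; split=> //; constructor 4.
apply: le_trans (cabsD _ _) _; apply: lerD.
  by apply: cint_le => // y h1 h2; apply: HM; split=> //; constructor 3.
rewrite cabsM i1 mul1r; apply: cint_le => // y h1 h2; apply: HM; split=> //.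
by constructor 2.
Qed.

(** The rectangles surrounding the small square avoid the singular point, hence
    contribute nothing by [goursat]. *)
Lemma rectint_shrink f a b c e u v (t : R) : 0 < t ->
  a <= u - t -> u + t <= b -> c <= v - t -> v + t <= e ->
  (forall x y, a <= x -> x <= b -> c <= y -> y <= e -> (x, y) <> (u, v) ->
     sdiff f (Complex x y)) ->
  rectint f a b c e = rectint f (u - t) (u + t) (v - t) (v + t).
Proof.
move=> t0 au ub cv ve H.
have h1 y : c <= y -> y <= e -> y <> v -> hcont f y a b.
  by move=> cy ye yv; apply: hcont_diff => x ax xb; apply: H => // -[].
have v1 x : a <= x -> x <= b -> x <> u -> vcont f x c e.
  by move=> ax xb xu; apply: vcont_diff => y cy ye; apply: H => // -[].
have lt1 (x z : R) : x < z -> x <> z by move=> /[swap] ->; rewrite ltxx.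
have lt2 (x z : R) : x < z -> z <> x by move=> /[swap] ->; rewrite ltxx.
have hc : hcont f c a b by apply: h1; [lra|lra|apply: lt1; lra].
have he : hcont f e a b by apply: h1; [lra|lra|apply: lt2; lra].
rewrite (@rectint_splitx _ f (u - t) a b) //; last lra.
have -> : rectint f a (u - t) c e = 0.
  apply: goursat; [lra|lra|] => x y ax xb cy ye; apply: H => //; first lra.
  by case=> xu _; lra.
have hc' : hcont f c (u - t) b by apply: ccont_sub hc.
have he' : hcont f e (u - t) b by apply: ccont_sub he.
rewrite add0r (@rectint_splitx _ f (u + t) (u - t) b) //; last lra.
have -> : rectint f (u + t) b c e = 0.
  apply: goursat; [lra|lra|] => x y ax xb cy ye; apply: H => //; first lra.
  by case=> xu _; lra.
have va : vcont f (u - t) c e by apply: v1; [lra|lra|apply: lt1; lra].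
have vb : vcont f (u + t) c e by apply: v1; [lra|lra|apply: lt2; lra].
rewrite addr0 (@rectint_splity _ f (v - t) (u - t) (u + t)) //; last lra.
have -> : rectint f (u - t) (u + t) c (v - t) = 0.
  apply: goursat; [lra|lra|] => x y ax xb cy ye; apply: H; [lra|lra|lra|lra|].
  by case=> _ xu; lra.
have va' : vcont f (u - t) (v - t) e by apply: ccont_sub va.
have vb' : vcont f (u + t) (v - t) e by apply: ccont_sub vb.
rewrite add0r (@rectint_splity _ f (v + t) (u - t) (u + t)) //; last lra.
have -> : rectint f (u - t) (u + t) (v + t) e = 0.
  apply: goursat; [lra|lra|] => x y ax xb cy ye; apply: H; [lra|lra|lra|lra|].
  by case=> _ xu; lra.
by rewrite addr0.
Qed.

(** The integral equals that over arbitrarily small squares around the point,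
    which tends to 0 when the function is bounded there. *)
Lemma rectint_punctured f a b c e u v (t M : R) : 0 < t ->
  a <= u - t -> u + t <= b -> c <= v - t -> v + t <= e ->
  (forall x y, a <= x -> x <= b -> c <= y -> y <= e -> (x, y) <> (u, v) ->
     sdiff f (Complex x y)) ->
  (forall z, cabs (z - Complex u v) < t -> cabs (f z) <= M) ->
  rectint f a b c e = 0.
Proof.
move=> t0 au ub cv ve H HM; apply/eqP/negPn/negP => J0.
have J1 := cabs_gt0 J0.
pose M' := `|M| + 1; have M0 : 0 < M' by rewrite ltr_wpDl.
pose s := Num.min (t / 3) (cabs (rectint f a b c e) / (32 * M')).
have s0 : 0 < s by rewrite lt_min !divr_gt0 // mulr_gt0.
have st : s <= t / 3 by rewrite ge_min lexx.
have sJ : s * (32 * M') <= cabs (rectint f a b c e).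
  by rewrite -ler_pdivlMr ?mulr_gt0 // ge_min lexx orbT.
have : cabs (rectint f a b c e) <= 4 * M' * (2 * s + 2 * s).
  rewrite (@rectint_shrink f a b c e u v s) //; try lra.
  apply: le_trans (rectint_le_edge (M := M') _ _ _ _) _.
  - lra.
  - lra.
  - move=> x y [ax xb cy ye E]; apply: H; [lra|lra|lra|lra|].
    by case=> xu yv; case: E => E; lra.
  - move=> x y [ax xb cy ye E]; apply: le_trans (HM _ _) _; last first.
      by rewrite /M'; apply: le_trans (ler_norm _) _; rewrite lerDl.
    apply: le_lt_trans (cabs_le_ReIm _) _ => /=.
    have : `|x - u| <= s by rewrite ler_norml; apply/andP; split; lra.
    have : `|y - v| <= s by rewrite ler_norml; apply/andP; split; lra.
    by move: (`|x - u|) (`|y - v|) => p q hp hq; lra.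
  by rewrite le_eqVlt; apply/orP; left; apply/eqP; ring.
rewrite leNgt => /negP; apply; apply: lt_le_trans sJ.
have := mulr_gt0 s0 M0; lra.
Qed.

End Cauchy.

(** * Cauchy's estimate *)

Section CauchyEstimate.
Variable R : realType.
Implicit Types (f g : R[i] -> R[i]).
Local Notation mu := (@lebesgue_measure R).

Lemma Rint_ge (h : R -> R) a b m : a <= b -> mu.-integrable `[a, b] (EFin \o h) ->
  (forall x, a <= x -> x <= b -> m <= h x) ->
  m * (b - a) <= \int[mu]_(t in `[a, b]) h t.
Proof.
move=> ab I H.
have -> : m * (b - a) = \int[mu]_(t in `[a, b]) m.
  by rewrite Rintegral_cst // fine_mu_itv.
apply: le_Rintegral => //.
- apply: continuous_compact_integrable; first exact: segment_compact.
  by move=> x; exact: cvg_cst.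
- by move=> x /=; rewrite in_itv /= => /andP[]; exact: H.
Qed.

Lemma Rint_le (h : R -> R) a b m : a <= b -> mu.-integrable `[a, b] (EFin \o h) ->
  (forall x, a <= x -> x <= b -> h x <= m) ->
  \int[mu]_(t in `[a, b]) h t <= m * (b - a).
Proof.
move=> ab I H.
have -> : m * (b - a) = \int[mu]_(t in `[a, b]) m.
  by rewrite Rintegral_cst // fine_mu_itv.
apply: le_Rintegral => //.
- apply: continuous_compact_integrable; first exact: segment_compact.
  by move=> x; exact: cvg_cst.
- by move=> x /=; rewrite in_itv /= => /andP[]; exact: H.
Qed.

Local Notation h2 := (2^-1 : R).
Local Notation oint f := (rectint f (- h2) h2 (- h2) h2).
Local Notation onsq x y := (onedge (- h2) h2 (- h2) h2 x y).

Let h2h2 : - h2 <= h2. Proof. lra. Qed.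

Lemma frac_bound (p q : R) : `|p| <= 5 / 8 -> 3 / 8 <= q -> q <= 5 / 8 ->
  3 / 8 <= q / (p ^+ 2 + q ^+ 2).
Proof.
move=> p1 q1 q2; have p2 : p ^+ 2 <= 25 / 64.
  rewrite -real_normK ?num_real //; have := normr_ge0 p; nra.
have q3 : q ^+ 2 <= 25 / 64 by nra.
have q0 : 0 < q ^+ 2 by rewrite exprn_gt0 //; lra.
have p0 := sqr_ge0 p.
rewrite ler_pdivlMr; nra.
Qed.

Lemma edge_far x y (h : R[i]) : onsq x y -> cabs h <= 8^-1 ->
  3 / 8 <= cabs (Complex x y - h).
Proof.
move=> [ax xb cy ye E] hh.
have := Re_le_cabs (Complex x y - h); have := Im_le_cabs (Complex x y - h).
have := Re_le_cabs h; have := Im_le_cabs h.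
case: h hh => u v /=.
move: (cabs (Complex u v)) (cabs (_ - _)) => C1 C2 hh.
rewrite !ler_norml => /andP[h1 h3] /andP[h4 h5] /andP[h6 h7] /andP[h8 h9].
by case: E => E; lra.
Qed.

Lemma edge_in x y : onsq x y -> cabs (Complex x y) < 1.
Proof.
move=> [ax xb cy ye E]; have := cabs_sqr (Complex x y) => /=.
have := cabs_ge0 (Complex x y); move: (cabs _) => C C0 CE.
have : C ^+ 2 < 1 by rewrite CE; nra.
by rewrite expr_lt1.
Qed.

Lemma edge_neq x y (h : R[i]) : onsq x y -> cabs h <= 8^-1 -> Complex x y != h.
Proof.
move=> e hh; have := edge_far e hh; apply: contraTN => /eqP ->.
by rewrite subrr cabs0 -ltNge divr_gt0.
Qed.

Lemma ediff_inv (h : R[i]) : cabs h <= 8^-1 ->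
  ediff (fun z => (z - h)^-1) (- h2) h2 (- h2) h2.
Proof. by move=> hh x y e; apply: sdiff_invB; exact: edge_neq. Qed.

(** Cauchy's formula divides by this integral, so a lower bound can replace its
    value 2 pi i. Each side of the square contributes at least 3 / 8 to the
    imaginary part. *)
Lemma winding_ge (h : R[i]) : cabs h <= 8^-1 ->
  3 / 2 <= cabs (oint (fun z => (z - h)^-1)).
Proof.
move=> hh; apply: le_trans (le_trans (ler_norm _) (Im_le_cabs _)).
have I (A B C1 D : R[i]) : complex.Im (A + 'i * B - C1 - 'i * D) =
    complex.Im A + complex.Re B - complex.Im C1 - complex.Re D.
  by case: A B C1 D => ? ? [? ?] [? ?] [? ?] /=; rewrite !(mul0r, mul1r, add0r).
rewrite /rectint I /cint [complex.Im (Complex _ _)]/= [complex.Re (Complex _ _)]/=.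
have [c1 c2 c3 c4] := ediff_cont h2h2 h2h2 (ediff_inv hh).
have := Re_le_cabs h; have := Im_le_cabs h.
case: h hh c1 c2 c3 c4 => u v /=.
move: (cabs (Complex u v)) => C hh c1 c2 c3 c4.
rewrite !ler_norml => /andP[v1 v2] /andP[u1 u2].
have [_ i1] := ccont_integrable c1.
have [_ i2] := ccont_integrable c2.
have [r3 _] := ccont_integrable c3.
have [r4 _] := ccont_integrable c4.
have l0 : h2 - - h2 = 1 by lra.
have B1 := Rint_ge (m := 3 / 8) h2h2 i1.
have B2 := Rint_le (m := - (3 / 8)) h2h2 i2.
have B3 := Rint_le (m := - (3 / 8)) h2h2 r3.
have B4 := Rint_ge (m := 3 / 8) h2h2 r4.
rewrite l0 mulr1 in B1 B2 B3 B4.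
apply: le_trans (lerB (lerB (lerD (B1 _) (B4 _)) (B2 _)) (B3 _)); first lra.
- move=> x x1 x2.
  have -> : complex.Im ((Complex x (- h2) - Complex u v)^-1) =
     (h2 + v) / ((x - u) ^+ 2 + (h2 + v) ^+ 2).
    by rewrite /= -(sqrrN (h2 + v)) opprD -mulNr opprD !opprK.
  by clear - v1 v2 u1 u2 hh x1 x2; apply: frac_bound; rewrite ?ler_norml; [apply/andP; split|..]; lra.
- move=> x x1 x2.
  have -> : complex.Re ((Complex h2 x - Complex u v)^-1) =
     (h2 - u) / ((x - v) ^+ 2 + (h2 - u) ^+ 2) by rewrite /= [in RHS](addrC ((x - v) ^+ 2)).
  by clear - v1 v2 u1 u2 hh x1 x2; apply: frac_bound; rewrite ?ler_norml; [apply/andP; split|..]; lra.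
- move=> x x1 x2; rewrite lerNr.
  have -> : - complex.Im ((Complex x h2 - Complex u v)^-1) =
     (h2 - v) / ((x - u) ^+ 2 + (h2 - v) ^+ 2) by rewrite /= opprK.
  by clear - v1 v2 u1 u2 hh x1 x2; apply: frac_bound; rewrite ?ler_norml; [apply/andP; split|..]; lra.
- move=> x x1 x2; rewrite lerNr.
  have -> : - complex.Re ((Complex (- h2) x - Complex u v)^-1) =
     (h2 + u) / ((x - v) ^+ 2 + (h2 + u) ^+ 2).
    by rewrite /= -(sqrrN (h2 + u)) opprD [in RHS](addrC ((x - v) ^+ 2)) -mulNr opprD !opprK.
  by clear - v1 v2 u1 u2 hh x1 x2; apply: frac_bound; rewrite ?ler_norml; [apply/andP; split|..]; lra.
Qed.

(** Let g = f - f(0), and let N(h) be the integral of 1 / (z - h) over the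
    contour. The quotient (f(z) - f(h)) / (z - h) has a bounded singularity, so
    the integral of g(z) / (z - h) is g(h) N(h). Expanding
    1 / (z - h) = 1 / z + h / (z (z - h)) twice gives g(h) up to the order two,
    with constants that depend on M alone. *)
Lemma holo_taylor f (M : R) :
  (forall z, cabs z < 1 -> sdiff f z) -> (forall z, cabs z < 1 -> cabs (f z) <= M) ->
  exists2 a, cabs a <= 128 * M & forall h, cabs h <= 8^-1 ->
    cabs (f h - f 0 - a * h) <= 6000 * M * cabs h ^+ 2.
Proof.
move=> fd fM.
have M0 : 0 <= M by apply: le_trans (cabs_ge0 (f 0)) (fM 0 _); rewrite cabs0.
pose g z := f z - f 0.
have gd z : cabs z < 1 -> sdiff g z.
  by move=> z1; apply: sdiffB; [exact: fd|exact: sdiff_cst].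
have gM z : cabs z < 1 -> cabs (g z) <= 2 * M.
  move=> z1; apply: le_trans (cabsD _ _) _; rewrite cabsN mulrDl mul1r.
  by apply: lerD; apply: fM; rewrite ?cabs0.
have c08 : cabs (0 : R[i]) <= 8^-1 by rewrite cabs0 invr_ge0.
pose I h z : R[i] := (z - h)^-1.
have Id h : cabs h <= 8^-1 -> forall x y, onsq x y -> sdiff (I h) (Complex x y).
  by move=> hh x y e; exact: ediff_inv.
have Ib h x y : cabs h <= 8^-1 -> onsq x y -> cabs (I h (Complex x y)) <= 8 / 3.
  move=> hh e; rewrite /I cabsV -[leRHS]invf_div lef_pV2 ?posrE.
  - exact: edge_far.
  - by apply: lt_le_trans (edge_far e hh); rewrite divr_gt0.
  - by rewrite divr_gt0.
pose N h := oint (I h).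
have N0 h : cabs h <= 8^-1 -> N h != 0.
  move=> hh; apply/eqP => E; have := winding_ge hh; rewrite -/(N h) E cabs0; lra.
have gI h : cabs h <= 8^-1 -> oint (fun z => g z * I h z) = g h * N h.
  move=> hh.
  have ed1 : ediff (fun z => (f z - f h) * I h z) (- h2) h2 (- h2) h2.
    move=> x y e; apply: sdiffM; last exact: Id.
    by apply: sdiffB; [apply: fd; exact: edge_in|exact: sdiff_cst].
  have ed2 : ediff (fun z => g h * I h z) (- h2) h2 (- h2) h2.
    by move=> x y e; apply: sdiffM; [exact: sdiff_cst|exact: Id].
  rewrite (_ : (fun z => g z * I h z) =
      (fun z => (f z - f h) * I h z + g h * I h z)); last first.
    by apply/funext => z; rewrite /g; ring.
  rewrite rectintD // rectintZ //; last by move=> x y; exact: Id.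
  rewrite [X in X + _](_ : _ = 0) ?add0r //.
  have h1 : cabs h < 1 by apply: le_lt_trans hh _; rewrite invf_lt1 // ltr1n.
  have [k /(_ 1 ltr01)[r r0 rH]] := fd h h1.
  have hr := Re_le_cabs h; have hi := Im_le_cabs h.
  pose t := Num.min r (4^-1).
  have t0 : 0 < t by rewrite lt_min r0 invr_gt0 ltr0n.
  have t1 : t <= 4^-1 by rewrite ge_min lexx orbT.
  have := hr; have := hi; rewrite !ler_norml => /andP[i1 i2] /andP[r1 r2].
  apply: (@rectint_punctured _ _ _ _ _ _ (complex.Re h) (complex.Im h) t (1 + cabs k)).
  - by [].
  - by clear - t1 r1 r2 hh; lra.
  - by clear - t1 r1 r2 hh; lra.
  - by clear - t1 i1 i2 hh; lra.
  - by clear - t1 i1 i2 hh; lra.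
  - move=> x y ax xb cy ye xy; apply: sdiffM; last first.
      apply: sdiff_invB; apply/eqP => E; apply: xy; by rewrite -E.
    apply: sdiffB; last exact: sdiff_cst.
    apply: fd; have := cabs_sqr (Complex x y) => /=.
    have := cabs_ge0 (Complex x y); move: (cabs _) => C C0 CE.
    have : C ^+ 2 < 1 by rewrite CE; clear - ax xb cy ye; nra.
    by rewrite expr_lt1.
  - move=> z; rewrite (_ : Complex _ _ = h); last by case: (h).
    move=> zt; have zr : cabs (z - h) < r by apply: lt_le_trans zt _; rewrite ge_min lexx.
    have := rH _ zr; rewrite (addrC h) subrK mul1r => H.
    have [->|zh] := eqVneq z h.
      by rewrite subrr mul0r cabs0 addr_ge0 ?cabs_ge0.
    have zh0 : 0 < cabs (z - h) by rewrite cabs_gt0 // subr_eq0.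
    rewrite cabsM /I cabsV ler_pdivrMr //.
    have -> : f z - f h = (f z - f h - k * (z - h)) + k * (z - h) by rewrite subrK.
    apply: le_trans (cabsD _ _) _; rewrite cabsM mulrDl mul1r; exact: lerD.
have g0 : g 0 = 0 by rewrite /g subrr.
have gE x y : onsq x y -> sdiff g (Complex x y).
  by move=> e; apply: gd; exact: edge_in.
have gEM x y : onsq x y -> cabs (g (Complex x y)) <= 2 * M.
  by move=> e; apply: gM; exact: edge_in.
pose E1 := oint (fun z => g z * (I 0 z * I 0 z)).
have l1 : h2 - - h2 = 1 by lra.
have d83 : 0 <= 8 / 3 :> R by rewrite divr_ge0.
have E1d : ediff (fun z => g z * (I 0 z * I 0 z)) (- h2) h2 (- h2) h2.
  by move=> x y e; apply: sdiffM; [exact: gE|apply: sdiffM; exact: Id].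
(* E1 / N 0 plays the role of the derivative at 0; 8 / 3 bounds 1 / |z - h| on
   the contour *)
have E1M : cabs E1 <= 8 * (2 * M * (8 / 3 * (8 / 3))).
  apply: le_trans (rectint_le_edge (M := 2 * M * (8 / 3 * (8 / 3))) _ _ _ _) _.
  - exact: h2h2.
  - exact: h2h2.
  - exact: E1d.
  - move=> x y e; rewrite !cabsM; apply: ler_pM; rewrite ?mulr_ge0 ?cabs_ge0 //.
      exact: gEM.
    by apply: ler_pM; rewrite ?cabs_ge0 //; exact: Ib.
  - by rewrite !l1 le_eqVlt; apply/orP; left; apply/eqP; ring.
pose a := E1 / N 0.
have aM : cabs a <= 128 * M.
  have W := winding_ge c08; rewrite -/(N 0) in W.
  rewrite /a cabsM cabsV ler_pdivrMr; last by apply: lt_le_trans W; rewrite divr_gt0.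
  apply: le_trans E1M _; move: (cabs (N 0)) W => W W1; clear - W1 M0; nra.
exists a => // h hh.
pose X := oint (fun z => g z * (I 0 z * I 0 z * I h z)).
pose Y := oint (fun z => I 0 z * I h z).
have Xd : ediff (fun z => g z * (I 0 z * I 0 z * I h z)) (- h2) h2 (- h2) h2.
  move=> x y e; apply: sdiffM; first exact: gE.
  by apply: sdiffM; [apply: sdiffM; exact: Id|exact: Id].
have Yd : ediff (fun z => I 0 z * I h z) (- h2) h2 (- h2) h2.
  by move=> x y e; apply: sdiffM; exact: Id.
have XM : cabs X <= 8 * (2 * M * (8 / 3 * (8 / 3) * (8 / 3))).
  apply: le_trans (rectint_le_edge (M := 2 * M * (8 / 3 * (8 / 3) * (8 / 3))) _ _ _ _) _.
  - exact: h2h2.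
  - exact: h2h2.
  - exact: Xd.
  - move=> x y e; rewrite !cabsM; apply: ler_pM; rewrite ?mulr_ge0 ?cabs_ge0 //.
      exact: gEM.
    apply: ler_pM; rewrite ?mulr_ge0 ?cabs_ge0 //; last exact: Ib.
    by apply: ler_pM; rewrite ?cabs_ge0 //; exact: Ib.
  - by rewrite !l1 le_eqVlt; apply/orP; left; apply/eqP; ring.
have YM : cabs Y <= 8 * (8 / 3 * (8 / 3)).
  apply: le_trans (rectint_le_edge (M := 8 / 3 * (8 / 3)) _ _ _ _) _.
  - exact: h2h2.
  - exact: h2h2.
  - exact: Yd.
  - by move=> x y e; rewrite !cabsM; apply: ler_pM; rewrite ?cabs_ge0 //; exact: Ib.
  - by rewrite !l1 le_eqVlt; apply/orP; left; apply/eqP; ring.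
have res x y : onsq x y ->
    I h (Complex x y) = I 0 (Complex x y) + h * (I 0 (Complex x y) * I h (Complex x y)).
  move=> e; have := edge_neq e hh; have := edge_neq e c08; rewrite /I.
  move: (Complex x y) => z z0 zh; rewrite subr0; field.
  by rewrite z0 subr_eq0 zh.
have NE : N h = N 0 + h * Y.
  rewrite -rectintZ // -rectintD //.
  - by apply: eq_rectint => // x y e; exact: res.
  - exact: ediff_inv.
  - by move=> x y e; apply: sdiffM; [exact: sdiff_cst|exact: Yd].
have GE : g h * N h = h * E1 + h ^+ 2 * X.
  have gI0 := gI 0 c08; rewrite g0 mul0r in gI0.
  rewrite -(gI h hh) -[RHS]add0r -gI0 -!rectintZ //.
  have d1 : ediff (fun z => h * (g z * (I 0 z * I 0 z))) (- h2) h2 (- h2) h2.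
    by move=> x y e; apply: sdiffM; [exact: sdiff_cst|exact: E1d].
  have d2 : ediff (fun z => h ^+ 2 * (g z * (I 0 z * I 0 z * I h z))) (- h2) h2 (- h2) h2.
    by move=> x y e; apply: sdiffM; [exact: sdiff_cst|exact: Xd].
  rewrite -(rectintD h2h2 h2h2 d1 d2) -rectintD //.
  - apply: eq_rectint => // x y e.
    by rewrite {1}(res _ _ e) {1}(res _ _ e); ring.
  - by move=> x y e; apply: sdiffM; [exact: gE|exact: Id].
  - by move=> x y e; apply: sdiffD; [exact: d1|exact: d2].
have key : N h * (f h - f 0 - a * h) = h ^+ 2 * (X - a * Y).
  have -> : N h * (f h - f 0 - a * h) = g h * N h - a * h * N h by rewrite /g; ring.
  rewrite GE NE; have -> : E1 = a * N 0 by rewrite /a divfK // N0.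
  by ring.
have W := winding_ge hh; rewrite -/(N h) in W.
have := congr1 (@cabs R) key; rewrite !cabsM => keyM.
have XY : cabs (X - a * Y) <= 9000 * M.
  apply: le_trans (cabsD _ _) _; rewrite cabsN cabsM.
  apply: (@le_trans _ _ (8 * (2 * M * (8 / 3 * (8 / 3) * (8 / 3))) + 128 * M * (8 * (8 / 3 * (8 / 3))))).
    by apply: lerD => //; apply: ler_pM => //; exact: cabs_ge0.
  by clear - M0; lra.
rewrite -(ler_pM2l (x := cabs (N h))); last by apply: lt_le_trans W; rewrite divr_gt0.
rewrite keyM -expr2.
apply: le_trans (ler_wpM2l _ XY) _; first exact: sqr_ge0.
have := sqr_ge0 (cabs h).
move: (cabs (N h)) (cabs h ^+ 2) W => n q W q0.
have := mulr_ge0 M0 q0; move=> Mq; clear - W Mq; nra.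
Qed.

End CauchyEstimate.

(** * Holomorphic discs *)

Section HolomorphicDiscs.
Variables (R : realType) (d : nat).
Local Notation V := 'rV[R[i]]_d.
Implicit Types (phi : R[i] -> V).

Lemma vdiff_comp phi (m : R[i] -> R[i]) z k a :
  vdiff phi (m z) a -> cdiff m z k -> vdiff (phi \o m) z (k *: a).
Proof.
move=> Hp Hm e e0.
pose D := cabs k + 1; have D0 : 0 < D by rewrite ltr_wpDl ?cabs_ge0.
pose A := enorm a + 1; have A0 : 0 < A by rewrite ltr_wpDl ?enorm_ge0.
have [r r0 rH] := Hp (e / (2 * D)) (divr_gt0 e0 (mulr_gt0 (ltr0Sn _ 1) D0)).
have [s1 s10 s1H] := Hm 1 ltr01.
have [s2 s20 s2H] := Hm (e / (2 * A)) (divr_gt0 e0 (mulr_gt0 (ltr0Sn _ 1) A0)).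
exists (Num.min (Num.min s1 s2) (r / D)); first by rewrite !lt_min s10 s20 divr_gt0.
move=> h; rewrite !lt_min => /andP[/andP[hs1 hs2]]; rewrite ltr_pdivlMr // => hr.
have h0 := cabs_ge0 h.
pose q := m (z + h) - m z.
have q1 : cabs q <= D * cabs h.
  have -> : q = (q - k * h) + k * h by rewrite subrK.
  apply: le_trans (cabsD _ _) _.
  by have := s1H h hs1; rewrite -/q cabsM /D; move: (cabs (q - k * h)) (cabs k) => x y; lra.
have qr : cabs q < r by apply: le_lt_trans q1 _; rewrite mulrC.
have := rH q qr; rewrite (_ : m z + q = m (z + h)) => [H1|]; last by rewrite /q addrC subrK.
have -> : (phi \o m) (z + h) - (phi \o m) z - h *: (k *: a) =
    (phi (m (z + h)) - phi (m z) - q *: a) + (q - k * h) *: a.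
  by apply/rowP => i; rewrite !mxE /=; ring.
apply: le_trans (enormD _ _) _; rewrite enormZ.
have H2 := s2H h hs2; rewrite -/q in H2.
apply: (@le_trans _ _ (e / (2 * D) * (D * cabs h) + e / (2 * A) * cabs h * A)).
  apply: lerD; first by apply: le_trans H1 _; rewrite ler_wpM2l // ltW // divr_gt0 // mulr_gt0.
  apply: ler_pM => //; rewrite ?cabs_ge0 ?enorm_ge0 //.
  by rewrite /A lerDl.
by rewrite le_eqVlt; apply/orP; left; apply/eqP; field; rewrite !gt_eqF.
Qed.

Lemma vdiff_translate phi z a (v : V) : vdiff phi z a ->
  vdiff (fun w => phi w - v) z a.
Proof.
move=> H e e0; have [r r0 rH] := H e e0; exists r => // h /rH.
by rewrite opprB addrA subrK.
Qed.

Lemma cdiff_affine (c k z : R[i]) : cdiff (fun w => c + k * w) z k.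
Proof.
move=> e e0; exists 1 => // h _.
rewrite (_ : _ - _ = 0); first by rewrite cabs0 mulr_ge0 ?cabs_ge0 ?ltW.
by ring.
Qed.

(** The constant is abstracted: its independence of f and M is what matters. *)
Lemma taylor_const_ex : exists C : R, 1 <= C /\ forall (f : R[i] -> R[i]) M,
  (forall z, cabs z < 1 -> sdiff f z) -> (forall z, cabs z < 1 -> cabs (f z) <= M) ->
  exists2 a, cabs a <= C * M & forall h, cabs h <= 8^-1 ->
    cabs (f h - f 0 - a * h) <= C * M * cabs h ^+ 2.
Proof.
exists 6000; split; first lra.
move=> f M fd fM; have [a aM Ha] := holo_taylor fd fM; exists a => //.
apply: le_trans aM _.
have M0 : 0 <= M by apply: le_trans (cabs_ge0 (f 0)) (fM 0 _); rewrite cabs0.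
lra.
Qed.

Definition tconst : R := projT1 (cid taylor_const_ex).

(** The factor d + 1 bounds the sum over the coordinates. *)
Definition dconst : R := tconst * d.+1%:R.

Lemma dconst_ge1 : 1 <= dconst.
Proof.
rewrite /dconst /tconst; case: cid => C [C1 _] /=.
by rewrite -[leLHS]mulr1 ler_pM // ler1n.
Qed.

Lemma disc_taylor0 phi (M : R) :
  (forall z, unit_disc z -> derivable phi z 1) ->
  (forall z, unit_disc z -> enorm (phi z) <= M) ->
  exists2 a, enorm a <= dconst * M & forall h, cabs h <= 8^-1 ->
    enorm (phi h - phi 0 - h *: a) <= dconst * M * cabs h ^+ 2.
Proof.
move=> pd pM.
have M0 : 0 <= M by apply: le_trans (enorm_ge0 (phi 0)) (pM 0 _); rewrite /unit_disc /= cabs0.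
have dM : \sum_(i < d) tconst * M <= dconst * M.
  rewrite sumr_const card_ord -[_ *+ d]mulr_natr mulrAC /dconst ler_wpM2r //.
  by rewrite ler_wpM2l ?ler_nat // /tconst; case: cid => C [C1 _] /=; lra.
have /choice[a Ha] i : exists a, cabs a <= tconst * M /\ forall h, cabs h <= 8^-1 ->
    cabs (phi h ord0 i - phi 0 ord0 i - a * h) <= tconst * M * cabs h ^+ 2.
  rewrite /tconst; case: cid => C [_ HC] /=.
  have [z z1|z z1|a a1 a2] := HC (fun z => phi z ord0 i) M.
  - by have /vdiff_coord H := derivable_vdiffE (pd z z1); exists (derive1 phi z ord0 i).
  - by apply: le_trans (coord_le_enorm _ i) _; exact: pM.
  - by exists a.
exists (\row_i a i).
  apply: le_trans (enorm_le_sum _) _; apply: le_trans dM; apply: ler_sum => i _.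
  by rewrite mxE; have [] := Ha i.
move=> h hh; apply: le_trans (enorm_le_sum _) _.
apply: (@le_trans _ _ (\sum_(i < d) (tconst * M * cabs h ^+ 2))).
  apply: ler_sum => i _; rewrite !mxE [h * _]mulrC.
  by have [_] := Ha i; exact.
by rewrite -mulr_suml ler_wpM2r // sqr_ge0.
Qed.

Lemma unit_disc_shift (z h : R[i]) : cabs z < 1 -> cabs h < 1 ->
  cabs (z + (1 - cabs z)%:C * h) < 1.
Proof.
move=> z1 h1; apply: le_lt_trans (cabsD _ _) _; rewrite cabsM cabs_real.
have z0 : 0 < 1 - cabs z by rewrite subr_gt0.
rewrite (gtr0_norm z0); have : (1 - cabs z) * cabs h < (1 - cabs z) * 1 by rewrite ltr_pM2l.
by rewrite mulr1; move: (cabs z) (cabs h) => x y; lra.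
Qed.

Lemma derivable_comp phi (m : R[i] -> R[i]) z :
  derivable phi (m z) 1 -> sdiff m z -> derivable (phi \o m) z 1.
Proof.
move=> /derivable_vdiffE Hp [k Hk].
by have [] := vdiff_derive1 (vdiff_comp Hp Hk).
Qed.

(** [disc_taylor0] at an arbitrary centre z, after rescaling by 1 - |z|. *)
Lemma disc_taylor phi (M : R) (z : R[i]) : unit_disc z ->
  (forall z, unit_disc z -> derivable phi z 1) ->
  (forall z, unit_disc z -> enorm (phi z) <= M) ->
  exists2 a, enorm a <= dconst * M / (1 - cabs z) &
    forall h, cabs h <= (1 - cabs z) / 8 ->
    enorm (phi (z + h) - phi z - h *: a) <=
      dconst * M / (1 - cabs z) ^+ 2 * cabs h ^+ 2.
Proof.
move=> z1 pd pM; rewrite /unit_disc /= in z1.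
pose s := 1 - cabs z; have s0 : 0 < s by rewrite subr_gt0.
have sc : s%:C != 0 by apply/eqP => -[] E; rewrite E ltxx in s0.
have [w w1|w w1|a a1 a2] := @disc_taylor0 (phi \o (fun w => z + s%:C * w)) M.
- apply: derivable_comp; first by apply: pd; exact: unit_disc_shift.
  by exists s%:C; exact: cdiff_affine.
- by apply: pM; exact: unit_disc_shift.
exists (s%:C^-1 *: a).
  by rewrite enormZ cabsV cabs_real (gtr0_norm s0) mulrC ler_pM2r // invr_gt0.
move=> h hh; have := a2 (s%:C^-1 * h).
rewrite cabsM cabsV cabs_real (gtr0_norm s0) /=.
rewrite mulr0 addr0 mulrA divff // mul1r scalerA (mulrC _ h) => H.
apply: le_trans (H _) _.
  by rewrite ler_pdivrMl //; apply: le_trans hh _; rewrite le_eqVlt eqxx.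
by rewrite -/s le_eqVlt; apply/orP; left; apply/eqP; field; rewrite gt_eqF.
Qed.

(** 16 covers the points with modulus larger than 1 / 8, where the bound 2 M is
    enough. *)
Definition lconst : R := 16 + 2 * dconst.

Lemma lconst_gt0 : 0 < lconst.
Proof. by rewrite /lconst; have := dconst_ge1; lra. Qed.

(** A Schwarz lemma whose constant is not sharp: near 0 it follows from the
    Taylor estimate, elsewhere from the bound on the disc. *)
Lemma disc_schwarz phi (M : R) (h : R[i]) :
  (forall z, unit_disc z -> derivable phi z 1) ->
  (forall z, unit_disc z -> enorm (phi z) <= M) -> cabs h < 1 ->
  enorm (phi h - phi 0) <= lconst * M * cabs h.
Proof.
move=> pd pM h1.
have [a aM Ha] := disc_taylor0 pd pM.
have u0 : unit_disc (0 : R[i]) by rewrite /unit_disc /= cabs0.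
have M0 : 0 <= M by apply: le_trans (enorm_ge0 (phi 0)) (pM 0 u0).
have c0 := cabs_ge0 h; have D1 := dconst_ge1.
have DM : 0 <= dconst * M by rewrite mulr_ge0 //; lra.
have [h8|h8] := leP (cabs h) 8^-1.
  have -> : phi h - phi 0 = (phi h - phi 0 - h *: a) + h *: a by rewrite subrK.
  apply: le_trans (enormD _ _) _; rewrite enormZ.
  have H1 := Ha h h8; have H2 := ler_wpM2l c0 aM.
  apply: le_trans (lerD H1 H2) _; rewrite /lconst.
  have := mulr_ge0 M0 c0; clear - h8 c0 DM.
  move: (cabs h) (dconst) M h8 c0 DM => x D m x8 x0 Dm0 mx0.
  have : D * m * x ^+ 2 <= D * m * x by rewrite ler_wpM2l // expr2; clear - x8 x0; nra.
  have := mulr_ge0 Dm0 x0; clear - mx0; nra.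
apply: (@le_trans _ _ (2 * M)).
  rewrite mulr2n mulrDl mul1r; apply: le_trans (enormD _ _) _; rewrite enormN.
  by apply: lerD; apply: pM.
have Mx : M * 8^-1 <= M * cabs h by rewrite ler_wpM2l // ltW.
have := mulr_ge0 DM c0; rewrite /lconst; move: (cabs h) (dconst) Mx => x D Mx DMx.
clear - DMx Mx; nra.
Qed.

(** Near the boundary of a domain the oscillation M is small on discs of fixed
    radius r < 1, whence an estimate with a small constant. *)
Lemma disc_schwarz_scaled phi (M r : R) (h : R[i]) : 0 < r -> r <= 1 ->
  (forall z, unit_disc z -> derivable phi z 1) ->
  (forall z, cabs z < r -> enorm (phi z - phi 0) <= M) -> cabs h < r ->
  enorm (phi h - phi 0) <= lconst * M / r * cabs h.
Proof.
move=> r0 r1 pd pM hr.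
have rc : r%:C != 0 by apply/eqP => -[] E; rewrite E ltxx in r0.
pose psi (w : R[i]) := phi (0 + r%:C * w) - phi 0.
have in_r z : unit_disc z -> cabs (0 + r%:C * z) < r.
  rewrite /unit_disc /= => z1; rewrite add0r cabsM cabs_real (gtr0_norm r0).
  by rewrite -[ltRHS]mulr1 ltr_pM2l.
have pd' z : unit_disc z -> derivable psi z 1.
  move=> z1; have H : unit_disc (0 + r%:C * z).
    by rewrite /unit_disc /=; apply: lt_le_trans (in_r _ z1) r1.
  have D := @vdiff_comp phi (fun w => 0 + r%:C * w) z _ _
    (derivable_vdiffE (pd _ H)) (cdiff_affine 0 r%:C z).
  by have [] := vdiff_derive1 (vdiff_translate (phi 0) D).
have pM' z : unit_disc z -> enorm (psi z) <= M.
  by move=> z1; apply: pM; exact: in_r.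
have h1 : cabs (r%:C^-1 * h) < 1.
  by rewrite cabsM cabsV cabs_real (gtr0_norm r0) ltr_pdivrMl // mulr1.
have := disc_schwarz pd' pM' h1.
rewrite /psi mulr0 !add0r mulrA divff // mul1r subrr subr0.
by rewrite cabsM cabsV cabs_real (gtr0_norm r0) mulrA.
Qed.

(** The Schwarz lemma on the largest disc centred at z. *)
Lemma disc_equicont phi (M : R) (z h : R[i]) : unit_disc z ->
  (forall z, unit_disc z -> derivable phi z 1) ->
  (forall z, unit_disc z -> enorm (phi z) <= M) -> cabs h < 1 - cabs z ->
  enorm (phi (z + h) - phi z) <= lconst * M / (1 - cabs z) * cabs h.
Proof.
move=> z1 pd pM hz; rewrite /unit_disc /= in z1.
pose s := 1 - cabs z; have s0 : 0 < s by rewrite subr_gt0.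
have sc : s%:C != 0 by apply/eqP => -[] E; rewrite E ltxx in s0.
pose psi := phi \o (fun w => z + s%:C * w).
have pd' w : unit_disc w -> derivable psi w 1.
  move=> w1; apply: derivable_comp; first by apply: pd; exact: unit_disc_shift.
  by exists s%:C; exact: cdiff_affine.
have pM' w : unit_disc w -> enorm (psi w) <= M.
  by move=> w1; apply: pM; exact: unit_disc_shift.
have h1 : cabs (s%:C^-1 * h) < 1.
  by rewrite cabsM cabsV cabs_real (gtr0_norm s0) ltr_pdivrMl // mulr1.
have := disc_schwarz pd' pM' h1.
rewrite /psi /= mulr0 !addr0 mulrA divff // mul1r.
by rewrite cabsM cabsV cabs_real (gtr0_norm s0) mulrA.
Qed.

(** Montel and Weierstrass in one step: the pointwise limit of uniformly
    bounded discs along an ultrafilter is a disc. *)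
Lemma ultra_disc (T : Type) (U : set_system T) (UU : UltraFilter U)
    (phi : T -> R[i] -> V) (M : R) :
  (forall k z, unit_disc z -> derivable (phi k) z 1) ->
  (forall k z, unit_disc z -> enorm (phi k z) <= M) ->
  exists psi : R[i] -> V, (forall z, unit_disc z -> derivable psi z 1) /\
    forall z, unit_disc z -> forall e : R, 0 < e ->
      U [set k | enorm (phi k z - psi z) < e].
Proof.
move=> pd pM.
have /choice[psi Hpsi] (z : R[i]) : exists l, unit_disc z -> forall e : R, 0 < e ->
    U [set k | enorm (phi k z - l) < e].
  have [z1|nz] := pselect (unit_disc z); last by exists 0.
  have [|l Hl] := @ultra_limit R T U UU d (fun k => phi k z) M; last by exists l.
  by apply: filterE => k /=; exact: pM.
exists psi; split=> // z z1.
have s0 : 0 < 1 - cabs z by rewrite subr_gt0.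
have /choice[a Ha] (k : T) : exists a : V, enorm a <= dconst * M / (1 - cabs z) /\
    forall h, cabs h <= (1 - cabs z) / 8 ->
    enorm (phi k (z + h) - phi k z - h *: a) <=
      dconst * M / (1 - cabs z) ^+ 2 * cabs h ^+ 2.
  by have [a a1 a2] := disc_taylor z1 (pd k) (pM k); exists a.
have [|b Hb] := @ultra_limit R T U UU d a (dconst * M / (1 - cabs z)).
  by apply: filterE => k /=; have [] := Ha k.
pose C := dconst * M / (1 - cabs z) ^+ 2.
have key h : cabs h <= (1 - cabs z) / 8 ->
    enorm (psi (z + h) - psi z - h *: b) <= C * cabs h ^+ 2.
  move=> hh; apply/ler_addgt0Pl => e e0.
  have zh : unit_disc (z + h).
    rewrite /unit_disc /=; apply: le_lt_trans (cabsD _ _) _.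
    by move: hh s0; move: (cabs z) (cabs h) => x y; lra.
  pose e' := e / (2 + cabs h).
  have D0 : 0 < 2 + cabs h by rewrite ltr_wpDr ?cabs_ge0.
  have e'0 : 0 < e' by rewrite divr_gt0.
  have [k [/= h1 [h2 h3]]] := ultra_pair UU (Hpsi _ zh e' e'0)
     (filterI (Hpsi _ z1 e' e'0) (Hb e' e'0)).
  have -> : psi (z + h) - psi z - h *: b =
     (phi k (z + h) - phi k z - h *: a k) - (phi k (z + h) - psi (z + h))
       + (phi k z - psi z) + h *: (a k - b).
    by apply/rowP => i; rewrite !mxE; ring.
  have [_ /(_ h hh) H] := Ha k.
  apply: le_trans (enormD _ _) _; rewrite enormZ.
  apply: le_trans (lerD (le_trans (enormD _ _) (lerD (le_trans (enormD _ _)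
    (lerD H (lexx _))) (lexx _))) (lexx _)) _; rewrite enormN.
  have H3 := ler_wpM2l (cabs_ge0 h) (ltW h3).
  have -> : e = e' + e' + cabs h * e' by rewrite /e'; field; rewrite gt_eqF.
  rewrite -/C; move: h1 h2 H3; move: (enorm _) (enorm _) (cabs h * enorm _) => x y w h1 h2 h3'.
  move: (C * _) (cabs h * e') h3' => p q h3'; lra.
have M0 : 0 <= M.
  have [k _] := filter_ex (filterT : U setT).
  by apply: le_trans (pM k 0 _); rewrite ?enorm_ge0 // /unit_disc /= cabs0.
have C0 : 0 <= C.
  by rewrite divr_ge0 ?sqr_ge0 // mulr_ge0 // (le_trans _ dconst_ge1).
suff : vdiff psi z b by move=> /vdiff_derive1[].
move=> e e0; exists (Num.min ((1 - cabs z) / 8) (e / (C + 1))).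
  by rewrite lt_min !divr_gt0 // ltr_wpDl.
move=> h; rewrite lt_min => /andP[hs he]; apply: le_trans (key h (ltW hs)) _.
rewrite expr2 mulrA ler_wpM2r ?cabs_ge0 //.
have C1 : 0 < C + 1 by rewrite ltr_wpDl.
move: he; rewrite ltr_pdivlMr // => he; have := cabs_ge0 h.
by move: (cabs h) he => x he x0; lra.
Qed.

End HolomorphicDiscs.

(** * The Poincare disc *)

Section PoincareDisc.
Variable R : realType.

(** Hyperbolic length of the radius from 0 to r. *)
Definition plen (r : R) : R := 2^-1 * ln ((1 + r) / (1 - r)).

(** The hyperbolic tangent, inverse of [plen]: the parametrization by arc length
    of the radii of the Poincare disc. *)
Definition th (t : R) : R := 1 - 2 / (expR (2 * t) + 1).

Lemma expR1_gt0 (t : R) : 0 < expR t + 1.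
Proof. by rewrite addr_gt0 // expR_gt0. Qed.

Lemma th0 : th 0 = 0.
Proof. by rewrite /th mulr0 expR0 (_ : 1 + 1 = 2) // divff // subrr. Qed.

Lemma th_lt1 t : th t < 1.
Proof. by rewrite /th ltrBlDr ltrDl divr_gt0 // expR1_gt0. Qed.

Lemma th_le s t : s <= t -> th s <= th t.
Proof.
move=> st; rewrite /th lerB // ler_pM2l // lef_pV2 ?posrE ?expR1_gt0 //.
by rewrite lerD2r ler_expR ler_pM2l.
Qed.

Lemma th_ge0 t : 0 <= t -> 0 <= th t.
Proof. by move=> /th_le; rewrite th0. Qed.

Lemma th_diff s t : (th t - th s) / (1 - th s * th t) = th (t - s).
Proof.
have e0 := expR1_gt0 (2 * s); have e1 := expR1_gt0 (2 * t).
have e2 := expR1_gt0 (2 * (t - s)).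
have p0 := expR_gt0 (2 * s); have p1 := expR_gt0 (2 * t).
have den : 1 - th s * th t != 0.
  rewrite /th; have -> : 1 - (1 - 2 / (expR (2 * s) + 1)) * (1 - 2 / (expR (2 * t) + 1))
   = 2 * (expR (2 * s) + expR (2 * t)) / ((expR (2 * s) + 1) * (expR (2 * t) + 1)).
    by field; rewrite !gt_eqF.
  by rewrite gt_eqF // divr_gt0 ?mulr_gt0 // addr_gt0.
have E : expR (2 * (t - s)) = expR (2 * t) / expR (2 * s) by rewrite mulrBr expRB.
apply: (mulIf den); rewrite mulfVK // /th E; rewrite E in e2.
move: (expR (2 * s)) (expR (2 * t)) p0 p1 e0 e1 e2 => x y p0 p1 e0 e1 e2.
have xy : x + y != 0 by rewrite gt_eqF // addr_gt0.
have yx : y / x + 1 = (x + y) / x by field; rewrite gt_eqF.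
by rewrite yx; field; rewrite !gt_eqF //= addr_gt0.
Qed.

Lemma expR_plen r : 0 <= r -> r < 1 -> expR (2 * plen r) = (1 + r) / (1 - r).
Proof.
move=> r0 r1; rewrite /plen mulrA divff // mul1r lnK // posrE divr_gt0 //.
  by rewrite ltr_wpDr.
by rewrite subr_gt0.
Qed.

Lemma th_plen r : 0 <= r -> r < 1 -> th (plen r) = r.
Proof.
move=> r0 r1; rewrite /th expR_plen //.
have d1 : 1 - r != 0 by rewrite subr_eq0 gt_eqF.
have -> : (1 + r) / (1 - r) + 1 = 2 / (1 - r) by field.
by field.
Qed.

Lemma plen_th t : 0 <= t -> plen (th t) = t.
Proof.
move=> t0; rewrite /plen.
have -> : (1 + th t) / (1 - th t) = expR (2 * t).
  rewrite /th; have := expR1_gt0 (2 * t); have := expR_gt0 (2 * t).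
  move: (expR _) => x x0 x1; have xn : x + 1 != 0 by rewrite gt_eqF.
  have -> : 1 + (1 - 2 / (x + 1)) = 2 * x / (x + 1) by field.
  have -> : 1 - (1 - 2 / (x + 1)) = 2 / (x + 1) by field.
  by field.
by rewrite expRK mulrA mulVf // mul1r.
Qed.

Lemma plen_le r s : 0 <= r -> r < 1 -> (1 + r) / (1 - r) <= expR (2 * s) -> plen r <= s.
Proof.
by move=> r0 r1; rewrite -expR_plen // ler_expR ler_pM2l.
Qed.

Lemma plen_le_frac r : 0 <= r -> r < 1 -> plen r <= r / (1 - r).
Proof.
move=> r0 r1; apply: plen_le => //; apply: le_trans (expR_ge1Dx _).
rewrite le_eqVlt; apply/orP; left; apply/eqP; field.
by rewrite subr_eq0 gt_eqF.
Qed.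

Lemma plen_ge r : 0 <= r -> r < 1 -> r <= 2 * plen r.
Proof.
move=> r0 r1; rewrite -ler_expR expR_plen //.
have d1 : 0 < 1 - r by rewrite subr_gt0.
apply: (@le_trans _ _ (1 - r)^-1).
  rewrite -[leLHS]invrK lef_pV2 ?posrE ?invr_gt0 ?expR_gt0 // -expRN.
  exact: expR_ge1Dx.
by rewrite ler_pdivlMr // mulVf ?gt_eqF // lerDl.
Qed.

Lemma plen_ge0 r : 0 <= r -> r < 1 -> 0 <= plen r.
Proof. by move=> r0 r1; have := plen_ge r0 r1; lra. Qed.

Lemma is_derive_th t : is_derive t (1 : R) th (1 - th t ^+ 2).
Proof.
have e0 := expR1_gt0 (2 * t).
pose D (x : R) := expR (2 * x) + 1.
have HD : is_derive t (1 : R) D (2 * expR (2 * t)).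
  have H : is_derive t (1 : R) (fun x => 2 * x : R) 2.
    have := is_deriveZ (2 : R) (is_derive_id t (1 : R)).
    by rewrite /GRing.scale /= mulr1.
  have := @is_derive1_comp R expR (fun x => 2 * x) t _ _ (is_derive_expR (2 * t)) H.
  move=> H1; have := is_deriveD H1 (is_derive_cst (1 : R) t (1 : R)).
  by rewrite addr0 mulrC.
have V := is_deriveZ (2 : R) (@is_deriveV R D t _ (1 : R) (lt0r_neq0 e0) HD).
have B := is_deriveB (is_derive_cst (1 : R) t (1 : R)) V.
apply: is_derive_eq B _.
rewrite sub0r /th /D /GRing.scale /=; move: (expR _) e0 => x x0.
by field; rewrite gt_eqF.
Qed.

End PoincareDisc.

Section Moebius.
Variable R : realType.

Lemma moebius_lt (a w : R[i]) : cabs a < 1 -> cabs w < 1 ->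
  cabs (w + a) < cabs (1 + a^*%C * w).
Proof.
move=> a1 w1; rewrite -(ltr_pXn2r (n := 2)) ?nnegrE ?cabs_ge0 //.
have a2 : cabs a ^+ 2 < 1 by rewrite expr_lt1 ?cabs_ge0.
have w2 : cabs w ^+ 2 < 1 by rewrite expr_lt1 ?cabs_ge0.
rewrite -subr_gt0.
have -> : cabs (1 + a^*%C * w) ^+ 2 - cabs (w + a) ^+ 2 = (1 - cabs a ^+ 2) * (1 - cabs w ^+ 2).
  by rewrite !cabs_sqr; case: a {a1 a2} => p q; case: w {w1 w2} => x y /=; ring.
by rewrite mulr_gt0 // subr_gt0.
Qed.

Lemma moebius_den (a w : R[i]) : cabs a < 1 -> cabs w < 1 -> 1 + a^*%C * w != 0.
Proof.
move=> a1 w1; apply/eqP => E; have := moebius_lt a1 w1.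
by rewrite E cabs0 ltNge cabs_ge0.
Qed.

(** The automorphism of the disc that maps 0 to a, after the homothety of
    ratio c. *)
Definition moebius (a c z : R[i]) : R[i] := (c * z + a) / (1 + a^*%C * (c * z)).

Lemma moebius_in (a c z : R[i]) : cabs a < 1 -> cabs c <= 1 -> cabs z < 1 ->
  cabs (moebius a c z) < 1.
Proof.
move=> a1 c1 z1.
have cz : cabs (c * z) < 1.
  rewrite cabsM; apply: le_lt_trans z1; rewrite ler_piMl ?cabs_ge0 //.
rewrite /moebius cabsM cabsV ltr_pdivrMr ?mul1r; first exact: moebius_lt.
by apply: cabs_gt0; exact: moebius_den.
Qed.

Lemma moebius_sdiff (a c z : R[i]) : cabs a < 1 -> cabs c <= 1 -> cabs z < 1 ->
  sdiff (moebius a c) z.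
Proof.
move=> a1 c1 z1.
have cz : cabs (c * z) < 1.
  rewrite cabsM; apply: le_lt_trans z1; rewrite ler_piMl ?cabs_ge0 //.
have H k l : sdiff (fun w => l + k * (c * w)) z.
  rewrite (_ : (fun w => _) = (fun w => l + k * c * w)); last first.
    by apply/funext => w; rewrite mulrA.
  by exists (k * c); exact: cdiff_affine.
apply: (@sdiffM _ (fun w => c * w + a) (fun w => (1 + a^*%C * (c * w))^-1)).
  rewrite (_ : (fun w => _) = (fun w => a + 1 * (c * w))); first exact: H.
  by apply/funext => w; rewrite mul1r addrC.
by apply: sdiffV; [exact: moebius_den|exact: H].
Qed.

Lemma moebius0 (a c : R[i]) : moebius a c 0 = a.
Proof. by rewrite /moebius !mulr0 add0r addr0 divr1. Qed.

(** This factor cancels the speed of [th], so that a radius run through by [th]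
    has unit speed for the infinitesimal metric at each of its points. *)
Lemma moebius_cdiff0 (u : R) : `|u| < 1 ->
  cdiff (moebius u%:C 1) 0 (1 - u ^+ 2)%:C.
Proof.
move=> u1 e e0; have a1 : cabs u%:C < 1 by rewrite cabs_real.
exists (Num.min 2^-1 (e / 2)); first by rewrite lt_min divr_gt0 // invr_gt0 ltr0n.
move=> h; rewrite lt_min => /andP[h1 h2].
have uh : cabs (u%:C * h) <= 2^-1.
  rewrite cabsM; apply: (@le_trans _ _ (1 * cabs h)); last by rewrite mul1r ltW.
  by rewrite ler_wpM2r ?cabs_ge0 // ltW.
have D1 : 2^-1 <= cabs (1 + u%:C * h).
  have := cabsD (1 + u%:C * h) (- (u%:C * h)).
  rewrite addrK cabsN cabs1; move: uh; move: (cabs _) (cabs _) => x y; lra.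
have D0 : 1 + u%:C * h != 0.
  by apply/eqP => E; move: D1; rewrite E cabs0; lra.
rewrite add0r moebius0 /moebius conjc_real !mul1r.
have -> : (h + u%:C) / (1 + u%:C * h) - u%:C - (1 - u ^+ 2)%:C * h =
   - ((1 - u ^+ 2)%:C * u%:C * h * h) / (1 + u%:C * h).
  by rewrite rmorphB rmorph1 rmorphXn /=; field.
rewrite cabsM cabsN cabsV ler_pdivrMr ?(lt_le_trans _ D1) ?invr_gt0 ?ltr0n //.
rewrite !cabsM !cabs_real.
have u2 : `|1 - u ^+ 2| <= 1.
  rewrite ger0_norm; first by rewrite lerBlDr lerDl sqr_ge0.
  by rewrite subr_ge0 -(real_normK (num_real u)) expr_le1 // ltW.
have c0 := cabs_ge0 h.
have U1 : `|1 - u ^+ 2| * `|u| <= 1.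
  by rewrite -[leRHS]mulr1; apply: ler_pM; rewrite ?cabs_ge0 ?normr_ge0 ?u2 // ltW.
apply: (@le_trans _ _ (1 * cabs h * (e / 2))).
  apply: ler_pM.
  - by rewrite !mulr_ge0 ?normr_ge0.
  - exact: cabs_ge0.
  - exact: (ler_wpM2r c0 U1).
  - exact: ltW.
apply: (@le_trans _ _ (e * cabs h * 2^-1)); first by rewrite le_eqVlt; apply/orP; left; apply/eqP; ring.
by rewrite ler_wpM2l // mulr_ge0 // ltW.
Qed.

End Moebius.

(** * The Kobayashi distance and metric *)

Section Kobayashi.
Variables (R : realType) (d : nat) (Omega : set 'rV[R[i]]_d).
Local Notation V := 'rV[R[i]]_d.
Local Notation K := (kobayashi Omega).
Implicit Types (phi : R[i] -> V) (a b : R[i]) (x y z : V).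

Lemma pdist_lt1 a b : unit_disc a -> unit_disc b ->
  cabs ((a - b) / (1 - b^*%C * a)) < 1.
Proof.
rewrite /unit_disc /= => a1 b1.
have nb1 : cabs (- b) < 1 by rewrite cabsN.
have := moebius_lt nb1 a1; have := moebius_den nb1 a1.
rewrite raddfN mulNr => D0 H.
by rewrite cabsM cabsV ltr_pdivrMr ?mul1r ?cabs_gt0.
Qed.

Lemma poincare_ge0 a b : unit_disc a -> unit_disc b -> 0 <= poincare_dist a b.
Proof. by move=> a1 b1; apply: plen_ge0; [exact: cabs_ge0|exact: pdist_lt1]. Qed.

Lemma chain_ge0 x y L : disc_chain Omega x y L -> 0 <= L.
Proof.
move=> [n [p [phi [a [b [_ _ H ->]]]]]]; apply: sumr_ge0 => j _.
by have [_ a1 b1 _ _] := H j (ltn_ord j); exact: poincare_ge0.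
Qed.

Lemma K_le_chain x y L : disc_chain Omega x y L -> K x y <= L.
Proof. by move=> H; apply: ge_inf => //; exists 0 => L' /chain_ge0. Qed.

Lemma K_le_disc phi a b : holomorphic_disc Omega phi -> unit_disc a -> unit_disc b ->
  K (phi a) (phi b) <= poincare_dist a b.
Proof.
move=> hp a1 b1; apply: K_le_chain.
exists 1%N, (fun j => if j is 0%N then phi a else phi b), (fun=> phi), (fun=> a), (fun=> b).
by split=> // [[|j]|]; rewrite ?big_ord1.
Qed.

Lemma K_le_plen phi (z : R[i]) : holomorphic_disc Omega phi -> unit_disc z ->
  K (phi 0) (phi z) <= plen (cabs z).
Proof.
move=> hp z1; have u0 : unit_disc (0 : R[i]) by rewrite /unit_disc /= cabs0.
apply: le_trans (K_le_disc hp u0 z1) _.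
by rewrite /poincare_dist mulr0 subr0 divr1 sub0r cabsN.
Qed.

Lemma th_disc (t : R) : 0 <= t -> unit_disc (th t)%:C.
Proof. by move=> t0; rewrite /unit_disc /= cabs_real ger0_norm ?th_lt1 ?th_ge0. Qed.

Lemma K_le_th phi (s t : R) : holomorphic_disc Omega phi -> 0 <= s -> s <= t ->
  K (phi (th s)%:C) (phi (th t)%:C) <= t - s.
Proof.
move=> hp s0 st; have t0 := le_trans s0 st.
apply: le_trans (K_le_disc hp (th_disc s0) (th_disc t0)) _.
have E : ((th s)%:C - (th t)%:C) / (1 - (th t)%:C^*%C * (th s)%:C) = (- th (t - s))%:C.
  rewrite -th_diff conjc_real -[in RHS]mulNr opprB (mulrC (th s) (th t)).
  by move: (th s) (th t) => p q; rewrite rmorphM fmorphV !rmorphB rmorphM rmorph1.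
rewrite /poincare_dist E cabs_real normrN ger0_norm ?th_ge0 ?subr_ge0 //.
by rewrite -/(plen _) plen_th ?subr_ge0.
Qed.

Lemma disc_moebius phi a c : holomorphic_disc Omega phi -> unit_disc a ->
  cabs c <= 1 -> holomorphic_disc Omega (phi \o moebius a c).
Proof.
move=> [pd pO] a1 c1; split=> z z1; last by apply: pO; exact: moebius_in.
by apply: derivable_comp; [apply: pd; exact: moebius_in|exact: moebius_sdiff].
Qed.

(** A normalized element of a chain of discs: a Moebius map brings the first
    point to the centre and the second one to the positive radius. *)
Definition link x y r := [/\ 0 <= r, r < 1 & exists phi,
  [/\ holomorphic_disc Omega phi, phi 0 = x & phi r%:C = y]].

Lemma link_disc phi a b : holomorphic_disc Omega phi -> unit_disc a -> unit_disc b ->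
  exists2 r, link (phi a) (phi b) r & plen r = poincare_dist a b.
Proof.
move=> hp a1 b1.
exists (cabs ((a - b) / (1 - b^*%C * a))); last by [].
have r1 := pdist_lt1 a1 b1; have r0 := cabs_ge0 ((a - b) / (1 - b^*%C * a)).
split=> //; pose q := (b - a) / (1 - a^*%C * b).
have qE : cabs ((a - b) / (1 - b^*%C * a)) = cabs q.
  rewrite /q !cabsM !cabsV (cabsB a); congr (_ / _).
  by rewrite -cabsC rmorphB rmorph1 rmorphM /= conjcK mulrC.
have D1 : 1 - a^*%C * b != 0.
  have na : cabs (- a) < 1 by rewrite cabsN.
  by have := moebius_den na b1; rewrite raddfN mulNr.
have D2 : 1 - a^*%C * a != 0.
  have na : cabs (- a) < 1 by rewrite cabsN.
  by have := moebius_den na a1; rewrite raddfN mulNr.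
have mq c : c * (cabs q)%:C = q -> moebius a c (cabs q)%:C = b.
  move=> E; rewrite /moebius E /q.
  have -> : (b - a) / (1 - a^*%C * b) + a = b * (1 - a^*%C * a) / (1 - a^*%C * b) by field.
  have -> : 1 + a^*%C * ((b - a) / (1 - a^*%C * b)) = (1 - a^*%C * a) / (1 - a^*%C * b) by field.
  by field; rewrite D1 D2.
rewrite qE.
have [q0|q0] := eqVneq (cabs q) 0.
  exists (phi \o moebius a 1); split.
  - by apply: disc_moebius; rewrite ?cabs1.
  - by rewrite /= moebius0.
  - by rewrite /= mq // q0 mulr0; apply/esym/cabs_eq0.
exists (phi \o moebius a (q / (cabs q)%:C)); split.
- apply: disc_moebius => //; rewrite cabsM cabsV cabs_real ger0_norm ?cabs_ge0 //.
  by rewrite divff.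
- by rewrite /= moebius0.
- rewrite /= mq // divfK //; apply/eqP => -[] /eqP; exact/negP.
Qed.

(** Induction along the chains of discs that define the Kobayashi distance; the
    first clause leaves room for a chain of length strictly less than L. *)
Lemma kob_chain_ind (P : V -> V -> R -> Prop) :
  (forall x y, Omega x -> Omega y -> K x y = 0 -> x = y) ->
  (forall x (L : R), Omega x -> 0 <= L -> P x x L) ->
  (forall x y z (L r : R), Omega x -> Omega y -> Omega z -> 0 <= L ->
     P x y L -> link y z r -> P x z (L + plen r)) ->
  forall x y L, Omega x -> Omega y -> K x y < L -> P x y L.
Proof.
move=> K0 Pb Ps x y L Ox Oy KL.
have [L' [n [p [phi [a [b [p0 pn H LE]]]]]] LL] : exists2 L', disc_chain Omega x y L' & L' < L.
  have [[L0 HL0]|nL] := pselect (exists L', disc_chain Omega x y L').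
    have hi : has_inf [set L' | disc_chain Omega x y L'].
      by split; [exists L0|exists 0 => L' /chain_ge0].
    have e0 : 0 < L - K x y by rewrite subr_gt0.
    have [L' HL' HL] := inf_adherent e0 hi; exists L' => //.
    by apply: lt_le_trans HL _; rewrite -/(K x y) addrC subrK.
  have Kx : K x y = 0.
    rewrite /kobayashi (_ : [set _ | _] = set0) ?inf0 //.
    by apply/seteqP; split=> // L' HL'; case: nL; exists L'.
  exists 0; last by rewrite -Kx.
  rewrite (K0 _ _ Ox Oy Kx).
  exists 0%N, (fun=> y), (fun=> fun=> 0), (fun=> 0), (fun=> 0); split=> //.
  by rewrite big_ord0.
have D0 : 0 < L - L' by rewrite subr_gt0.
have pos k : (k <= n)%N -> 0 <= \sum_(j < k) poincare_dist (a j) (b j).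
  move=> kn; apply: sumr_ge0 => j _; have [|_ a1 b1 _ _] := H j; last exact: poincare_ge0.
  exact: leq_trans (ltn_ord j) kn.
have main k : (k <= n)%N ->
    Omega (p k) /\ P x (p k) (L - L' + \sum_(j < k) poincare_dist (a j) (b j)).
  elim: k => [_|k IH kn].
    by rewrite p0 big_ord0 addr0; split=> //; apply: Pb => //; exact: ltW.
  have [Ok Pk] := IH (ltnW kn).
  have [hp a1 b1 pa pb] := H k kn.
  have Ok1 : Omega (p k.+1) by rewrite -pb; have [_] := hp; apply.
  split=> //; have [r lr rE] := link_disc hp a1 b1.
  rewrite pa pb in lr; rewrite big_ord_recr /= addrA -rE.
  apply: Ps Pk lr => //; rewrite addr_ge0 ?(ltW D0) //.
  exact: pos (ltnW kn).
by have [_] := main n (leqnn n); rewrite pn -LE subrK.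
Qed.

Lemma link_K x y r : link x y r -> K x y <= plen r.
Proof.
move=> [r0 r1 [phi [hp <- <-]]].
have := @K_le_plen phi r%:C hp; rewrite /unit_disc /= cabs_real ger0_norm //.
by apply.
Qed.

Lemma K_ge0 x y : 0 <= K x y.
Proof.
rewrite /kobayashi.
have [->|/set0P ne] := eqVneq [set L | disc_chain Omega x y L] set0.
  by rewrite inf0.
by apply: lb_le_inf => // L /chain_ge0.
Qed.

Lemma kmetric_le phi x v (xi : R[i]) : holomorphic_disc Omega phi -> phi 0 = x ->
  xi *: derive1 phi 0 = v -> kobayashi_metric Omega x v <= cabs xi.
Proof.
move=> hp p0 xv; apply: ge_inf.
  by exists 0 => _ [xi' _ <-]; exact: cabs_ge0.
by exists xi => //; exists phi.
Qed.

Lemma kmetric_ge0 x v : 0 <= kobayashi_metric Omega x v.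
Proof.
rewrite /kobayashi_metric; set S := [set _ | _ in _].
have [->|/set0P ne] := eqVneq S set0; first by rewrite inf0.
by apply: lb_le_inf => // _ [xi' _ <-]; exact: cabs_ge0.
Qed.

Lemma disc_cst x : Omega x -> holomorphic_disc Omega (fun=> x).
Proof.
by move=> Ox; split.
Qed.

Lemma kmetric_0 x : Omega x -> kobayashi_metric Omega x 0 <= 0.
Proof.
move=> Ox; have := @kmetric_le (fun=> x) x 0 0 (disc_cst Ox) erefl (scale0r _).
by rewrite cabs0.
Qed.

End Kobayashi.

(** * Euclidean bounds and unit speed paths *)

Section Velocity.
Variables (R : realType) (d : nat).
Local Notation V := 'rV[R[i]]_d.
Implicit Types (q : R -> V).

Lemma velocity_near_eq q1 q2 t (r : R) : 0 < r ->
  (forall s, `|s - t| < r -> q1 s = q2 s) -> velocity q1 t = velocity q2 t.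
Proof.
move=> r0 H; apply/rowP => j; rewrite !mxE.
have N : \forall s \near t, q1 s = q2 s.
  exists r => //= s; rewrite /ball /= distrC; exact: H.
by congr Complex; rewrite !derive1E; apply: near_eq_derive;
  apply: filterS N => s ->.
Qed.

Lemma derive1_shift (f : R -> R) c t :
  derive1 (fun s => f (s - c)) t = derive1 f (t - c).
Proof.
rewrite /derive1 (_ : (fun h => h^-1 *: (f (h + t - c) - f (t - c))) =
  (fun h => h^-1 *: (f (h + (t - c)) - f (t - c)))) //.
by apply/funext => h; rewrite addrA.
Qed.

Lemma velocity_shift q c t : velocity (fun s => q (s - c)) t = velocity q (t - c).
Proof.
apply/rowP => j; rewrite !mxE.
rewrite (derive1_shift (fun s => complex.Re (q s ord0 j))).
by rewrite (derive1_shift (fun s => complex.Im (q s ord0 j))).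
Qed.

Lemma velocity_cst (v : V) t : velocity (fun=> v) t = 0.
Proof.
apply/rowP => j; rewrite !mxE.
by have := derive1_cst (complex.Re (v ord0 j)) t; have := derive1_cst (complex.Im (v ord0 j)) t; rewrite /cst => -> ->.
Qed.

Lemma eps_is_derive (g : R -> R) (t a : R) :
  (forall e : R, 0 < e -> exists2 r : R, 0 < r & forall h, `|h| < r ->
     `|g (t + h) - g t - a * h| <= e * `|h|) -> is_derive t (1 : R) g a.
Proof.
move=> H.
suff C : h^-1 *: (g (h *: 1 + t) - g t) @[h --> 0^'] --> a.
  by apply: DeriveDef; [apply: cvgP C|exact: cvg_lim C].
apply/cvgrPdist_lt => e e0.
have [r r0 rH] := H (e / 2) (divr_gt0 e0 (ltr0Sn _ 1)).
exists r => //= h; rewrite /ball /= sub0r normrN => hr h0.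
rewrite [h *: 1]mulr1 (addrC h t).
have -> : a - h^-1 *: (g (t + h) - g t) = - (h^-1 * (g (t + h) - g t - a * h)).
  by rewrite /GRing.scale /=; field.
have n0 : 0 < `|h| by rewrite normr_gt0.
rewrite normrN normrM normfV ltr_pdivrMl //.
apply: le_lt_trans (rH h hr) _.
by rewrite mulrC ltr_pM2l // ltr_pdivrMr // ltr_pMr // ltr1n.
Qed.

Lemma is_derive_eps (g : R -> R) (t a : R) : is_derive t (1 : R) g a ->
  forall e : R, 0 < e -> exists2 r : R, 0 < r & forall h, `|h| < r ->
     `|g (t + h) - g t - a * h| <= e * `|h|.
Proof.
move=> [D <-] e e0; move: D => /cvgrPdist_lt /(_ e e0) [r r0 rH].
exists r => // h hr; have [->|h0] := eqVneq h 0.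
  by rewrite addr0 subrr mulr0 subrr normr0 mulr0.
have := rH h; rewrite /ball /= sub0r normrN => /(_ hr h0).
rewrite [h *: 1]mulr1 (addrC h t) => /ltW le.
have -> : g (t + h) - g t - 'D_1 g t * h = - h * ('D_1 g t - h^-1 *: (g (t + h) - g t)).
  by rewrite /GRing.scale /=; field.
by rewrite normrM normrN mulrC ler_wpM2r.
Qed.

(** Radii are run through at hyperbolic unit speed. *)
Lemma velocity_disc (phi : R[i] -> V) (a : V) (t : R) :
  vdiff phi (th t)%:C a ->
  velocity (fun s => phi (th s)%:C) t = (1 - th t ^+ 2)%:C *: a.
Proof.
move=> H; apply/rowP => j; have C := @vdiff_coord _ _ _ _ _ j H.
have Hre : is_derive (th t) (1 : R) (fun u : R => complex.Re (phi u%:C ord0 j))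
    (complex.Re (a ord0 j)).
  apply: eps_is_derive => e e0; have [r r0 rH] := C e e0; exists r => // h hr.
  have := rH h%:C; rewrite cabs_real => /(_ hr); apply: le_trans.
  apply: le_trans (Re_le_cabs _); rewrite rmorphD.
  by case: (a ord0 j) => p q; rewrite !ReB /= mulr0 subr0.
have Him : is_derive (th t) (1 : R) (fun u : R => complex.Im (phi u%:C ord0 j))
    (complex.Im (a ord0 j)).
  apply: eps_is_derive => e e0; have [r r0 rH] := C e e0; exists r => // h hr.
  have := rH h%:C; rewrite cabs_real => /(_ hr); apply: le_trans.
  apply: le_trans (Im_le_cabs _); rewrite rmorphD.
  by case: (a ord0 j) => p q; rewrite !ImB /= mulr0 add0r.
have [_ E1] := @is_derive1_comp R _ (@th R) t _ _ Hre (is_derive_th t).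
have [_ E2] := @is_derive1_comp R _ (@th R) t _ _ Him (is_derive_th t).
rewrite !mxE !derive1E.
rewrite (_ : (fun s => complex.Re (phi (th s)%:C ord0 j)) =
  (fun u : R => complex.Re (phi u%:C ord0 j)) \o @th R) // E1.
rewrite (_ : (fun s => complex.Im (phi (th s)%:C ord0 j)) =
  (fun u : R => complex.Im (phi u%:C ord0 j)) \o @th R) // E2.
move: (th t) => u; case: (a ord0 j) => p q; apply/eqP; rewrite eq_complex /=.
by apply/andP; split; apply/eqP; ring.
Qed.

End Velocity.

Lemma frac_le4 (R : realType) (x : R) : x <= 2^-1 -> 0 <= x -> x <= 4 * x * (1 - x).
Proof. by move=> x1 x0; nra. Qed.

Section KobayashiBounds.
Variables (R : realType) (d : nat) (Omega : set 'rV[R[i]]_d) (M : R).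
Local Notation V := 'rV[R[i]]_d.
Local Notation K := (kobayashi Omega).
Hypothesis Hbd : forall z, Omega z -> enorm z <= M.
Hypothesis Hmet : metric_on Omega K.
Implicit Types (x y z w v : V).

Lemma Ksym x y : Omega x -> Omega y -> K x y = K y x.
Proof. by case: Hmet => _ _ + _; exact. Qed.

Lemma Ktri y x z : Omega x -> Omega y -> Omega z -> K x z <= K x y + K y z.
Proof. by case: Hmet => _ _ _ H Ox Oy Oz; exact: H. Qed.

Lemma Kxx x : Omega x -> K x x = 0.
Proof. by case: Hmet => _ H _ _ Ox; apply/H. Qed.

Lemma K_eq0 x y : Omega x -> Omega y -> K x y = 0 -> x = y.
Proof. by case: Hmet => _ H _ _ Ox Oy; move/H; exact. Qed.

Definition Klip : R := 2 * lconst R d * (`|M| + 1).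

Lemma Klip_gt0 : 0 < Klip.
Proof. by rewrite /Klip !mulr_gt0 ?lconst_gt0 // ltr_wpDl. Qed.

(** By the Schwarz lemma each disc of a chain is Lipschitz from the hyperbolic
    to the Euclidean distance, because Omega is bounded. *)
Lemma enorm_le_K x y : Omega x -> Omega y -> enorm (x - y) <= Klip * K x y.
Proof.
move=> Ox Oy; have C0 := Klip_gt0.
have H L : K x y < L -> enorm (x - y) <= Klip * L.
  move=> KL; pattern x, y, L; apply: (@kob_chain_ind _ _ Omega) KL => //.
  - exact: K_eq0.
  - by move=> z L' _ L0; rewrite subrr enorm0 mulr_ge0 // ltW.
  - move=> x' y' z' L' r Ox' Oy' Oz' L0 IH [r0 r1 [phi [[pd pO] p0 pr]]].
    apply: le_trans (enorm_triangle y' _ _) _; rewrite mulrDr; apply: lerD => //.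
    have M1 (s : R[i]) : unit_disc s -> enorm (phi s) <= `|M| + 1.
      move=> /pO /Hbd /le_trans; apply; apply: le_trans (ler_norm _) _.
      by rewrite lerDl.
    have rr : cabs r%:C < 1 by rewrite cabs_real ger0_norm.
    have := disc_schwarz pd M1 rr; rewrite pr p0 enormB cabs_real (ger0_norm r0).
    move=> /le_trans; apply; rewrite /Klip.
    rewrite (_ : 2 * lconst R d * (`|M| + 1) * plen r =
      lconst R d * (`|M| + 1) * (2 * plen r)); last by ring.
    apply: ler_wpM2l; last exact: plen_ge.
    apply: mulr_ge0; [exact: ltW (lconst_gt0 _ _)|exact: addr_ge0].
apply/ler_addgt0Pl => e e0.
have := H (K x y + e / Klip); rewrite ltrDl divr_gt0 // => /(_ isT).
by rewrite mulrDr (mulrC _ (e / Klip)) divfK ?gt_eqF // (addrC e).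
Qed.

Definition inball z (rho : R) := forall w, enorm (w - z) < rho -> Omega w.

Lemma affine_disc z v rho : 0 < rho -> inball z rho -> enorm v <= rho ->
  holomorphic_disc Omega (fun s : R[i] => z + s *: v) /\
  derive1 (fun s : R[i] => z + s *: v) 0 = v.
Proof.
move=> r0 Hb vr.
have D (s : R[i]) : vdiff (fun s : R[i] => z + s *: v) s v.
  move=> e e0; exists 1 => // h _.
  rewrite (_ : _ - _ = 0); first by rewrite enorm0 mulr_ge0 ?cabs_ge0 ?ltW.
  by apply/rowP => i; rewrite !mxE; ring.
split; last by have [] := vdiff_derive1 (D 0).
split=> s s1; first by have [] := vdiff_derive1 (D s).
rewrite /unit_disc /= in s1; apply: Hb.
rewrite [z + _]addrC addrK enormZ.
apply: le_lt_trans (ler_wpM2l (cabs_ge0 s) vr) _.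
by rewrite -[ltRHS]mul1r ltr_pM2r.
Qed.

(** The affine disc through the two points fits into the ball. *)
Lemma K_le_enorm z rho w : inball z rho -> 0 < rho -> enorm (w - z) <= rho / 2 ->
  K z w <= 4 / rho * enorm (w - z).
Proof.
move=> Hb r0 wz.
have Oz : Omega z by apply: Hb; rewrite subrr enorm0.
have [/enorm_eq0/eqP|n0] := eqVneq (enorm (w - z)) 0.
  rewrite subr_eq0 => /eqP ->; rewrite Kxx // subrr enorm0 mulr0 //.
have e0 : 0 < enorm (w - z) by rewrite lt_neqAle eq_sym n0 enorm_ge0.
pose n := enorm (w - z); pose v := (rho / n)%:C *: (w - z).
have vr : enorm v <= rho.
  have rn : 0 <= rho / n by apply: divr_ge0; exact: ltW.
  by rewrite enormZ cabs_real (ger0_norm rn) divfK.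
have [hp _] := affine_disc r0 Hb vr.
have r1 : n / rho <= 2^-1 by rewrite ler_pdivrMr // mulrC.
have nr0 : 0 <= n / rho by rewrite divr_ge0 // ltW.
have nr1 : n / rho < 1 by apply: le_lt_trans r1 _; rewrite invf_lt1 // ltr1n.
have := @K_le_plen _ _ _ _ (n / rho)%:C hp.
rewrite /unit_disc /= cabs_real ger0_norm // => /(_ nr1).
rewrite scale0r addr0 scalerA -rmorphM /= (_ : n / rho * (rho / n) = 1); last first.
  by rewrite /n; field; rewrite n0 gt_eqF.
rewrite scale1r addrC subrK => /le_trans; apply.
apply: le_trans (plen_le_frac nr0 nr1) _.
have d0 : 0 < 1 - n / rho by rewrite subr_gt0.
rewrite ler_pdivrMr // (_ : 4 / rho * _ = 4 * (n / rho)); last by rewrite mulrAC mulrA.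
exact: frac_le4.
Qed.

Hypothesis Hopen : open Omega.

Lemma open_inball z : Omega z -> exists2 rho, 0 < rho & inball z rho.
Proof.
move=> Oz; have /nbhs_enorm[e e0 eO] : nbhs z Omega by apply: open_nbhs_nbhs.
by exists e.
Qed.

(** The two bounds on the speed have different uses: the first controls
    distances, the second the length integral. B lists the junctions of discs. *)
Definition unit_speed_path x y L (q : R -> V) (B : seq R) :=
  [/\ q 0 = x, q L = y,
    forall s t, 0 <= s -> s <= t -> t <= L -> Omega (q s) /\ K (q s) (q t) <= t - s &
    forall t, 0 < t -> t < L -> t \notin B ->
      kobayashi_metric Omega (q t) (velocity q t) <= 1].

(** Concatenate the radii of the discs of a chain of length less than L, each at
    hyperbolic unit speed. Waiting at the start absorbs the surplus of L. *)
Lemma unit_speed_path_ex x y L : Omega x -> Omega y -> K x y < L ->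
  exists q B, unit_speed_path x y L q B.
Proof.
move=> Ox Oy KL.
suff : 0 <= L /\ exists q B, unit_speed_path x y L q B by case.
pattern x, y, L; apply: (@kob_chain_ind _ _ Omega) KL => //.
- exact: K_eq0.
- move=> z L' Oz L0; split=> //; exists (fun=> z), [::]; split=> //.
    by move=> s t s0 st tL; rewrite Kxx // subr_ge0.
  move=> t t0 tL _; rewrite velocity_cst; apply: le_trans (kmetric_0 Oz) _.
  exact: ler01.
move=> {x y L Ox Oy} x y z L r Ox Oy Oz L0 [_ [q [B [q0 qL qK qv]]]].
move=> [r0 r1 [phi [hp p0 pr]]]; have [pd pO] := hp.
have l0 := plen_ge0 r0 r1; split; first exact: addr_ge0.
pose g t := if t <= L then q t else phi (th (t - L))%:C.
have gL t : L <= t -> g t = phi (th (t - L))%:C.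
  rewrite /g => Lt; case: leP => // tL; have -> : t = L by apply/eqP; rewrite eq_le tL.
  by rewrite subrr th0 qL -p0.
have gl t : t <= L -> g t = q t by rewrite /g => ->.
exists g, (L :: B); split.
- by rewrite gl.
- by rewrite gL ?lerDl // addrC addKr th_plen.
- move=> s t s0 st tL.
  have [tl|lt] := leP t L.
    rewrite !gl //; last exact: le_trans tl.
    by apply: qK.
  rewrite (gL t) //; last exact: ltW.
  have tL0 : 0 <= t - L by rewrite subr_ge0 ltW.
  have [sl|ls] := leP s L.
    have [Oqs Kq] := qK s L s0 sl (lexx _).
    rewrite gl //; split=> //.
    have OqL : Omega (q L) by rewrite qL.
    apply: le_trans (Ktri (y := q L) Oqs OqL (pO _ (th_disc tL0))) _.
    have := @K_le_th _ _ _ phi 0 (t - L) hp (lexx _) tL0.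
    by rewrite th0 p0 -qL subr0 => /(lerD Kq) /le_trans; apply; rewrite addrC addrA subrK.
  have sL0 : 0 <= s - L by rewrite subr_ge0 ltW.
  rewrite (gL s) ?(ltW ls) //; split; first exact: pO (th_disc sL0).
  apply: le_trans (K_le_th hp sL0 _) _; first by rewrite lerD2r.
  by rewrite opprB addrA subrK.
- move=> t t0 tL; rewrite inE negb_or => /andP[tnL tB].
  have [tl|lt] := ltP t L.
    rewrite gl ?(ltW tl) // (@velocity_near_eq _ _ g q t (L - t)) ?subr_gt0 //.
      exact: qv.
    move=> s; rewrite ltr_norml => /andP[_ s2]; apply: gl.
    by rewrite ltW // -(ltrD2r (- t)).
  have {}lt : L < t by rewrite lt_neqAle eq_sym tnL.
  rewrite gL ?(ltW lt) //.
  rewrite (@velocity_near_eq _ _ g (fun s => phi (th (s - L))%:C) t (t - L)) ?subr_gt0 //; last first.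
    move=> s; rewrite ltr_norml => /andP[s2 _]; apply: gL.
    by rewrite ltW // -(ltrD2r (- t)) -opprB.
  have t1 : 0 <= t - L by rewrite subr_ge0 ltW.
  have D := derivable_vdiffE (pd _ (th_disc t1)).
  rewrite (velocity_shift (fun s => phi (th s)%:C)) (velocity_disc D).
  have u1 : `|th (t - L)| < 1 by rewrite ger0_norm ?th_lt1 ?th_ge0.
  have c1 : cabs (1 : R[i]) <= 1 by rewrite cabs1.
  have hm := disc_moebius hp (th_disc t1) c1.
  apply: le_trans (@kmetric_le _ _ _ _ _ _ 1 hm _ _) _; last by rewrite cabs1.
    by rewrite /= moebius0.
  have D' : vdiff phi (moebius (th (t - L))%:C 1 0) (derive1 phi (th (t - L))%:C).
    by rewrite moebius0.
  have [_ ->] := vdiff_derive1 (vdiff_comp D' (moebius_cdiff0 u1)).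
  by rewrite scale1r.
Qed.

End KobayashiBounds.

(** * Properness and geodesics *)

Lemma nat_ultra : exists U : set_system nat, UltraFilter U /\ forall N, U [set n | (N <= n)%N].
Proof.
have [U [UU sU]] := ultraFilterLemma (@eventually_filter).
by exists U; split=> // N; apply: sU; exists N.
Qed.

Lemma inv_small (R : realType) (e : R) : 0 < e ->
  exists N, forall n, (N <= n)%N -> n.+1%:R^-1 < e.
Proof.
move=> e0; have [N HN] : exists N, e^-1 < N%:R by exists (Num.truncn e^-1).+1; exact: truncnS_gt.
exists N => n Nn; rewrite -[ltRHS]invrK ltf_pV2 ?posrE ?invr_gt0 ?ltr0Sn //.
by apply: lt_le_trans HN _; rewrite ler_nat ltnW // ltnS.
Qed.

Section HopfRinow.
Variables (R : realType) (d : nat) (Omega : set 'rV[R[i]]_d) (M : R).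
Local Notation V := 'rV[R[i]]_d.
Local Notation K := (kobayashi Omega).
Hypothesis Hbd : forall z, Omega z -> enorm z <= M.
Hypothesis Hmet : metric_on Omega K.
Hypothesis Hopen : open Omega.
Hypothesis Hcomp : forall u : nat -> V, (forall n, Omega (u n)) ->
    (forall e : R, 0 < e -> exists N : nat, forall m n : nat,
       (N <= m)%N -> (N <= n)%N -> K (u m) (u n) < e) ->
    exists2 l, Omega l & forall e : R, 0 < e -> exists N : nat, forall n : nat,
       (N <= n)%N -> K (u n) l < e.
Variable o : V.
Hypothesis Oo : Omega o.
Implicit Types (x y z w v : V).

Local Notation Ktri := (Ktri Hmet).
Local Notation Ksym := (Ksym Hmet).
Local Notation Kxx := (Kxx Hmet).
Local Notation Klip := (Klip d M).

Lemma inball_sub z (r s : R) : s <= r -> inball Omega z r -> inball Omega z s.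
Proof. by move=> sr H w ws; apply: H; exact: lt_le_trans ws sr. Qed.

Lemma inball_shift z w (r s : R) : enorm (w - z) <= r -> inball Omega z (r + s) ->
  inball Omega w s.
Proof.
move=> wz H v vw; apply: H; apply: le_lt_trans (enorm_triangle w _ _) _.
by rewrite addrC; apply: ler_ltD.
Qed.

Lemma inball_in z (r : R) : 0 < r -> inball Omega z r -> Omega z.
Proof. by move=> r0; apply; rewrite subrr enorm0. Qed.

(** Bounded sequences have Euclidean ultralimits; a uniform distance to the
    boundary keeps the limit inside, where both topologies agree. *)
Lemma ultra_Klim_inball (T : Type) (U : set_system T) (UU : UltraFilter U)
    (f : T -> V) (e : R) : 0 < e ->
  U [set k | Omega (f k) /\ inball Omega (f k) e] ->
  exists2 l, Omega l & forall eps : R, 0 < eps -> U [set k | Omega (f k) /\ K (f k) l < eps].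
Proof.
move=> e0 Uf; have [|l Hl] := @ultra_limit R T U UU d f M.
  by apply: filterS Uf => k [/Hbd].
have e20 : 0 < e / 2 by rewrite divr_gt0.
have inl : inball Omega l (e / 2).
  have [k [[_ h1] h2]] := ultra_pair UU Uf (Hl _ e20).
  have h2' : enorm (l - f k) <= e / 2 by rewrite enormB; exact: ltW.
  by apply: (inball_shift h2'); rewrite -splitr.
exists l; first exact: inball_in inl.
move=> eps eps0; pose t := Num.min (e / 4) (eps * e / 16).
have t0 : 0 < t by rewrite lt_min !divr_gt0 // mulr_gt0.
apply: filterS (filterI Uf (Hl t t0)) => k /= [[Ofk _] fl]; split=> //.
have Ol := inball_in e20 inl.
have ft1 : enorm (f k - l) <= e / 2 / 2.
  apply: le_trans (ltW fl) _; rewrite /t ge_min; apply/orP; left.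
  by rewrite -mulrA -invfM -natrM.
have ft2 : enorm (f k - l) < eps * e / 16.
  by apply: lt_le_trans fl _; rewrite /t ge_min lexx orbT.
rewrite Ksym //; apply: le_lt_trans (K_le_enorm Hmet inl e20 ft1) _.
apply: (@lt_trans _ _ (4 / (e / 2) * (eps * e / 16))).
  by rewrite ltr_pM2l // divr_gt0.
rewrite (_ : 4 / (e / 2) * (eps * e / 16) = eps / 2); last by field; rewrite gt_eqF.
by rewrite ltr_pdivrMr // ltr_pMr // ltr1n.
Qed.

(** A point can be pulled back towards o along a nearly shortest path. *)
Lemma pull_back x (t L : R) : Omega x -> K o x < L -> 0 <= t -> t <= L ->
  exists x', [/\ Omega x', K o x' <= t & K x' x <= L - t].
Proof.
move=> Ox KL t0 tL.
have [q [B [q0 qL qK _]]] := unit_speed_path_ex Hmet Oo Ox KL.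
have [Oq0 K1] := qK 0 t (lexx _) t0 tL; have [Oqt K2] := qK t L t0 tL (lexx _).
by exists (q t); split=> //; rewrite -?qL // -q0 -[leRHS]subr0.
Qed.

Definition proper_at (r : R) := exists2 e : R, 0 < e &
  forall x, Omega x -> K o x <= r -> inball Omega x e.

Lemma proper_at_le r s : s <= r -> proper_at r -> proper_at s.
Proof. by move=> sr [e e0 H]; exists e => // x Ox Kx; apply: H => //; exact: le_trans sr. Qed.

(** A point of the larger ball is within 2 eta of the smaller ball by
    [pull_back], hence Euclidean close to it. *)
Lemma proper_at_step r : 0 <= r -> proper_at r -> exists2 eta, 0 < eta & proper_at (r + eta).
Proof.
move=> r0 [e e0 H]; have C0 := Klip_gt0 d M.
pose eta := e / (4 * Klip); have eta0 : 0 < eta by apply: divr_gt0 => //; apply: mulr_gt0 => //; rewrite ltr0n.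
exists eta => //; exists (e / 2); first by rewrite divr_gt0.
move=> x Ox Kx.
have [x' [Ox' Kx' Kxx']] : exists x', [/\ Omega x', K o x' <= r & K x' x <= 2 * eta].
  have [KL|LK] := ltP (K o x) r.
    by exists x; split=> //; [exact: ltW|rewrite Kxx // mulr_ge0 // ltW].
  have KL : K o x < r + 2 * eta by lra.
  have rL : r <= r + 2 * eta by lra.
  have [x' [h1 h2 h3]] := pull_back Ox KL r0 rL; exists x'; split=> //.
  by apply: le_trans h3 _; rewrite addrC addKr.
apply: (@inball_shift x' x (e / 2)); last by rewrite -splitr; exact: H.
apply: le_trans (enorm_le_K Hbd Hmet Ox Ox') _; rewrite Ksym //.
apply: (@le_trans _ _ (Klip * (2 * eta))); first by rewrite ler_pM2l.
by rewrite /eta le_eqVlt; apply/orP; left; apply/eqP; field; rewrite gt_eqF.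
Qed.

(** Suppose that points z n of the ball approach the boundary. Pulled back by 2 e
    they lie in a good ball, where they have a limit; let l m be this limit for
    e = r / (m + 1), within 3 e of the z n. The points l m form a Cauchy sequence;
    by completeness it converges to a point of Omega, which is then the limit of
    the z n. *)
Lemma proper_at_lim r : 0 < r -> (forall s, s < r -> proper_at s) -> proper_at r.
Proof.
move=> r0 H; apply: contrapT => nP.
have /choice[z Hz] (n : nat) : exists z, [/\ Omega z, K o z <= r & ~ inball Omega z n.+1%:R^-1].
  apply: contrapT => nE; apply: nP; exists n.+1%:R^-1; first by rewrite invr_gt0.
  by move=> x Ox Kx; apply: contrapT => nI; apply: nE; exists x.
have [U [UU UN]] := nat_ultra.
have near_l (e : R) : 0 < e -> e <= r ->
    exists2 l, Omega l & U [set n | K (z n) l < 3 * e].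
  move=> e0 er.
  have /choice[z' Hz'] (n : nat) : exists z', [/\ Omega z', K o z' <= r - e & K z' (z n) <= 2 * e].
    have [Oz Kz _] := Hz n.
    have KL : K o (z n) < K o (z n) + e by rewrite ltrDl.
    have [L2|L2] := leP (2 * e) (K o (z n) + e).
      have t0 : 0 <= K o (z n) + e - 2 * e by rewrite subr_ge0.
      have tL : K o (z n) + e - 2 * e <= K o (z n) + e by lra.
      have [x' [h1 h2 h3]] := pull_back Oz KL t0 tL; exists x'; split=> //; lra.
    have tL : 0 <= K o (z n) + e by rewrite addr_ge0 ?K_ge0 // ltW.
    have [x' [h1 h2 h3]] := pull_back Oz KL (lexx 0) tL; exists x'; split=> //; lra.
  have re : r - e < r by rewrite ltrBlDr ltrDl.
  have [e1 e10 He1] := H _ re.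
  have [|l Ol Hl] := @ultra_Klim_inball _ U UU z' e1 e10.
    by apply: filterE => n; have [h1 h2 h3] := Hz' n; split=> //; exact: He1.
  exists l => //; apply: filterS (Hl e e0) => n /= [Ozn Kzn].
  have [h1 h2 h3] := Hz' n; have [Oz _ _] := Hz n.
  apply: le_lt_trans (Ktri Oz Ozn Ol) _; rewrite Ksym //; lra.
have /choice[l Hl] (m : nat) : exists l, Omega l /\ U [set n | K (z n) l < 3 * (r / m.+1%:R)].
  have m0 : 0 < r / m.+1%:R by rewrite divr_gt0.
  have mr : r / m.+1%:R <= r by rewrite ler_pdivrMr // ler_peMr ?ler1n // ltW.
  by have [l h1 h2] := near_l _ m0 mr; exists l.
have r3 : 0 < 3 * r by rewrite mulr_gt0.
have Hcau (e : R) : 0 < e -> exists N : nat, forall m n : nat,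
    (N <= m)%N -> (N <= n)%N -> K (l m) (l n) < e.
  move=> e0; have e'0 : 0 < e / (2 * (3 * r)) by rewrite divr_gt0 // mulr_gt0.
  have [N HN] := inv_small e'0; exists N => m n Nm Nn.
  have [Om Um] := Hl m; have [On Un] := Hl n.
  have [k [h1 h2]] := ultra_pair UU Um Un; have [Oz _ _] := Hz k.
  have B p : (N <= p)%N -> 3 * (r / p.+1%:R) < e / 2.
    move=> /HN Hp; rewrite mulrA -[ltRHS](_ : 3 * r * (e / (2 * (3 * r))) = e / 2).
      by rewrite ltr_pM2l.
    by field; rewrite gt_eqF.
  have := B _ Nm; have := B _ Nn => Bn Bm.
  apply: le_lt_trans (Ktri Om Oz On) _; rewrite (Ksym Om Oz).
  by rewrite (splitr e) ltrD // ?(lt_trans h1) ?(lt_trans h2).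
have [L OL HL] := Hcomp (fun m => proj1 (Hl m)) Hcau.
have UL (e : R) : 0 < e -> U [set n | K (z n) L < e].
  move=> e0; have e2 : 0 < e / 2 by rewrite divr_gt0.
  have [N1 HN1] := HL _ e2.
  have e'0 : 0 < e / (2 * (3 * r)) by rewrite divr_gt0 // mulr_gt0.
  have [N2 HN2] := inv_small e'0.
  pose m := maxn N1 N2; have [Om Um] := Hl m.
  apply: filterS Um => n /= Hn; have [Oz _ _] := Hz n.
  apply: le_lt_trans (Ktri Oz Om OL) _; rewrite (splitr e) ltrD //; last first.
    by apply: HN1; rewrite leq_maxl.
  apply: lt_trans Hn _; have Hp := HN2 m (leq_maxr _ _).
  rewrite mulrA -[ltRHS](_ : 3 * r * (e / (2 * (3 * r))) = e / 2).
    by rewrite ltr_pM2l.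
  by field; rewrite gt_eqF.
have [rho rho0 Hrho] := open_inball Hopen OL.
have C0 := Klip_gt0 d M.
have e0 : 0 < rho / 2 / Klip by rewrite !divr_gt0.
have rho2 : 0 < rho / 2 by rewrite divr_gt0.
have [N HN] := inv_small rho2.
have [n [/= h1 h2]] := ultra_pair UU (UL _ e0) (UN N).
have [Oz _ nI] := Hz n; apply: nI.
apply: (@inball_sub _ (rho / 2)); first exact: ltW (HN _ h2).
apply: (@inball_shift L _ (rho / 2)); last by rewrite -splitr.
apply: le_trans (enorm_le_K Hbd Hmet Oz OL) _.
by rewrite mulrC -ler_pdivlMr // ltW.
Qed.

(** Hopf-Rinow: closed balls stay at positive Euclidean distance from the
    boundary. The supremum of the good radii is attained by completeness, and
    every good radius can be enlarged. *)
Lemma K_proper r : proper_at r.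
Proof.
apply: contrapT => nP.
have P0 : proper_at 0.
  have [rho rho0 Hrho] := open_inball Hopen Oo; exists rho => // x Ox Kx.
  have E : K o x = 0 by apply/eqP; rewrite eq_le Kx K_ge0.
  by rewrite -(K_eq0 Hmet Oo Ox E).
pose S := [set s : R | 0 <= s /\ proper_at s].
have Sr s : S s -> s <= r.
  by move=> [s0 Ps]; rewrite leNgt; apply/negP => /ltW rs; apply: nP; exact: proper_at_le rs Ps.
have hS : has_sup S by split; [exists 0; split=> //|exists r => s /Sr].
have sub s : S s -> s <= sup S by move=> Ss; exact: sup_upper_bound.
have s0 : 0 <= sup S by apply: sub; split.
have PS : proper_at (sup S).
  have [E|n0] := eqVneq (sup S) 0; first by rewrite E.
  apply: proper_at_lim; first by rewrite lt_neqAle eq_sym n0.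
  move=> s ss; have e0 : 0 < sup S - s by rewrite subr_gt0.
  have [t [_ Pt] st] := sup_adherent e0 hS; apply: proper_at_le Pt.
  by rewrite ltW //; move: st; rewrite opprB addrC subrK.
have [eta eta0 Pe] := proper_at_step s0 PS.
have : sup S + eta <= sup S by apply: sub; split=> //; rewrite addr_ge0 // ltW.
by rewrite -subr_ge0 opprD addrA subrr sub0r oppr_ge0 leNgt eta0.
Qed.

Lemma ultra_Klim (T : Type) (U : set_system T) (UU : UltraFilter U)
    (f : T -> V) (r : R) : U [set k | Omega (f k) /\ K o (f k) <= r] ->
  exists2 l, Omega l & forall eps : R, 0 < eps -> U [set k | Omega (f k) /\ K (f k) l < eps].
Proof.
move=> Uf; have [e e0 He] := K_proper r.
apply: (@ultra_Klim_inball _ U UU f e e0).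
by apply: filterS Uf => k /= [Of Kf]; split=> //; exact: He.
Qed.

Lemma Kball_compact r : compact [set z | Omega z /\ K o z <= r].
Proof.
rewrite compact_ultra => F FU FA.
have [l Ol Hl] := @ultra_Klim _ F FU id r FA.
exists l; split.
  split=> //; apply/ler_addgt0Pl => e e0.
  have [z [[Oz Kz] [_ zl]]] := ultra_pair FU FA (Hl e e0).
  by apply: le_trans (Ktri Oo Oz Ol) _; rewrite addrC lerD // ltW.
move=> A /nbhs_enorm[e e0 eA]; have C0 := Klip_gt0 d M.
apply: filterS (Hl (e / Klip) (divr_gt0 e0 C0)) => z /= [Oz Kz]; apply: eA.
apply: le_lt_trans (enorm_le_K Hbd Hmet Oz Ol) _.
by rewrite mulrC -ltr_pdivlMr.
Qed.

Lemma compact_Kbounded (C : set V) : compact C -> C `<=` Omega ->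
  exists r, forall z, C z -> K o z <= r.
Proof.
move=> cC CO; apply: contrapT => nE.
have /choice[z Hz] (n : nat) : exists z, C z /\ n%:R < K o z.
  apply: contrapT => nz; apply: nE; exists n%:R => z Cz.
  by rewrite leNgt; apply/negP => Kz; apply: nz; exists z.
have zC : (z @ \oo) C.
  suff : \oo (z @^-1` C) by [].
  by exists 0%N => // n _; have [] := Hz n.
have [l [Cl Hl]] := cC (z @ \oo) _ zC.
have Ol := CO _ Cl; have [rho rho0 Hrho] := open_inball Hopen Ol.
have [N HN] : exists N : nat, K o l + 2 < N%:R.
  by exists (Num.truncn (K o l + 2)).+1; exact: truncnS_gt.
have r2 : 0 < rho / 2 by rewrite divr_gt0.
have zN : (z @ \oo) [set w | exists2 n, (N <= n)%N & w = z n].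
  suff : \oo (z @^-1` [set w | exists2 n, (N <= n)%N & w = z n]) by [].
  by exists N => // n /= Nn; exists n.
have lB : nbhs l [set w | enorm (w - l) < rho / 2].
  by apply/nbhs_enorm; exists (rho / 2).
have [w [/= [n Nn ->] wl]] := Hl _ _ zN lB.
have [Cz Kz] := Hz n; have Oz := CO _ Cz.
have := K_le_enorm Hmet Hrho rho0 (ltW wl).
have : 4 / rho * enorm (z n - l) <= 2.
  have -> : 2 = 4 / rho * (rho / 2) by field; rewrite gt_eqF.
  by rewrite ler_pM2l ?divr_gt0 // ltW.
have := Ktri Oo Ol Oz; have : N%:R <= n%:R :> R by rewrite ler_nat.
move: (4 / rho * _) => X; lra.
Qed.

(** Geodesics are ultralimits of unit speed paths whose durations decrease to
    the distance: the limit is 1-Lipschitz, hence an isometry. *)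
Lemma geodesic_ex x y : Omega x -> Omega y ->
  exists g, [/\ geodesic Omega `[0, K x y] g, g 0 = x & g (K x y) = y].
Proof.
move=> Ox Oy; have [U [UU UN]] := nat_ultra.
pose T := K x y; have T0 : 0 <= T by exact: K_ge0.
have /choice[q Hq] (n : nat) : exists q : R -> V, [/\ q 0 = x, q (T + n.+1%:R^-1) = y &
    forall s t, 0 <= s -> s <= t -> t <= T + n.+1%:R^-1 -> Omega (q s) /\ K (q s) (q t) <= t - s].
  have KL : K x y < T + n.+1%:R^-1 by rewrite ltrDl invr_gt0.
  by have [q [B [h1 h2 h3 _]]] := unit_speed_path_ex Hmet Ox Oy KL; exists q.
have TL n : T <= T + n.+1%:R^-1 by rewrite lerDl invr_ge0.
have qO n t : 0 <= t -> t <= T -> Omega (q n t).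
  by move=> t0 tT; have [_ _ H] := Hq n; have [] := H t t t0 (lexx _) (le_trans tT (TL n)).
have qK n s t : 0 <= s -> s <= t -> t <= T -> K (q n s) (q n t) <= t - s.
  by move=> s0 st tT; have [_ _ H] := Hq n; have [] := H s t s0 st (le_trans tT (TL n)).
have /choice[g Hg] (t : R) : exists l, 0 <= t -> t <= T -> Omega l /\
    forall eps : R, 0 < eps -> U [set n | K (q n t) l < eps].
  have [[t0 tT]|nt] := pselect (0 <= t /\ t <= T); last first.
    by exists 0 => t0 tT; case: nt.
  have [|l Ol Hl] := @ultra_Klim _ U UU (fun n => q n t) (K o x + T).
    apply: filterE => n; split; first exact: qO.
    apply: le_trans (Ktri Oo Ox (qO n t t0 tT)) _; rewrite lerD2l.
    have [<- _ _] := Hq n; apply: le_trans (qK n 0 t (lexx _) t0 tT) _; by rewrite subr0.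
  by exists l => _ _; split=> // eps eps0; apply: filterS (Hl eps eps0) => n [].
have gK s t : 0 <= s -> s <= t -> t <= T -> K (g s) (g t) <= t - s.
  move=> s0 st tT; have t0 := le_trans s0 st; have sT := le_trans st tT.
  have [Os Hs] := Hg s s0 sT; have [Ot Ht] := Hg t t0 tT.
  apply/ler_addgt0Pl => e e0; have e2 : 0 < e / 2 by rewrite divr_gt0.
  have [n [h1 h2]] := ultra_pair UU (Hs _ e2) (Ht _ e2).
  have Oqs := qO n s s0 sT; have Oqt := qO n t t0 tT.
  apply: le_trans (Ktri Os Oqs Ot) _; apply: le_trans (lerD (lexx _) (Ktri Oqs Oqt Ot)) _.
  have := qK n s t s0 st tT; rewrite (Ksym Os Oqs).
  by move: h1 h2 => /=; rewrite {3}(splitr e); lra.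
have [Og0 H0] := Hg 0 (lexx _) T0; have [OgT HT] := Hg T T0 (lexx _).
have g0 : g 0 = x.
  apply: (K_eq0 Hmet) => //; apply/eqP; rewrite eq_le K_ge0 andbT.
  apply/ler_addgt0Pl => e e0; have [n [h1 _]] := ultra_pair UU (H0 _ e0) (H0 _ e0).
  by rewrite addr0 Ksym // ltW //; have [<- _ _] := Hq n.
have gT : g T = y.
  apply: (K_eq0 Hmet) => //; apply/eqP; rewrite eq_le K_ge0 andbT.
  apply/ler_addgt0Pl => e e0; have e2 : 0 < e / 2 by rewrite divr_gt0.
  have [N HN] := inv_small e2.
  have [n [h1 h2]] := ultra_pair UU (HT _ e2) (UN N).
  have Oq := qO n T T0 (lexx _); rewrite addr0.
  apply: le_trans (Ktri OgT Oq Oy) _; rewrite (Ksym OgT Oq) (splitr e) lerD //; first exact: ltW.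
  have [_ qy H] := Hq n; rewrite -{1}qy.
  have [_ h] := H T (T + n.+1%:R^-1) T0 (TL n) (lexx _).
  apply: le_trans h _; rewrite addrC addKr; exact: ltW (HN _ h2).
exists g; split=> //; split.
  by move=> t /=; rewrite in_itv /= => /andP[t0 tT]; have [] := Hg t t0 tT.
have gE s t : 0 <= s -> s <= t -> t <= T -> K (g s) (g t) = t - s.
  move=> s0 st tT; have t0 := le_trans s0 st; have sT := le_trans st tT.
  apply/eqP; rewrite eq_le gK //=.
  have [Os _] := Hg s s0 sT; have [Ot _] := Hg t t0 tT.
  have := Ktri Ox Os Oy; have := Ktri Os Ot Oy.
  have := gK 0 s (lexx _) s0 sT; have := gK t T t0 tT (lexx _).
  by rewrite g0 gT -/T; move: (K _ _) (K _ _) (K _ _) (K _ _) => a b c e; lra.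
move=> s t; rewrite /= !in_itv /= => /andP[s0 sT] /andP[t0 tT].
have [st|ts] := leP s t; first by rewrite gE // distrC ger0_norm // subr_ge0.
have [Os _] := Hg s s0 sT; have [Ot _] := Hg t t0 tT.
by rewrite Ksym // gE ?(ltW ts) // ger0_norm // subr_ge0 ltW.
Qed.

End HopfRinow.

(** * Contraction near the boundary *)

Section Contraction.
Variables (R : realType) (d : nat) (Omega : set 'rV[R[i]]_d) (M : R).
Local Notation V := 'rV[R[i]]_d.
Local Notation K := (kobayashi Omega).
Hypothesis Hbd : forall z, Omega z -> enorm z <= M.
Hypothesis Hmet : metric_on Omega K.
Hypothesis Hopen : open Omega.
Hypothesis Hdisc : no_nontrivial_analytic_discs (boundary Omega).
Variable o : V.
Hypothesis Oo : Omega o.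
Implicit Types (x y z w v : V).

Local Notation Ktri := (Ktri Hmet).
Local Notation Ksym := (Ksym Hmet).

Lemma boundaryP p : boundary Omega p <-> (closure Omega p /\ ~ Omega p).
Proof. by rewrite /boundary (interior_id _).1. Qed.

(** A limit inside Omega would be at finite distance from o. *)
Lemma ultra_boundary (T : Type) (U : set_system T) (UU : UltraFilter U)
    (f : T -> V) p : (forall k, Omega (f k)) ->
  (forall r : R, U [set k | r < K o (f k)]) ->
  (forall e : R, 0 < e -> U [set k | enorm (f k - p) < e]) ->
  boundary Omega p.
Proof.
move=> Of Kf fp; apply/boundaryP; split.
  move=> A /nbhs_enorm[e e0 eA]; have [k [fk _]] := ultra_pair UU (fp e e0) (fp e e0).
  by exists (f k); split; [exact: Of|exact: eA].
move=> Op; have [rho rho0 Hrho] := open_inball Hopen Op.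
have r2 : 0 < rho / 2 by rewrite divr_gt0.
have [k [/= h1 h2]] := ultra_pair UU (fp _ r2) (Kf (K o p + 2)).
have := K_le_enorm Hmet Hrho rho0 (ltW h1).
have : 4 / rho * enorm (f k - p) <= 2.
  have -> : 2 = 4 / rho * (rho / 2) by field; rewrite gt_eqF.
  by rewrite ler_pM2l ?divr_gt0 // ltW.
have := Ktri Oo Op (Of k); move: (4 / rho * _) => X; lra.
Qed.

(** Otherwise a limit of discs whose centres leave every ball would be a
    nonconstant disc: by bounded hyperbolic displacement all of its points lie in
    the boundary, which is excluded. *)
Lemma far_discs_small (r eta : R) : 0 < r -> r < 1 -> 0 < eta ->
  exists rho, forall phi (s : R[i]), holomorphic_disc Omega phi -> rho <= K o (phi 0) ->
    cabs s < r -> enorm (phi s - phi 0) <= eta.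
Proof.
move=> r0 r1 eta0; apply: contrapT => nE.
have /choice[c Hc] (n : nat) : exists c : (R[i] -> V) * R[i], [/\ holomorphic_disc Omega c.1,
    n%:R <= K o (c.1 0), cabs c.2 < r & eta < enorm (c.1 c.2 - c.1 0)].
  apply: contrapT => nc; apply: nE; exists n%:R => phi s hp Kp sr.
  by rewrite leNgt; apply/negP => H; apply: nc; exists (phi, s).
have [U [UU UN]] := nat_ultra.
have pd k (z : R[i]) : unit_disc z -> derivable (c k).1 z 1.
  by have [[+ _] _ _ _] := Hc k; exact.
have pO k (z : R[i]) : unit_disc z -> Omega ((c k).1 z).
  by have [[_ +] _ _ _] := Hc k; exact.
have [psi [psid Hpsi]] := ultra_disc UU pd (fun k (s : R[i]) h => @Hbd _ (pO k s h)).
have [|lr Hlr] := @ultra_real R nat U UU (fun n => complex.Re (c n).2) 1.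
  apply: filterE => n /=; apply: le_trans (Re_le_cabs _) _.
  by have [_ _ h _] := Hc n; rewrite ltW // (lt_trans h).
have [|li Hli] := @ultra_real R nat U UU (fun n => complex.Im (c n).2) 1.
  apply: filterE => n /=; apply: le_trans (Im_le_cabs _) _.
  by have [_ _ h _] := Hc n; rewrite ltW // (lt_trans h).
pose l := Complex lr li.
have Hl (e : R) : 0 < e -> U [set n | cabs ((c n).2 - l) < e].
  move=> e0; have e2 : 0 < e / 2 by rewrite divr_gt0.
  apply: filterS (filterI (Hlr _ e2) (Hli _ e2)) => n /= [h1 h2].
  apply: le_lt_trans (cabs_le_ReIm _) _; rewrite ReB ImB /= (splitr e).
  exact: ltrD.
have lr1 : cabs l <= r.
  apply/ler_addgt0Pl => e e0; have [n [h _]] := ultra_pair UU (Hl e e0) (Hl e e0).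
  have [_ _ h2 _] := Hc n; rewrite -(subrK (c n).2 l).
  apply: le_trans (cabsD _ _) _; rewrite cabsB; apply: lerD; exact: ltW.
have l1 : unit_disc l by rewrite /unit_disc /=; exact: le_lt_trans lr1 r1.
have u0 : unit_disc (0 : R[i]) by rewrite /unit_disc /= cabs0.
apply: Hdisc; exists psi; split.
  split=> // z z1; apply: (@ultra_boundary _ U UU (fun k => (c k).1 z)).
  - by move=> k; exact: pO.
  - move=> b; pose b' := b + plen (cabs z).
    have [N HN] : exists N : nat, b' < N%:R.
      by exists (Num.truncn b').+1; exact: truncnS_gt.
    apply: filterS (UN N) => n /= Nn; have [hp Kn _ _] := Hc n.
    have := K_le_plen hp z1; have := Ktri Oo (pO n z z1) (pO n 0 u0).
    rewrite (Ksym (pO n z z1)) ?(pO n 0 u0) //; last exact: pO.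
    have : N%:R <= n%:R :> R by rewrite ler_nat.
    rewrite /b' in HN; lra.
  - exact: Hpsi.
exists 0, l; split=> // E.
have s0 : 0 < 1 - cabs l by rewrite subr_gt0.
pose C := lconst R d * M / (1 - cabs l).
have e4 : 0 < eta / 4 by rewrite divr_gt0.
have C0 : 0 <= C.
  have M0 : 0 <= M by apply: le_trans (enorm_ge0 _) (@Hbd _ Oo).
  by rewrite divr_ge0 // ?mulr_ge0 // ltW // lconst_gt0.
have t0 : 0 < Num.min (1 - cabs l) (eta / 4 / (C + 1)).
  by rewrite lt_min s0 /= divr_gt0 // ltr_wpDl.
have [k [/= h1 [h2 h3]]] := ultra_pair UU (Hl _ t0) (filterI (Hpsi l l1 _ e4) (Hpsi 0 u0 _ e4)).
have [hp _ _ big] := Hc k.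
move: h1; rewrite lt_min => /andP[h1 h4].
have := disc_equicont l1 (pd k) (fun (s : R[i]) h => @Hbd _ (pO k s h)) h1.
rewrite [l + _]addrC subrK -/C => EQ.
have CE : C * cabs ((c k).2 - l) <= eta / 4.
  move: h4; rewrite ltr_pdivlMr ?ltr_wpDl // => h4; apply: le_trans (ltW h4).
  by rewrite mulrC ler_wpM2l ?cabs_ge0 // lerDl.
move: big; apply/negP; rewrite -leNgt.
have -> : (c k).1 (c k).2 - (c k).1 0 = ((c k).1 (c k).2 - (c k).1 l)
   + ((c k).1 l - psi l) + (psi l - psi 0) - ((c k).1 0 - psi 0).
  by apply/rowP => i; rewrite !mxE; ring.
rewrite E subrr addr0; apply: le_trans (enormD _ _) _; rewrite enormN.
apply: le_trans (lerD (enormD _ _) (lexx _)) _; move: h2 h3 EQ CE.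
rewrite /= E; move: (enorm _) (enorm _) (enorm _) (C * _) => X Y Z W; lra.
Qed.

(** This is what the absence of analytic discs in the boundary is for. Along a
    chain of discs of length at most D + 1 that starts far from o, every disc is
    nearly constant by [far_discs_small]; the scaled Schwarz lemma turns this
    into a Lipschitz bound with a small constant, and the bounds add up. *)
Lemma no_disc_contraction (D eps : R) : 0 <= D -> 0 < eps ->
  exists rho, forall x y, Omega x -> Omega y -> K x y <= D -> rho <= K o x ->
    enorm (x - y) <= eps.
Proof.
move=> D0 eps0; pose D1 := D + 1; have D10 : 0 < D1 by rewrite ltr_wpDl.
pose r := (1 + th D1) / 2; have t1 := th_lt1 D1; have t0 := th_ge0 (ltW D10).
have r0 : 0 < r by rewrite divr_gt0 // ltr_wpDr.
have r1 : r < 1 by rewrite ltr_pdivrMr //; lra.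
have tr : th D1 < r by rewrite ltr_pdivlMr //; lra.
have L0 := lconst_gt0 R d.
pose eta := eps * r / (2 * lconst R d * D1).
have eta0 : 0 < eta.
  by apply: divr_gt0; [exact: mulr_gt0|do 2 apply: mulr_gt0 => //].

have [rho0 Hrho] := far_discs_small r0 r1 eta0.
exists (rho0 + D1) => x y Ox Oy Kxy Kx.
have KL : K x y < D1 by apply: le_lt_trans Kxy _; rewrite ltrDl.
pose c := eps / D1.
suff : K x y <= D1 /\ (D1 <= D1 -> rho0 + D1 <= K o x -> enorm (x - y) <= c * D1).
  by case=> _ /(_ (lexx _) Kx); rewrite divfK // gt_eqF.
apply: (@kob_chain_ind _ _ Omega (fun x y L => K x y <= L /\
  (L <= D1 -> rho0 + D1 <= K o x -> enorm (x - y) <= c * L))) KL => //.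
- exact: (K_eq0 Hmet).
- move=> z L Oz L0'; split; first by rewrite (Kxx Hmet).
  by move=> _ _; rewrite subrr enorm0 mulr_ge0 // divr_ge0 ?ltW.
move=> x' y' z' L s Ox' Oy' Oz' L0' [Kx' IH] lk.
have Ks := link_K lk; have [s0 s1 [phi [hp p0 ps]]] := lk.
have l0 := plen_ge0 s0 s1.
split; first by apply: le_trans (Ktri Ox' Oy' Oz') _; exact: lerD.
move=> LD Kox'; have LD1 : L <= D1 by lra.
apply: le_trans (enorm_triangle y' _ _) _; rewrite mulrDr; apply: lerD; first exact: IH.
have Koy : rho0 <= K o (phi 0).
  by rewrite p0; have := Ktri Oo Oy' Ox'; rewrite (Ksym Oy' Ox'); lra.
have sr : s < r.
  apply: le_lt_trans tr; rewrite -(th_plen s0 s1); apply: th_le; lra.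
have := @disc_schwarz_scaled _ _ phi eta r s%:C r0 (ltW r1) hp.1.
rewrite cabs_real (ger0_norm s0) ps p0 enormB => /(_ _ sr) H.
apply: le_trans (H _) _; first by move=> z zr; rewrite -p0; exact: Hrho.
have -> : c * plen s = lconst R d * eta / r * (2 * plen s).
  by rewrite /c /eta; field; rewrite !gt_eqF.
apply: ler_wpM2l; last exact: plen_ge.
by apply: divr_ge0; [apply: mulr_ge0|]; exact: ltW.
Qed.

End Contraction.

(** * Gromov hyperbolic spaces and the Morse lemma *)

Lemma up_log_bound2 (k : nat) : (2 ^ up_log 2 k <= 2 * k + 2)%N.
Proof.
have [k1|k1] := leqP k 1; first by case: k k1 => [|[|]].
have := up_log_bounds (isT : (1 < 2)%N) k1 => /andP[+ _].
have : (0 < up_log 2 k)%N by rewrite up_log_gt0.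
by case: (up_log 2 k) => // N' _; rewrite /= expnS; lia.
Qed.

Section Hyperbolic.
Variables (R : realType) (T : Type) (X : set T) (D : T -> T -> R) (delta : R).
Hypothesis Hmet : metric_on X D.
Hypothesis delta0 : 0 < delta.
Implicit Types (x y z o p : T) (g : R -> T).

(** Geodesics parametrized from 0, in an arbitrary metric space. *)
Definition geo g (L : R) x y := [/\ 0 <= L, g 0 = x, g L = y &
  forall s t, 0 <= s -> s <= L -> 0 <= t -> t <= L -> X (g s) /\ D (g s) (g t) = `|s - t|].

Hypothesis Hgeo : forall x y, X x -> X y -> exists g, geo g (D x y) x y.
Hypothesis Hslim : forall x y z g1 g2 g3 L1 L2 L3,
  geo g1 L1 x y -> geo g2 L2 y z -> geo g3 L3 z x -> forall t, 0 <= t -> t <= L1 ->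
  exists s, (0 <= s /\ s <= L2 /\ D (g1 t) (g2 s) <= delta) \/
            (0 <= s /\ s <= L3 /\ D (g1 t) (g3 s) <= delta).

Let Dge0 x y : X x -> X y -> 0 <= D x y. Proof. by case: Hmet => H _ _ _; exact: H. Qed.
Let Dsym x y : X x -> X y -> D x y = D y x. Proof. by case: Hmet => _ _ H _; exact: H. Qed.
Let Dtri y x z : X x -> X y -> X z -> D x z <= D x y + D y z.
Proof. by case: Hmet => _ _ _ H Hx Hy Hz; exact: H. Qed.
Let Dxx x : X x -> D x x = 0. Proof. by case: Hmet => _ H _ _ Hx; apply/H. Qed.

Lemma geo_in g L x y t : geo g L x y -> 0 <= t -> t <= L -> X (g t).
Proof. by move=> [_ _ _ H] t0 tL; have [] := H t t t0 tL t0 tL. Qed.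

Lemma geo_l g L x y t : geo g L x y -> 0 <= t -> t <= L -> D x (g t) = t.
Proof.
move=> [L0 <- _ H] t0 tL; have [_ ->] := H 0 t (lexx _) L0 t0 tL.
by rewrite sub0r normrN ger0_norm.
Qed.

Lemma geo_r g L x y t : geo g L x y -> 0 <= t -> t <= L -> D (g t) y = L - t.
Proof.
move=> [L0 _ <- H] t0 tL; have [_ ->] := H t L t0 tL L0 (lexx _).
by rewrite distrC ger0_norm // subr_ge0.
Qed.

Lemma geo_end g L x y : geo g L x y -> X x /\ X y.
Proof.
move=> G; have [L0 <- <- _] := G.
by split; [apply: (geo_in G)|apply: (geo_in G)].
Qed.

Lemma geo_len g L x y : geo g L x y -> D x y = L.
Proof. by move=> G; have [L0 _ gL _] := G; rewrite -{1}gL (geo_l G). Qed.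

(** Up to a multiple of delta, the distance from o to a geodesic from x to y:
    see [gp_le_geo] and [gp_ge_geo]. *)
Definition gromov_prod o x y : R := (D o x + D o y - D x y) / 2.

Lemma gp_sym o x y : X x -> X y -> gromov_prod o x y = gromov_prod o y x.
Proof. by move=> Hx Hy; rewrite /gromov_prod (Dsym Hx Hy) (addrC (D o x)). Qed.

Lemma gp_le_geo o x y g L t : X o -> geo g L x y -> 0 <= t -> t <= L ->
  gromov_prod o x y <= D o (g t).
Proof.
move=> Xo G t0 tL; have [Xx Xy] := geo_end G; have Xt := geo_in G t0 tL.
have := Dtri Xo Xt Xx; have := Dtri Xo Xt Xy; have := geo_len G.
rewrite (Dsym Xt Xx) (geo_l G t0 tL) (geo_r G t0 tL) /gromov_prod.
by move=> -> h1 h2; rewrite ler_pdivrMr //; lra.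
Qed.

(** On the triangle x, y, o consider the last point of [x, y] that is close to
    [o, x]. Just after it the points are close to [y, o], so it is close to both
    sides, and the triangle inequality concludes. *)
Lemma gp_ge_geo o x y g L : X o -> geo g L x y ->
  exists t, [/\ 0 <= t, t <= L & D o (g t) - 4 * delta <= gromov_prod o x y].
Proof.
move=> Xo G; have [Xx Xy] := geo_end G; have [L0 g0 gL _] := G.
have [g2 G2] := Hgeo Xy Xo; have [g3 G3] := Hgeo Xo Xx.
have [_ g30 g3L _] := G3; have [_ g20 g2L _] := G2.
have Dox := Dge0 Xo Xx; have Dyo := Dge0 Xy Xo.
pose S := [set t : R | 0 <= t /\ t <= L /\
   exists s, [/\ 0 <= s, s <= D o x & D (g t) (g3 s) <= delta]].
have S0 : S 0.
  split=> //; split=> //; exists (D o x); split=> //.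
  by rewrite g0 g3L Dxx // ltW.
have hS : has_sup S by split; [exists 0|exists L => t [_ [tL _]]].
have sup0 : 0 <= sup S by apply: sup_upper_bound.
have supL : sup S <= L by apply: sup_le_ub; [exists 0|move=> t [_ [tL _]]].
have [t1 [t10 [t1L [s1 [s10 s1L Ds1]]]] t1S] := sup_adherent delta0 hS.
have t1s : t1 <= sup S by apply: sup_upper_bound => //; split=> //; split=> //; exists s1.
have [t2 [t20 t2L t12 [s2 [s20 s2L Ds2]]]] : exists t2, [/\ 0 <= t2, t2 <= L,
    `|t1 - t2| <= 2 * delta &
    exists s, [/\ 0 <= s, s <= D y o & D (g t2) (g2 s) <= delta]].
  have [sL|sL] := leP L (sup S + delta).
    exists L; split=> //.
      by rewrite distrC ger0_norm ?subr_ge0 //; lra.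
    by exists 0; split=> //; rewrite gL g20 Dxx // ltW.
  exists (sup S + delta); split.
  - by rewrite addr_ge0 // ltW.
  - exact: ltW.
  - by rewrite distrC ger0_norm; lra.
  - have h0 : 0 <= sup S + delta by rewrite addr_ge0 // ltW.
    have [s [[a1 [a2 a3]]|[a1 [a2 a3]]]] := Hslim G G2 G3 h0 (ltW sL).
      by exists s.
    have : sup S + delta <= sup S.
      by apply: sup_upper_bound => //; split=> //; split; [exact: ltW|exists s].
    by rewrite -subr_ge0 opprD addrA subrr sub0r oppr_ge0 leNgt delta0.
have Xt1 := geo_in G t10 t1L; have Xt2 := geo_in G t20 t2L.
have Xs1 := geo_in G3 s10 s1L; have Xs2 := geo_in G2 s20 s2L.
exists t1; split=> //.
have [_ D12] : X (g t1) /\ D (g t1) (g t2) = `|t1 - t2| by case: G => _ _ _; exact.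
have e1 := geo_l G3 s10 s1L; have e2 := geo_r G3 s10 s1L.
have e3 := geo_l G2 s20 s2L; have e4 := geo_r G2 s20 s2L.
have e5 := geo_l G t10 t1L; have e6 := geo_r G t10 t1L; have e7 := geo_len G.
have i1 := Dtri Xo Xs1 Xt1; have i2 := Dtri Xt1 Xs1 Xx.
have i3 := Dtri Xt1 Xt2 Xs2; have i4 := Dtri Xt1 Xs2 Xo; have i5 := Dtri Xt1 Xs2 Xy.
rewrite (Dsym Xs1 Xt1) in i1; rewrite (Dsym Xt1 Xx) in i2; rewrite (Dsym Xt1 Xo) in i4.
rewrite (Dsym Xs2 Xy) in i5; rewrite (Dsym Xy Xo) in e4.
rewrite /gromov_prod ler_pdivlMr // e7.
move: i1 i2 i3 i4 i5 Ds1 Ds2 t12; rewrite e1 e2 e3 e4 e5 e6 D12.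
move: (D o (g t1)) (D o x) (D o y) (D _ _) (D _ _) (D _ _) (`|t1 - t2|) => a b c e f h k.
lra.
Qed.

(** A point of [x, z] that almost realizes the product is close to one of the two
    other sides of the triangle x, y, z. *)
Lemma four_point o x y z : X o -> X x -> X y -> X z ->
  Num.min (gromov_prod o x y) (gromov_prod o y z) - 5 * delta <= gromov_prod o x z.
Proof.
move=> Xo Xx Xy Xz.
have [g1 G1] := Hgeo Xx Xz; have [g2 G2] := Hgeo Xz Xy; have [g3 G3] := Hgeo Xy Xx.
have [t [t0 tL H]] := gp_ge_geo Xo G1; have Xt := geo_in G1 t0 tL.
have [s [[s0 [sL Ds]]|[s0 [sL Ds]]]] := Hslim G1 G2 G3 t0 tL.
  have Xs := geo_in G2 s0 sL; have := gp_le_geo Xo G2 s0 sL.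
  have := Dtri Xo Xt Xs; rewrite (gp_sym _ Xz Xy).
  have : Num.min (gromov_prod o x y) (gromov_prod o y z) <= gromov_prod o y z by rewrite ge_min lexx orbT.
  lra.
have Xs := geo_in G3 s0 sL; have := gp_le_geo Xo G3 s0 sL.
have := Dtri Xo Xt Xs; rewrite (gp_sym _ Xy Xx).
have : Num.min (gromov_prod o x y) (gromov_prod o y z) <= gromov_prod o x y by rewrite ge_min lexx.
lra.
Qed.

Lemma gp_ge_l o x y : X o -> X x -> X y -> D o x - D x y <= gromov_prod o x y.
Proof.
move=> Xo Xx Xy; have := Dtri Xo Xy Xx; rewrite (Dsym Xy Xx) /gromov_prod ler_pdivlMr //.
lra.
Qed.

(** Exponential divergence: a chain of at most 2 ^ N unit steps passes close to
    every point at which its ends have a small Gromov product. *)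
Lemma chain_gp (c : nat -> T) (p : T) (N : nat) : X p -> forall i m,
  (m <= 2 ^ N)%N -> (forall k, (i <= k)%N -> (k <= i + m)%N -> X (c k)) ->
  (forall k, (i <= k)%N -> (k < i + m)%N -> D (c k) (c k.+1) <= 1) ->
  exists2 k, (i <= k)%N && (k <= i + m)%N &
    D p (c k) <= gromov_prod p (c i) (c (i + m)%N) + 1 + (5 * delta) *+ N.
Proof.
move=> Xp; elim: N => [|N IH] i m mN Xc Dc.
  have Xi : X (c i) by apply: Xc => //; exact: leq_addr.
  have Xm : X (c (i + m)%N) by apply: Xc => //; exact: leq_addr.
  have D1 : D (c i) (c (i + m)%N) <= 1.
    case: m mN Xc Dc Xm => [|[|m]] // _ Xc Dc Xm; first by rewrite addn0 Dxx.
    by rewrite addn1; apply: Dc; rewrite // addn1.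
  exists i; first by rewrite leqnn leq_addr.
  by rewrite mulr0n addr0; have := gp_ge_l Xp Xi Xm; lra.
pose h := minn m (2 ^ N); have hm : (h <= m)%N by rewrite geq_minl.
have hN : (h <= 2 ^ N)%N by rewrite geq_minr.
have mhN : (m - h <= 2 ^ N)%N by move: mN; rewrite /h expnS; lia.
have [||k1 k1i H1] := IH i h hN.
- by move=> k ? ?; apply: Xc; lia.
- by move=> k ? ?; apply: Dc; lia.
have [||k2 k2i H2] := IH (i + h)%N (m - h)%N mhN.
- by move=> k ? ?; apply: Xc; lia.
- by move=> k ? ?; apply: Dc; lia.
have Xi : X (c i) by apply: Xc; lia.
have Xm : X (c (i + m)%N) by apply: Xc; lia.
have Xh : X (c (i + h)%N) by apply: Xc; lia.
have E : (i + h + (m - h))%N = (i + m)%N by lia.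
rewrite E in H2 k2i.
have := four_point Xp Xi Xh Xm.
have -> : (5 * delta) *+ N.+1 = 5 * delta + (5 * delta) *+ N by rewrite [LHS]mulrS.
have [hh|hh] := leP (gromov_prod p (c i) (c (i + h)%N)) (gromov_prod p (c (i + h)%N) (c (i + m)%N)) => F.
  exists k1; first by lia.
  by move: H1 F; move: (5 * delta *+ N) => q; lra.
exists k2; first by lia.
by move: H2 F; move: (5 * delta *+ N) => q; lra.
Qed.

Lemma chain_gp_between (c : nat -> T) (p : T) (N i j n : nat) : X p ->
  (i <= j)%N -> (j <= n)%N -> (j - i <= 2 ^ N)%N ->
  (forall k, (k <= n)%N -> X (c k)) ->
  (forall k, (k < n)%N -> D (c k) (c k.+1) <= 1) ->
  exists2 k, (k <= n)%N & D p (c k) <= gromov_prod p (c i) (c j) + 1 + (5 * delta) *+ N.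
Proof.
move=> Xp ij jn jiN Xc Dc.
have [||k ki Hk] := @chain_gp c p N Xp i (j - i)%N jiN.
- by move=> k _; rewrite subnKC // => kj; apply: Xc; exact: leq_trans kj jn.
- by move=> k _; rewrite subnKC // => kj; apply: Dc; exact: leq_trans kj jn.
rewrite subnKC // in ki Hk; exists k => //.
by case/andP: ki => _ kj; exact: leq_trans kj jn.
Qed.

(** An exponential dominated by an affine function of its exponent bounds the
    exponent. *)
Lemma pow2_growth (a b : R) (N : nat) : 0 <= a -> 0 <= b ->
  (2 ^ N)%N%:R <= a * N%:R + b -> N%:R <= 4 * (a + b) + 1.
Proof.
move=> a0 b0 H; case: N H => [|N] H; first by rewrite addr_ge0 // mulr_ge0 // addr_ge0.
set n := N.+1 in H *.
have n1 : 1 <= n%:R :> R by rewrite ler1n.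
have sq : (n * n <= 4 * 2 ^ n)%N.
  have e1 : (n <= n./2 + n./2 + 1)%N by lia.
  have e2 : (n./2 < 2 ^ n./2)%N by exact: ltn_expl.
  have e3 : (2 ^ n./2 * 2 ^ n./2 <= 2 ^ n)%N by rewrite -expnD leq_exp2l //; lia.
  have : ((n./2 + 1) * (n./2 + 1) <= 2 ^ n./2 * 2 ^ n./2)%N by apply: leq_mul; lia.
  by nia.
have sqR : n%:R * n%:R <= 4 * (2 ^ n)%N%:R :> R by rewrite -!natrM ler_nat.
have : n%:R * n%:R <= 4 * ((a + b) * n%:R) :> R.
  apply: le_trans sqR _; rewrite ler_pM2l //; apply: le_trans H _.
  by rewrite mulrDl lerD2l ler_peMr.
have n0 : 0 < n%:R :> R by rewrite (lt_le_trans ltr01).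
rewrite mulrA ler_pM2r // => /le_trans; apply.
by rewrite lerDl.
Qed.

Section Morse.
Variables A B : R.
Hypothesis A0 : 0 <= A.
Hypothesis B0 : 0 <= B.

Definition morse_const : R :=
  let a := A * (30 * delta) in let b := A * (60 * delta + 10) + B in
  5 * delta * (4 * (2 * a + 2 * (b + 1)) + 1) + 10 * delta + 2.

(** Morse lemma, one half: a geodesic stays close to a discrete quasi-geodesic
    with the same ends. Consider the point of the geodesic that is almost
    farthest from the chain: a detour through the chain has length linear in
    this distance, and exponential in it by [chain_gp]. *)
Lemma morse (c : nat -> T) (n : nat) (g : R -> T) (L : R) :
  (forall k, (k <= n)%N -> X (c k)) ->
  (forall k, (k < n)%N -> D (c k) (c k.+1) <= 1) ->
  (forall i j, (i <= j)%N -> (j <= n)%N -> (j - i)%:R <= A * D (c i) (c j) + B) ->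
  geo g L (c 0%N) (c n) -> forall t, 0 <= t -> t <= L ->
  exists2 i, (i <= n)%N & D (g t) (c i) <= morse_const.
Proof.
move=> Xc Dc Qc G; have [L0 g0 gL _] := G.
have /choice[m Hm] (t : R) : exists i, (i <= n)%N /\
    forall j, (j <= n)%N -> D (g t) (c i) <= D (g t) (c j).
  have [i _ Hi] := @arg_minP _ R 'I_n.+1 ord0 predT (fun i => D (g t) (c i)) isT.
  exists i; split; first by rewrite -ltnS.
  by move=> j jn; have := Hi (inord j) isT; rewrite inordK.
pose f t := D (g t) (c (m t)).
pose S := [set f t | t in [set t | 0 <= t /\ t <= L]].
have fL t : 0 <= t -> t <= L -> f t <= L.
  move=> t0 tL; have [_ H] := Hm t; apply: le_trans (H 0%N _) _ => //.
  have Xt := geo_in G t0 tL; have [X0 _] := geo_end G.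
  by rewrite Dsym // (geo_l G).
have hS : has_sup S.
  by split; [exists (f 0), 0|exists L => _ [t [t0 tL] <-]; exact: fL].
have [_ [t0 [t00 t0L] <-] Ht0] := sup_adherent ltr01 hS.
pose Del := f t0.
have fD t : 0 <= t -> t <= L -> f t <= Del + 1.
  move=> h1 h2; have : f t <= sup S by apply: sup_upper_bound => //; exists t.
  by rewrite /Del; lra.
suff HD : Del + 1 <= morse_const.
  move=> t h1 h2; have [mn _] := Hm t; exists (m t) => //.
  exact: le_trans (fD t h1 h2) HD.
pose p := g t0; have Xp : X p by exact: geo_in G t00 t0L.
have Dp k : (k <= n)%N -> Del <= D p (c k) by have [_ H] := Hm t0; exact: H.
have Del0 : 0 <= Del by have [mn _] := Hm t0; apply: Dge0 => //; exact: Xc.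
have [X0 Xn] := geo_end G.
(* the two points of the geodesic at distance 2 Del + 1 from p, or the ends of
   the geodesic, with nearby points of the chain *)
have [s1 [i1 [s10 s1t i1n gp1 D1]]] : exists s i, [/\ 0 <= s, s <= t0, (i <= n)%N,
    Del <= gromov_prod p (g s) (c i) & D p (c i) <= 3 * Del + 2].
  have [tr|tr] := leP (2 * Del + 1) t0; last first.
    exists 0, 0%N; split=> //; rewrite ?g0.
      rewrite /gromov_prod Dxx // subr0 -mulr2n -[_ *+ 2]mulr_natr mulfK //; exact: Dp.
    by rewrite Dsym // (geo_l G) //; move: tr Del0; lra.
  have s0 : 0 <= t0 - (2 * Del + 1) by rewrite subr_ge0.
  have sL : t0 - (2 * Del + 1) <= L by lra.
  pose s := t0 - (2 * Del + 1); have [mn _] := Hm s.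
  have Xs := geo_in G s0 sL; have Xm := Xc _ mn.
  have Ds : D p (g s) = 2 * Del + 1.
    have [_ _ _ H] := G; have [_ ->] := H t0 s t00 t0L s0 sL.
    by rewrite /s opprB addrC subrK ger0_norm // addr_ge0 // mulr_ge0.
  exists s, (m s); split=> //.
  - by rewrite lerBlDr lerDl addr_ge0 // mulr_ge0.
  - have := fD s s0 sL; have := Dp _ mn; rewrite /gromov_prod Ds ler_pdivlMr // /f; lra.
  - have := Dtri Xp Xs Xm; rewrite Ds; have := fD s s0 sL; rewrite /f; lra.
have [s2 [i2 [s2t s2L i2n gp2 D2]]] : exists s i, [/\ t0 <= s, s <= L, (i <= n)%N,
    Del <= gromov_prod p (c i) (g s) & D p (c i) <= 3 * Del + 2].
  have [tr|tr] := leP (2 * Del + 1) (L - t0); last first.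
    exists L, n; split=> //; rewrite ?gL.
      rewrite /gromov_prod Dxx // subr0 -mulr2n -[_ *+ 2]mulr_natr mulfK //; exact: Dp.
    by rewrite (geo_r G) //; move: tr Del0; lra.
  have s0 : 0 <= t0 + (2 * Del + 1) by rewrite !addr_ge0 // mulr_ge0.
  have sL : t0 + (2 * Del + 1) <= L by lra.
  pose s := t0 + (2 * Del + 1); have [mn _] := Hm s.
  have Xs := geo_in G s0 sL; have Xm := Xc _ mn.
  have Ds : D p (g s) = 2 * Del + 1.
    have [_ _ _ H] := G; have [_ ->] := H t0 s t00 t0L s0 sL.
    by rewrite /s opprD addrA subrr sub0r normrN ger0_norm // addr_ge0 // mulr_ge0.
  exists s, (m s); split=> //.
  - by rewrite lerDl addr_ge0 // mulr_ge0.
  - have := fD s s0 sL; have := Dp _ mn; rewrite /gromov_prod Ds (Dsym Xm Xs) ler_pdivlMr // /f; lra.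
  - have := Dtri Xp Xs Xm; rewrite Ds; have := fD s s0 sL; rewrite /f; lra.
have s20 := le_trans t00 s2t; have s1L := le_trans s1t t0L.
have Xs1 := geo_in G s10 s1L; have Xs2 := geo_in G s20 s2L.
have Xi1 := Xc _ i1n; have Xi2 := Xc _ i2n.
have gp0 : gromov_prod p (g s1) (g s2) = 0.
  have [_ _ _ H] := G.
  have [_ e1] := H t0 s1 t00 t0L s10 s1L; have [_ e2] := H t0 s2 t00 t0L s20 s2L.
  have [_ e3] := H s1 s2 s10 s1L s20 s2L.
  rewrite /gromov_prod /p e1 e2 e3 ger0_norm ?subr_ge0 // distrC ger0_norm ?subr_ge0 //.
  rewrite distrC ger0_norm ?subr_ge0 ?(le_trans s1t) //.
  by apply/eqP; rewrite mulf_eq0; apply/orP; left; apply/eqP; ring.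
(* the chain between the two feet *)
pose k := maxn (i1 - i2) (i2 - i1).
pose N := up_log 2 k.
have kN : (k <= 2 ^ N)%N by apply: up_logP.
have mid : Del <= gromov_prod p (c i1) (c i2) + 1 + (5 * delta) *+ N.
  have [le12|/ltnW le21] := leqP i1 i2.
    have le : (i2 - i1 <= 2 ^ N)%N by apply: leq_trans kN; rewrite leq_maxr.
    have [q qn Hq] := chain_gp_between Xp le12 i2n le Xc Dc.
    exact: le_trans (Dp q qn) Hq.
  have le : (i1 - i2 <= 2 ^ N)%N by apply: leq_trans kN; rewrite leq_maxl.
  have [q qn Hq] := chain_gp_between Xp le21 i1n le Xc Dc.
  rewrite (gp_sym _ Xi1 Xi2); exact: le_trans (Dp q qn) Hq.
have F1 := four_point Xp Xs1 Xi1 Xs2; have F2 := four_point Xp Xi1 Xi2 Xs2.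
have DN : Del <= (5 * delta) *+ N + 10 * delta + 1.
  have nn : 0 <= (5 * delta) *+ N by rewrite mulrn_wge0 // mulr_ge0 // ltW.
  move: gp1 gp2 mid nn delta0 F1 F2; rewrite gp0; move: (5 * delta *+ N) => q.
  have [h1|h1] := leP (gromov_prod p (g s1) (c i1)) (gromov_prod p (c i1) (g s2));
  have [h2|h2] := leP (gromov_prod p (c i1) (c i2)) (gromov_prod p (c i2) (g s2)); lra.
have Dk : D (c i1) (c i2) <= 6 * Del + 4.
  by have := Dtri Xi1 Xp Xi2; rewrite (Dsym Xi1 Xp); lra.
have kb : k%:R <= A * (6 * Del + 4) + B.
  have AD : A * D (c i1) (c i2) + B <= A * (6 * Del + 4) + B by rewrite lerD2r ler_wpM2l.
  apply: le_trans AD; have [le12|/ltnW le21] := leqP i1 i2.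
    have -> : k = (i2 - i1)%N.
      by apply/maxn_idPr; move: le12; rewrite -subn_eq0 => /eqP ->.
    exact: Qc.
  have -> : k = (i1 - i2)%N.
    by apply/maxn_idPl; move: le21; rewrite -subn_eq0 => /eqP ->.
  by rewrite (Dsym Xi1 Xi2); exact: Qc.
have N2 : (2 ^ N <= 2 * k + 2)%N by exact: up_log_bound2.
have NR : (2 ^ N)%N%:R <= 2 * (A * (30 * delta)) * N%:R + 2 * (A * (60 * delta + 10) + B + 1).
  have h1 : (2 ^ N)%N%:R <= 2 * k%:R + 2 :> R by rewrite -natrM -natrD ler_nat.
  apply: le_trans h1 _.
  have h2 : A * (6 * Del + 4) <= A * (6 * ((5 * delta) *+ N + 10 * delta + 1) + 4).
    by rewrite ler_wpM2l // lerD2r ler_pM2l.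
  have h3 : A * (6 * ((5 * delta) *+ N + 10 * delta + 1) + 4) =
     A * (30 * delta) * N%:R + A * (60 * delta + 10) by rewrite -mulr_natr; ring.
  move: kb h2; rewrite h3; move: (A * (6 * Del + 4)) (A * (60 * delta + 10)) => u v.
  by rewrite -[2 * _ * N%:R]mulrA; move: (A * (30 * delta) * N%:R) => w; lra.
have a0 : 0 <= A * (30 * delta) by rewrite !mulr_ge0 // ltW.
have b0 : 0 <= A * (60 * delta + 10) + B.
  by rewrite addr_ge0 // mulr_ge0 // addr_ge0 // mulr_ge0 // ltW.
have a2 : 0 <= 2 * (A * (30 * delta)) by exact: mulr_ge0.
have b2 : 0 <= 2 * (A * (60 * delta + 10) + B + 1).
  by apply: mulr_ge0 => //; apply: addr_ge0.
have Nb := pow2_growth a2 b2 NR.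
rewrite /morse_const.
have := ler_wpM2l (mulr_ge0 (ler0n R 5) (ltW delta0)) Nb.
move: DN; rewrite -mulr_natr /=; move: (5 * delta * _) (5 * delta * _) => u v; lra.
Qed.

End Morse.
End Hyperbolic.

(** * Absolutely continuous monotone functions *)

Section AbsolutelyContinuousMonotone.
Variable R : realType.
Local Notation mu := (@lebesgue_measure R).

Definition novl (p q : R * R) : bool := (p.2 <= q.1) || (q.2 <= p.1).

Definition ivl (p : R * R) : bool := p.1 <= p.2.

(** Finite sequences of intervals allow inductions that subdivide them. Functions
    on a segment are extended by constants. *)
Definition abs_cont (f : R -> R) := forall e : R, 0 < e -> exists2 r : R, 0 < r &
  forall l : seq (R * R), all ivl l -> pairwise novl l ->
    \sum_(p <- l) (p.2 - p.1) < r -> \sum_(p <- l) `|f p.2 - f p.1| <= e.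

Lemma abs_cont_cont f : abs_cont f -> continuous f.
Proof.
move=> H x; apply/cvgrPdist_le => e e0; have [r r0 rH] := H e e0.
exists r => //= y; rewrite /ball /= => xy.
have [xley|yltx] := leP x y.
  have := rH [:: (x, y)]; rewrite /= !big_seq1 /ivl /= xley distrC => ->//.
  by move: xy; rewrite distrC ger0_norm // subr_ge0.
have := rH [:: (y, x)]; rewrite /= !big_seq1 /ivl /= (ltW yltx) => ->//.
by move: xy; rewrite ger0_norm // subr_ge0 ltW.
Qed.

Section Stieltjes.
Variables (G : cumulative R R) (a b : R).
Hypothesis ab : a <= b.
Hypothesis Gac : abs_cont G.
Hypothesis Gl : forall x, x <= a -> G x = G a.
Hypothesis Gr : forall x, b <= x -> G x = G b.

Let Gnd : nondecreasing G := cumulative_is_nondecreasing G.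

Let nu := lebesgue_stieltjes_measure G.

Lemma stieltjes_itv x y : x <= y -> nu `]x, y]%classic = (G y - G x)%:E.
Proof.
move=> xy; rewrite /nu /lebesgue_stieltjes_measure /measure_extension.
by rewrite measurable_mu_extE/=; [rewrite wlength_itv_bnd|exact: is_ocitv].
Qed.

Lemma stieltjes_setT : (nu setT <= (G b - G a)%:E)%E.
Proof.
rewrite -(bigcup_itvT false false).
pose I n : set R := `]- (n%:R), n%:R]%classic.
have C : (nu \o I) n @[n --> \oo] --> nu (\bigcup_n I n).
  apply: nondecreasing_cvg_mu; rewrite /I//; first exact: bigcup_measurable.
  by move=> *; apply/subsetPset/subset_itv; rewrite leBSide/= ?lerN2 ler_nat.
rewrite -(cvg_lim _ C) //; apply: lime_le; first by apply: cvgP C.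
apply: nearW => n /=; rewrite stieltjes_itv ?ge0_cp // lee_fin.
  apply: lerB.
    by rewrite -[leRHS](Gr (x := Num.max b n%:R)) ?le_max ?lexx // Gnd // le_max lexx orbT.
  by rewrite -[leLHS](Gl (x := Num.min a (- n%:R))) ?ge_min ?lexx // Gnd // ge_min lexx orbT.
Qed.

Lemma bounded_interval (I : set R) : is_interval I -> I !=set0 -> (mu I < +oo)%E ->
  has_inf I /\ has_sup I.
Proof.
move=> iI [x Ix] fin.
have len y z : I y -> I z -> y <= z -> z - y <= fine (mu I).
  move=> Iy Iz yz.
  have sub : `]y, z]%classic `<=` I.
    by move=> t /=; rewrite in_itv /= => /andP[yt tz]; apply: (iI y z) => //; rewrite (ltW yt).
  have : (mu `]y, z]%classic <= mu I)%E.
    apply: le_measure => //; rewrite inE //; exact: is_interval_measurable.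
  rewrite lebesgue_measure_itv /= lte_fin; case: ltP => [_|zy] H.
    have fI : mu I \is a fin_num by rewrite ge0_fin_numE.
    by rewrite -lee_fin fineK // EFinB.
  have -> : z = y by apply/eqP; rewrite eq_le zy.
  by rewrite subrr fine_ge0.
have f0 : 0 <= fine (mu I) by exact: fine_ge0.
split; split; try by exists x.
- exists (x - fine (mu I)) => y Iy; have [xy|/ltW yx] := leP x y.
    by apply: le_trans xy; rewrite lerBlDr lerDl.
  by rewrite lerBlDr addrC -lerBlDr; exact: len.
- exists (x + fine (mu I)) => y Iy; have [xy|/ltW yx] := leP x y.
    by rewrite addrC -lerBlDr; exact: len.
  by apply: le_trans yx _; rewrite lerDl.
Qed.

Lemma interval_len (I : set R) : is_interval I -> I !=set0 -> (mu I < +oo)%E ->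
  ((sup I - inf I)%:E <= mu I)%E.
Proof.
move=> iI I0 fin; have [hi hs] := bounded_interval iI I0 fin.
have fI : mu I \is a fin_num by rewrite ge0_fin_numE.
rewrite -(fineK fI) lee_fin; apply/ler_addgt0Pl => e e0.
have e2 : 0 < e / 2 by rewrite divr_gt0.
have [y Iy ys] := sup_adherent e2 hs; have [x Ix xi] := inf_adherent e2 hi.
suff : y - x <= fine (mu I) by move: ys xi; lra.
have [yx|xy] := leP y x.
  by apply: (@le_trans _ _ 0); [rewrite subr_le0|exact: fine_ge0].
have sub : `]x, y]%classic `<=` I.
  by move=> t /=; rewrite in_itv /= => /andP[xt ty]; apply: (iI x y) => //; rewrite (ltW xt).
have : (mu `]x, y]%classic <= mu I)%E.
  apply: le_measure => //; rewrite inE //; exact: is_interval_measurable.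
rewrite lebesgue_measure_itv /= lte_fin xy => H.
by rewrite -lee_fin fineK // EFinB.
Qed.

Lemma stieltjes_open (I : set R) : open I -> is_interval I -> I !=set0 -> (mu I < +oo)%E ->
  (nu I <= (G (sup I) - G (inf I))%:E)%E.
Proof.
move=> oI iI I0 fin; have [hi hs] := bounded_interval iI I0 fin.
have le : inf I <= sup I.
  by have [x Ix] := I0; apply: le_trans (ge_inf hi.2 Ix) (sup_upper_bound hs Ix).
rewrite -stieltjes_itv //; apply: le_measure; rewrite ?inE //.
  exact: open_measurable.
move=> x Ix /=; rewrite in_itv /= (sup_upper_bound hs Ix) andbT.
have [e /= e0 eI] := open_subball oI Ix.
have h4 : 0 < e / 4 by rewrite divr_gt0.
have : I (x - e / 4).
  apply: (eI (e / 2)) => /=.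
  - by rewrite sub0r normrN ger0_norm ?divr_ge0 ?ltW // ltr_pdivrMr // ltr_pMr // ltr1n.
  - by rewrite divr_gt0.
  - by rewrite /ball /= opprB addrC subrK ger0_norm ?(ltW h4) //; lra.
by move=> /(ge_inf hi.2) H; apply: le_lt_trans H _; rewrite ltrBlDr ltrDl.
Qed.

Lemma interval_disj (I J : set R) : is_interval I -> is_interval J ->
  I !=set0 -> J !=set0 -> (mu I < +oo)%E -> (mu J < +oo)%E -> I `&` J = set0 ->
  novl (inf I, sup I) (inf J, sup J).
Proof.
have key (I' J' : set R) x y : is_interval I' -> is_interval J' -> I' `&` J' = set0 ->
    I' x -> J' y -> x < y -> forall x' y', I' x' -> J' y' -> x' <= y'.
  move=> iI iJ IJ Ix Jy xy x' y' Ix' Jy'; rewrite leNgt; apply/negP => yx.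
  have no z : I' z -> J' z -> False.
    by move=> h1 h2; have : (I' `&` J') z by []; rewrite IJ.
  have [yx'|xy'] := leP y' x.
    by apply: (no x) => //; apply: (iJ y' y) => //; rewrite yx' (ltW xy).
  by apply: (no y') => //; apply: (iI x x') => //; rewrite (ltW xy') (ltW yx).
move=> iI iJ I0 J0 fI fJ IJ.
have [hiI hsI] := bounded_interval iI I0 fI; have [hiJ hsJ] := bounded_interval iJ J0 fJ.
have [x Ix] := I0; have [y Jy] := J0; rewrite /novl /=.
have [xy|yx|E] := ltgtP x y.
- apply/orP; left; apply: sup_le_ub => // x' Ix'; apply: lb_le_inf => // y' Jy'.
  exact: (key I J x y).
- apply/orP; right; apply: sup_le_ub => // x' Ix'; apply: lb_le_inf => // y' Jy'.
  by apply: (key J I y x) => //; rewrite setIC.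
- by exfalso; have : (I `&` J) x by [split; rewrite // E]; rewrite IJ.
Qed.

(** Absolute continuity of G is absolute continuity of its Stieltjes measure:
    cover the null set by an open set of small measure and apply the definition
    to finitely many of its components. *)
Lemma stieltjes_null (E : set R) : measurable E -> mu E = 0 -> nu E = 0.
Proof.
move=> mE E0; apply/eqP; rewrite eq_le measure_ge0 andbT.
apply/lee_addgt0Pr => e e0; rewrite add0e.
have [r r0 rH] := Gac e0.
have fE : (mu E < +oo)%E by rewrite E0.
have [U [oU EU mU]] := lebesgue_regularity_outer mE fE r0.
have measU : measurable U by exact: open_measurable.
have mU' : (mu U < r%:E)%E.
  apply: le_lt_trans mU; have mUE : measurable (U `\` E) by exact: measurableD.
  have H := measureU2 mu mE mUE.
  have EUE : E `|` U `\` E = U by rewrite setDUK.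
  rewrite EUE in H; apply: le_trans H _.
  by rewrite -[leRHS]add0e -E0.
pose I := open_disjoint_itv oU.
have oI i : open (I i) by exact: open_disjoint_itv_open.
have iI i : is_interval (I i) by exact: open_disjoint_itv_is_interval.
have tI : trivIset setT I by exact: open_disjoint_itv_trivIset.
have UI : U = \bigcup_i I i by exact: open_disjoint_itv_bigcup.
have mI i : measurable (I i) by exact: open_measurable.
have fI i : (mu (I i) < +oo)%E.
  apply: le_lt_trans (lt_trans mU' (ltry r)); apply: le_measure.
  - by rewrite inE; exact: mI.
  - by rewrite inE.
  - by rewrite UI; exact: bigcup_sup.
have mUI : measurable (\bigcup_i I i) by rewrite -UI.
have nuU : nu U = (\sum_(i <oo) nu (I i))%E.
  rewrite [in LHS]UI; exact: (measure_semi_bigcup nu mI tI mUI).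
have muU : mu U = (\sum_(i <oo) mu (I i))%E.
  rewrite [in LHS]UI; exact: (measure_semi_bigcup mu mI tI mUI).
apply: (@le_trans _ _ (nu U)); first by apply: le_measure; rewrite ?inE.
rewrite nuU.
apply: lime_le; first by apply: is_cvg_nneseries => n _ _; exact: measure_ge0.
apply: nearW => n.
pose s := [seq i <- index_iota 0 n | I i != set0].
pose l := [seq (inf (I i), sup (I i)) | i <- s].
have sP i : i \in s -> I i !=set0 by rewrite mem_filter => /andP[/set0P].
have H : \sum_(p <- l) `|G p.2 - G p.1| <= e.
  apply: rH.
  - apply/allP => _ /mapP[i /sP I0 ->]; rewrite /ivl /=.
    have [hi hs] := bounded_interval (iI i) I0 (fI i).
    by have [x Ix] := I0; apply: le_trans (ge_inf hi.2 Ix) (sup_upper_bound hs Ix).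
  - rewrite pairwise_map.
    have us : uniq s by rewrite filter_uniq // iota_uniq.
    apply/(pairwiseP 0%N) => i j; rewrite !inE => is_ js ij.
    apply: interval_disj; rewrite ?fI //; try exact: sP (mem_nth _ _).
    apply: contrapT => /eqP/set0P[x [x1 x2]].
    have := tI _ _ Logic.I Logic.I (ex_intro _ x (conj x1 x2)).
    by move/eqP; rewrite nth_uniq // ltn_eqF.
  - rewrite big_map -lte_fin; apply: le_lt_trans mU'.
    rewrite -sumEFin; apply: (@le_trans _ _ (\sum_(i <- s) mu (I i))%E).
      by rewrite !big_seq; apply: lee_sum => i /sP I0; exact: interval_len.
    rewrite muU.
    apply: le_trans (nneseries_lim_ge n _); last by move=> ? _ _; exact: measure_ge0.
    rewrite big_filter [leRHS](bigID (fun i => I i != set0)) /=.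
    by rewrite leeDl // sume_ge0.
rewrite (bigID (fun i => I i != set0)) /= [X in (_ + X)%E]big1 ?adde0; last first.
  by move=> i; rewrite negbK => /eqP ->; exact: (measure0 nu).
rewrite -big_filter -/s -lee_fin in H *.
apply: le_trans H; rewrite -sumEFin big_map big_seq [leRHS]big_seq.
apply: lee_sum => i /sP I0; apply: le_trans (stieltjes_open _ _ _ _) _ => //.
by rewrite lee_fin ler_norm.
Qed.

(** Radon-Nikodym. *)
Lemma stieltjes_density : exists g : R -> R, [/\ forall x, 0 <= g x,
  mu.-integrable setT (EFin \o g) &
  forall x y, x <= y -> (G y - G x)%:E = (\int[mu]_(t in `]x, y]) (g t)%:E)%E].
Proof.
have moo : (nu setT < +oo)%E by exact: le_lt_trans stieltjes_setT (ltry _).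
pose nu' := mfrestr (@measurableT _ (measurableTypeR R)) moo.
have nuE A : nu' A = nu A by rewrite /nu' /mfrestr /mrestr setIT.
have dom : nu' `<< mu.
  by apply/null_content_dominatesP => A mA A0; rewrite nuE; exact: stieltjes_null.
have [f [f0 ff fi Hf]] := radon_nikodym_sigma_finite dom.
exists (fine \o f); split.
- by move=> x; exact: fine_ge0.
- by rewrite (_ : EFin \o _ = f) //; apply/funext => x /=; rewrite fineK.
- move=> x y xy; rewrite -stieltjes_itv // -nuE; apply: etrans (Hf _ _) _ => //.
  by apply: eq_integral => t _ /=; rewrite fineK.
Qed.

End Stieltjes.

(** Absolutely continuous nondecreasing functions are primitives of their
    Stieltjes density, hence differentiable almost everywhere by the Lebesgue
    differentiation theorem. *)
Lemma abs_cont_nondecreasing_FTC (G : R -> R) (a b : R) : a <= b ->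
  nondecreasing G -> abs_cont G ->
  (forall x, x <= a -> G x = G a) -> (forall x, b <= x -> G x = G b) ->
  exists g : R -> R, [/\ mu.-integrable setT (EFin \o g),
    forall x, a <= x -> (G x - G a)%:E = (\int[mu]_(t in `]a, x]) (g t)%:E)%E &
    {ae mu, forall x, a < x -> is_derive x (1 : R) G (g x)}].
Proof.
move=> ab Gnd Gac Gl Gr.
have Grc : right_continuous G by exact/right_continuousW/abs_cont_cont.
pose F : cumulative R R := HB.pack G (isCumulative.Build R _ R G Gnd Grc).
have [g [g0 ig Hg]] := @stieltjes_density F a b Gac Gl Gr.
exists g; split=> //; first by move=> x ax; exact: Hg.
have loc : locally_integrable [set: R] g by exact: (open_integrable_locally openT ig).
have int y : mu.-integrable [set` Interval (BRight a) (BRight y)] (EFin \o g).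
  by apply: integrableS ig.
have := FTC1 int loc.
apply: filterS; first exact: (ae_filter_ringOfSetsType mu).
move=> x Hx ax.
have ax' : (BRight a < BRight x)%O by rewrite bnd_simp.
have [D E] := Hx ax'.
have GE : \near x, (\int[mu]_(t in [set` Interval (BRight a) (BRight x)]) g t)%R + G a = G x.
  near=> y; have ay : a < y by near: y; exact: lt_nbhsr.
  rewrite /Rintegral; have -> : (\int[mu]_(t in `]a, y]) (g t)%:E = (G y - G a)%:E)%E.
    by rewrite Hg // ltW.
  by rewrite /= subrK.
apply: near_eq_is_derive GE _.
rewrite derive1E in E; have := is_deriveD (DeriveDef D E) (is_derive_cst (G a) x (1 : R)).
by rewrite addr0.
Unshelve. all: by end_near. Qed.

End AbsolutelyContinuousMonotone.

(** * Absolutely continuous functions and lower integrals *)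

Arguments novl {R}.
Arguments ivl {R}.

Section AbsolutelyContinuous.
Variable R : realType.
Local Notation mu := (@lebesgue_measure R).
Implicit Types (p q : R * R) (l : seq (R * R)) (f : R -> R).

Fixpoint pieces (x : R) (s : seq R) : seq (R * R) :=
  if s is y :: s' then (x, y) :: pieces y s' else [::].

Lemma novlC p q : novl p q = novl q p.
Proof. by rewrite /novl orbC. Qed.

Lemma pieces_in x s p : path <%O x s -> p \in pieces x s ->
  [/\ x <= p.1, p.1 <= p.2 & p.2 <= last x s].
Proof.
elim: s x => [//|y s IH] x /= /andP[xy ys]; rewrite inE => /orP[/eqP -> /=|/(IH _ ys)[h1 h2 h3]].
  split; rewrite ?lexx ?(ltW xy) //.
  have := ys; rewrite lt_path_sortedE => /andP[/allP h _].
  by case: s ys h {IH} => //= z s _ h; apply/ltW/h; exact: mem_last.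
by split=> //; apply: le_trans h1; exact: ltW.
Qed.

Lemma pieces_novl x s : path <%O x s -> pairwise novl (pieces x s).
Proof.
elim: s x => [//|y s IH] x /= /andP[xy ys]; rewrite IH // andbT.
apply/allP => p /(pieces_in ys)[h1 h2 h3]; by rewrite /novl /= h1.
Qed.

Lemma pieces_len x s : \sum_(p <- pieces x s) (p.2 - p.1) = last x s - x.
Proof.
elim: s x => [|y s IH] x /=; first by rewrite big_nil subrr.
by rewrite big_cons IH /= addrC addrA subrK.
Qed.

Lemma pieces_variation x b f s : itv_partition x b s ->
  variation x b f s = \sum_(p <- pieces x s) `|f p.2 - f p.1|.
Proof.
move=> /variation_zip ->; elim: s x => [|y s IH] x; first by rewrite !big_nil.
by rewrite [zip _ _]/= [pieces _ _]/= !big_cons IH.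
Qed.

Lemma pieces_novl_sub p q s : path <%O p.1 s -> last p.1 s = p.2 -> novl p q ->
  all (novl q) (pieces p.1 s).
Proof.
move=> ps ls /orP pq; apply/allP => t /(pieces_in ps)[h1 h2]; rewrite ls => h3.
by case: pq => H; apply/orP; [right; exact: le_trans H|left; exact: le_trans h1].
Qed.

Section VariationBound.
Variables (f : R -> R) (e r : R).
Hypothesis rH : forall l, all ivl l -> pairwise novl l ->
    \sum_(p <- l) (p.2 - p.1) < r -> \sum_(p <- l) `|f p.2 - f p.1| <= e.

(** Induction on l1: replacing an interval of l1 by the pieces of a partition
    keeps the total length, so the hypothesis bounds all the variations at
    once. *)
Lemma variation_bound l1 l2 : all ivl (l1 ++ l2) -> pairwise novl (l1 ++ l2) ->
  \sum_(p <- l1 ++ l2) (p.2 - p.1) < r ->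
  (\sum_(p <- l1) total_variation p.1 p.2 f + (\sum_(p <- l2) `|f p.2 - f p.1|)%:E <= e%:E)%E.
Proof.
elim: l1 l2 => [|p l1 IH] l2.
  by rewrite big_nil add0e lee_fin; exact: rH.
rewrite cat_cons [all _ _]/= [pairwise _ _]/= !big_cons => /andP[ivp ivl12] /andP[np n12] len.
have lp0 : 0 <= p.2 - p.1 by rewrite subr_ge0.
have T0 : (0 <= \sum_(p <- l1) total_variation p.1 p.2 f)%E.
  have : all ivl l1 by move: ivl12; rewrite all_cat => /andP[].
  move=> /allP h; rewrite big_seq; apply: sume_ge0 => q /h ivq.
  exact: total_variation_ge0.
have Tr := IH l2 ivl12 n12 (le_lt_trans (ler_wpDl lp0 (lexx _)) len).
set T1 := (\sum_(p <- l1) _)%E in T0 Tr *; set r2 := (\sum_(p <- l2) _) in Tr *.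
have r20 : 0 <= r2 by apply: sumr_ge0.
have finT : T1 \is a fin_num.
  rewrite ge0_fin_numE //; apply: le_lt_trans (ltry e); apply: le_trans Tr.
  by rewrite leeDl // lee_fin.
rewrite -addeA -leeBrDr; last by rewrite fin_numD finT.
apply: ge_ereal_sup => _ [_ [s ps <-] <-].
rewrite leeBrDr ?fin_numD ?finT //.
have vE := pieces_variation f ps; have {ps} [ps /eqP ls] := ps.
rewrite vE addeCA -EFinD -big_cat; apply: IH.
- move: ivl12; rewrite !all_cat => /andP[-> ->]; rewrite andbT /=.
  by apply/allP => t /(pieces_in ps)[_ h _].
- have al : all (fun q => all (novl q) (pieces p.1 s)) (l1 ++ l2).
    by apply: sub_all np => q; exact: pieces_novl_sub.
  move: n12 al; rewrite !pairwise_cat all_cat => /and3P[h1 h2 h3] /andP[a1 a2].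
  rewrite h2 h3 pieces_novl // allrel_catr h1 !andbT.
  apply/andP; split; first exact: a1.
  apply/allrelP => t q tp q2; rewrite novlC.
  by move/allP: a2 => /(_ _ q2) /allP; apply.
- move: len; rewrite !big_cat /= pieces_len ls; lra.
Qed.

End VariationBound.

Definition clamp (a b x : R) := Num.max a (Num.min b x).

Lemma clamp_ge a b x : a <= clamp a b x.
Proof. by rewrite /clamp le_max lexx. Qed.

Lemma clamp_le a b x : a <= b -> clamp a b x <= b.
Proof. by move=> ab; rewrite /clamp ge_max ab ge_min lexx. Qed.

Lemma clamp_id a b x : a <= x -> x <= b -> clamp a b x = x.
Proof. by move=> ax xb; rewrite /clamp (min_idPr _) // (max_idPr _). Qed.

Lemma clamp_homo a b x y : x <= y -> clamp a b x <= clamp a b y.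
Proof.
move=> xy; rewrite /clamp ge_max !le_max lexx !le_min !ge_min lexx xy /=.
by case: leP => //=; rewrite !orbT.
Qed.

Lemma clamp_len a b x y : x <= y -> clamp a b y - clamp a b x <= y - x.
Proof.
move=> xy; rewrite /clamp; case: (leP b x) => h1; case: (leP b y) => h2;
  (case: (leP a b) => h3; case: (leP a x) => h4; case: (leP a y) => h5); lra.
Qed.

Lemma clamp_l a b x : x <= a -> clamp a b x = a.
Proof. by move=> xa; rewrite /clamp; apply/max_idPl; rewrite ge_min xa orbT. Qed.

Lemma clamp_r a b x : a <= b -> b <= x -> clamp a b x = b.
Proof. by move=> ab bx; rewrite /clamp (min_idPl _) // (max_idPr _). Qed.

Definition clamp2 a b p := (clamp a b p.1, clamp a b p.2).

Lemma clamp2_ivl a b l : all ivl l -> all ivl (map (clamp2 a b) l).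
Proof.
by move=> /allP h; rewrite all_map; apply/allP => p /h; exact: clamp_homo.
Qed.

Lemma clamp2_novl a b l : pairwise novl l -> pairwise novl (map (clamp2 a b) l).
Proof.
rewrite pairwise_map; apply: sub_pairwise => p q /orP[h|h]; apply/orP; [left|right];
  exact: clamp_homo.
Qed.

Lemma clamp2_len a b l : all ivl l ->
  \sum_(p <- map (clamp2 a b) l) (p.2 - p.1) <= \sum_(p <- l) (p.2 - p.1).
Proof.
move=> /allP h; rewrite big_map big_seq [leRHS]big_seq; apply: ler_sum => p /h.
exact: clamp_len.
Qed.

(** The total variation of f on the intervals from a to x, and its sum with f,
    are nondecreasing and absolutely continuous. *)
Section JordanDecomposition.
Variables (f : R -> R) (a b : R).
Hypothesis ab : a <= b.
Hypothesis fac : abs_cont f.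
Hypothesis fl : forall x, x <= a -> f x = f a.
Hypothesis fr : forall x, b <= x -> f x = f b.

Local Notation TV x y := (total_variation x y f).

Lemma abs_cont_TV_fin x y : x <= y -> TV x y \is a fin_num.
Proof.
move=> xy; have [r r0 rH] := fac ltr01.
have short u v : u <= v -> v - u < r -> TV u v \is a fin_num.
  move=> uv uvr; rewrite ge0_fin_numE ?total_variation_ge0 //.
  have := @variation_bound f 1 r rH [:: (u, v)] [::].
  rewrite /= !big_seq1 big_nil adde0 /ivl /= uv => h.
  by apply: le_lt_trans (h _ _ _) _ => //; exact: ltry.
have [n Hn] : exists n : nat, (y - x) / (r / 2) < n%:R.
  by exists (Num.truncn ((y - x) / (r / 2))).+1; exact: truncnS_gt.
have {Hn} : y - x <= n%:R * (r / 2) by rewrite -ler_pdivrMr ?ltW // divr_gt0.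
elim: n y xy => [|n IH] y xy h.
  by apply: short => //; apply: le_lt_trans h _; rewrite mul0r.
have [h2|h2] := leP (y - x) (r / 2).
  by apply: short => //; apply: le_lt_trans h2 _; rewrite ltr_pdivrMr // ltr_pMr // ltr1n.
rewrite -natr1 in h.
rewrite (@total_variationD _ x y (y - r / 2)) ?fin_numD; try by move: h2 r0; lra.
apply/andP; split; [apply: IH|apply: short]; move: h h2 r0; move: (n%:R) => m; nra.
Qed.

Definition jordan x := fine (TV a (clamp a b x)).

Lemma jordanB x y : x <= y ->
  (jordan y - jordan x)%:E = TV (clamp a b x) (clamp a b y).
Proof.
move=> xy; have h := clamp_homo a b xy; have h1 := clamp_ge a b x.
rewrite EFinB /jordan !fineK ?abs_cont_TV_fin ?clamp_ge //.
by rewrite (total_variationD f h1 h) addeAC subee ?add0e // abs_cont_TV_fin.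
Qed.

Lemma f_clamp x : f (clamp a b x) = f x.
Proof.
have [xa|ax] := leP x a; first by rewrite clamp_l // fl.
have [bx|xb] := leP b x; first by rewrite clamp_r // fr.
by rewrite clamp_id // ltW.
Qed.

Lemma jordan_ge x y : x <= y -> `|f y - f x| <= jordan y - jordan x.
Proof.
move=> xy; rewrite -lee_fin jordanB // -(f_clamp x) -(f_clamp y).
by apply: total_variation_ge; exact: clamp_homo.
Qed.

Lemma jordan_nd : nondecreasing jordan.
Proof. by move=> x y xy; rewrite -subr_ge0; apply: le_trans (jordan_ge xy). Qed.

Lemma jordan_ac : abs_cont jordan.
Proof.
move=> e e0; have [r r0 rH] := fac e0; exists r => // l il nl len.
have il' := clamp2_ivl a b il; have nl' := clamp2_novl a b nl.
have := @variation_bound f e r rH (map (clamp2 a b) l) [::].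
rewrite cats0 big_nil adde0 => /(_ il' nl' (le_lt_trans (clamp2_len a b il) len)).
move=> H; rewrite -lee_fin; apply: le_trans H; rewrite big_map -sumEFin big_seq [leRHS]big_seq.
apply: lee_sum => p /(allP il) ip; rewrite -jordanB // ger0_norm ?lexx //.
by rewrite subr_ge0; exact: jordan_nd.
Qed.

Lemma jordan_l x : x <= a -> jordan x = jordan a.
Proof. by move=> xa; rewrite /jordan !clamp_l. Qed.

Lemma jordan_r x : b <= x -> jordan x = jordan b.
Proof. by move=> bx; rewrite /jordan !clamp_r. Qed.

(** f is the difference of two functions covered by
    [abs_cont_nondecreasing_FTC]. *)
Lemma abs_cont_FTC : exists g : R -> R, [/\ mu.-integrable setT (EFin \o g),
    forall x, a <= x -> (f x - f a)%:E = (\int[mu]_(t in `]a, x]) (g t)%:E)%E &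
    {ae mu, forall x, a < x -> is_derive x (1 : R) f (g x)}].
Proof.
have [v [iv Hv Dv]] := abs_cont_nondecreasing_FTC ab jordan_nd jordan_ac jordan_l jordan_r.
pose w := jordan \+ f.
have wnd : nondecreasing w.
  move=> x y xy; rewrite /w /= -subr_ge0.
  have := jordan_ge xy; rewrite ler_norml => /andP[h _]; move: h; lra.
have wac : abs_cont w.
  move=> e e0; have e2 : 0 < e / 2 by rewrite divr_gt0.
  have [r r0 rH] := jordan_ac e2; have [s s0 sH] := fac e2.
  exists (Num.min r s); first by rewrite lt_min r0.
  move=> l il nl; rewrite lt_min => /andP[lr ls].
  rewrite (splitr e); apply: le_trans (lerD (rH l il nl lr) (sH l il nl ls)).
  rewrite -big_split /=; apply: ler_sum => p _.
  by rewrite /w /= opprD addrACA ler_normD.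
have wl x : x <= a -> w x = w a by move=> xa; rewrite /w /= jordan_l // fl.
have wr x : b <= x -> w x = w b by move=> bx; rewrite /w /= jordan_r // fr.
have [u [iu Hu Du]] := abs_cont_nondecreasing_FTC ab wnd wac wl wr.
exists (fun x => u x - v x); split.
- by apply: eq_integrable (integrableB _ iu iv) => //= x _.
- move=> x ax; rewrite (_ : f x - f a = (w x - w a) - (jordan x - jordan a)); last first.
    by rewrite /w /=; ring.
  rewrite EFinB Hu // Hv // -integralB //; last by exact: integrableS iv.
  exact: integrableS iu.
- move: Dv Du; apply: filterS2; first exact: (ae_filter_ringOfSetsType mu).
  move=> x hv hu ax; have := is_deriveB (hu ax) (hv ax).
  by rewrite (_ : w - jordan = f) //; apply/funext => y; rewrite /w !fctE /= addrC addKr.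
Qed.

End JordanDecomposition.

(** The integral of a nonnegative function is the supremum of the integrals of the
    simple functions below it, hence monotone without measurability. The
    infinitesimal metric along a curve is such a function. *)
Lemma ge0_le_integral_nonmeasurable (f g : R -> \bar R) (D E : set R) :
  (forall x, (0 <= f x)%E) -> (forall x, (0 <= g x)%E) ->
  (forall x, ((f \_ D) x <= (g \_ E) x)%E) ->
  (\int[mu]_(x in D) f x <= \int[mu]_(x in E) g x)%E.
Proof.
move=> f0 g0 fg; rewrite !ge0_integralE //.
by apply: ereal_sup_le => _ [h hf <-]; exists h => // x; exact: le_trans (fg x).
Qed.

(** Sums of simple functions below the two restrictions lie below the function.
    For functions that are not measurable this is the remaining half of
    additivity. *)
Lemma lower_integral_superadditive (f : R -> R) (D E : set R) (x y : R) :
  (forall t, 0 <= f t) -> D `&` E = set0 ->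
  (x%:E <= \int[mu]_(t in D) (f t)%:E)%E -> (y%:E <= \int[mu]_(t in E) (f t)%:E)%E ->
  ((x + y)%:E <= \int[mu]_(t in D `|` E) (f t)%:E)%E.
Proof.
move=> f0 DE; have f0' t : (0 <= (f t)%:E)%E by rewrite lee_fin.
rewrite !ge0_integralE // => xD yE; apply/lee_addgt0Pr => e e0.
have e2 : 0 < e / 2 by rewrite divr_gt0.
have ltx : ((x - e / 2)%:E < x%:E)%E by rewrite lte_fin ltrBlDr ltrDl.
have [_ [h1 h1f <-] H1] := ereal_sup_gt (lt_le_trans ltx xD).
have lty : ((y - e / 2)%:E < y%:E)%E by rewrite lte_fin ltrBlDr ltrDl.
have [_ [h2 h2f <-] H2] := ereal_sup_gt (lt_le_trans lty yE).
rewrite -leeBlDr //; apply: ereal_sup_ge; eexists.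
  exists (add_nnsfun h1 h2); last reflexivity.
  move=> t /=; move: (h1f t) (h2f t); rewrite !patchE EFinD.
  rewrite in_setU; have [tD|_] := boolP (t \in D); have [tE|_] := boolP (t \in E) => /= a b.
  - have : (D `&` E) t by split; exact: set_mem.
    by rewrite DE.
  - by apply: le_trans (leeD a b) _; rewrite adde0.
  - by apply: le_trans (leeD a b) _; rewrite add0e.
  - by apply: le_trans (leeD a b) _; rewrite adde0.
rewrite sintegralD; apply: le_trans (leeD (ltW H1) (ltW H2)).
by rewrite -EFinD lee_fin {1}(splitr e) opprD addrACA.
Qed.

Import HBNNSimple.

(** A simple function below f is at most 1 outside a countable set, hence almost
    everywhere. *)
Lemma lower_integral_le_length (f : R -> R) (s t : R) (N : set R) : s <= t ->
  (forall u, 0 <= f u) -> countable N ->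
  (forall u, s < u -> u < t -> ~ N u -> f u <= 1) ->
  (\int[mu]_(u in `[s, t]) (f u)%:E <= (t - s)%:E)%E.
Proof.
move=> st f0 cN fN; have f0' u : (0 <= (f u)%:E)%E by rewrite lee_fin.
have H1 : (\int[mu]_(u in `[s, t]) (1 : R)%:E = (t - s)%:E)%E.
  by rewrite integral_cst //= mul1e lebesgue_measure_itv /= lte_fin; case: ltgtP st => // -> _;
    rewrite subrr.
rewrite -H1 ge0_integralE //; apply: ge_ereal_sup => _ [h hf <-].
rewrite -integralT_nnsfun [leRHS]integral_mkcond.
apply: ae_ge0_le_integral => //.
- move=> x _; rewrite lee_fin; exact: fun_ge0.
- by apply/measurable_EFinP; exact: measurable_funPT.
- by move=> x _; rewrite patchE; case: ifP.
- by apply/(measurable_restrictT _ _).1 => //; exact: measurable_cst.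
- have meas1 (u : measurableTypeR R) : measurable [set u] by exact: measurable_set1.
  have cst2 : countable [set s; t] by apply: finite_set_countable.
  have mN : measurable N by exact: countable_measurable cN.
  have m2 : measurable [set s; t] by exact: countable_measurable cst2.
  exists (N `|` [set s; t]); split.
  - exact: measurableU.
  - by apply: null_set_setU => //; exact: countable_lebesgue_measure0.
  - move=> x /= nx; apply: contrapT => nN; apply: nx => _.

  apply: le_trans (hf x) _; rewrite !patchE; case: ifPn => // xst.
  rewrite lee_fin; move: xst; rewrite inE /= in_itv /= => /andP[sx xt].
  apply: fN; last by move=> Nx; apply: nN; left.
    by rewrite lt_neqAle sx andbT; apply/eqP => E; apply: nN; right; left.
  by rewrite lt_neqAle xt andbT; apply/eqP => E; apply: nN; right; right.
Qed.

(** F is the primitive of its derivative h, which is at most g almost everywhere.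
    The positive part of h, set to 0 on the exceptional set, is a measurable
    function below g, and the integral of g is at least that of such functions. *)
Lemma abs_cont_le_integral (F g : R -> R) (a b : R) : a <= b -> abs_cont F ->
  (forall x, x <= a -> F x = F a) -> (forall x, b <= x -> F x = F b) ->
  (forall x, 0 <= g x) ->
  {ae mu, forall x, a < x -> x < b -> forall y, is_derive x (1 : R) F y -> y <= g x} ->
  ((F b - F a)%:E <= \int[mu]_(x in `]a, b]) (g x)%:E)%E.
Proof.
move=> ab Fac Fl Fr g0 Hg; have [h [ih Hh Dh]] := abs_cont_FTC ab Fac Fl Fr.
have : {ae mu, forall x, a < x -> x < b -> h x <= g x}.
  move: Dh Hg; apply: filterS2; first exact: (ae_filter_ringOfSetsType mu).
  by move=> x Dx gx ax xb; apply: gx => //; exact: Dx.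
move=> [N [mN N0 PN]].
have mh : measurable_fun setT h by apply/measurable_EFinP; exact: measurable_int ih.
pose h1 x := Num.max (h x) 0.
pose h2 x := h1 x * \1_(`]a, b[%classic `\` N) x.
have mh1 : measurable_fun setT h1 by apply: measurable_maxr.
have h10 x : 0 <= h1 x by rewrite /h1 le_max lexx orbT.
have h20 x : 0 <= h2 x by rewrite /h2 mulr_ge0 // indicE.
have mD : measurable (`]a, b[%classic `\` N) by apply: measurableD.
have mh2 : measurable_fun setT h2.
  by apply: measurable_funM => //; apply: measurable_indic.
rewrite Hh //.
apply: (@le_trans _ _ (\int[mu]_(x in `]a, b]) (h1 x)%:E)%E).
  apply: le_integral => //.
  - exact: integrableS ih.
  - by apply: integrable_funrpos => //; exact: integrableS ih.
  - by move=> x _; rewrite lee_fin /h1 le_max lexx.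
have NP x : a < x -> x < b -> ~ N x -> h x <= g x.
  by move=> ax xb Nx; apply: contrapT => nh; apply: Nx; apply: PN => /= /(_ ax xb).
have mE (k : R -> R) : measurable_fun setT k -> measurable_fun `]a, b] (EFin \o k).
  by move=> mk; apply/measurable_EFinP; exact: measurable_funS mk.
rewrite (_ : (\int[mu]_(x in `]a, b]) (h1 x)%:E)%E = (\int[mu]_(x in `]a, b]) (h2 x)%:E)%E).
  apply: ge0_le_integral_nonmeasurable => // x; rewrite !patchE.
  case: ifP => // _; rewrite /h2 indicE; case: (boolP (x \in _ `\` _)) => [|_]; last by rewrite mulr0 lee_fin.
  rewrite !inE /= => -[/= /[!in_itv] /= /andP[ax xb] Nx]; rewrite mulr1.
  by rewrite lee_fin /h1 ge_max g0 NP.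
apply: ae_eq_integral => //; [exact: mE|exact: mE|].
exists (N `|` [set b]); split.
- exact: measurableU.
- by apply: null_set_setU => //; exact: lebesgue_measure_set1.
- move=> x /= H; have [Nx|Nx] := pselect (N x); [by left|right].
  apply: contrapT => xb; apply: H; rewrite /= in_itv /= => /andP[ax xb'].
  rewrite /h2 indicE mem_set ?mulr1 //; split=> //=; rewrite in_itv /= ax lt_neqAle xb' andbT.
  exact/eqP.
Qed.

End AbsolutelyContinuous.

(** * Distance and length along a curve *)

Section SlopeArithmetic.
Variable R : realType.
Implicit Types a b c e h X y : R.

Lemma add_slopes a b e h : a <= e * h -> b <= e * h -> a + b <= h * (2 * e).
Proof. lra. Qed.

Lemma add_drift a c e h : a <= e * h -> a + h * c <= h * (c + e).
Proof. lra. Qed.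

Lemma plen_slope X e h : h * X * X * 2 <= e -> h * X * e <= e / 2 ->
  X <= X + e - (h * X * X + h * X * e).
Proof. lra. Qed.

Lemma quotient_bound a b e h y : - (e * h) <= b - a - y * h -> y * h - e * h <= b - a.
Proof. lra. Qed.

Lemma slope_chain a b c e h X y k1 k2 : y * h - e * h <= b - a -> b <= a + c -> c <= k1 + k2 ->
  k1 <= h * (X + e) -> k2 <= e * h -> y * h <= (e + e + e + X) * h.
Proof. lra. Qed.

End SlopeArithmetic.

Section KobayashiLength.
Variables (R : realType) (d : nat) (Omega : set 'rV[R[i]]_d) (M : R).
Local Notation V := 'rV[R[i]]_d.
Local Notation K := (kobayashi Omega).
Local Notation mu := (@lebesgue_measure R).
Hypothesis Hbd : forall z, Omega z -> enorm z <= M.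
Hypothesis Hmet : metric_on Omega K.
Hypothesis Hopen : open Omega.
Hypothesis Hcomp : forall u : nat -> V, (forall n, Omega (u n)) ->
    (forall e : R, 0 < e -> exists N : nat, forall m n : nat,
       (N <= m)%N -> (N <= n)%N -> K (u m) (u n) < e) ->
    exists2 l, Omega l & forall e : R, 0 < e -> exists N : nat, forall n : nat,
       (N <= n)%N -> K (u n) l < e.
Implicit Types (x y z w v : V).
Local Notation Ktri := (Ktri Hmet).
Local Notation Ksym := (Ksym Hmet).

Section Curve.
Variables (g : R -> V) (a b : R).
Hypothesis ab : a <= b.
Hypothesis gO : forall t, a <= t -> t <= b -> Omega (g t).
Hypothesis gac : abs_continuous a b g.

Let cl := clamp a b.

Lemma abs_continuous_seq (e : R) : 0 < e -> exists2 r : R, 0 < r &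
  forall l : seq (R * R), all ivl l -> pairwise novl l ->
    \sum_(p <- l) (p.2 - p.1) < r -> \sum_(p <- l) enorm (g (cl p.2) - g (cl p.1)) < e.
Proof.
move=> e0; have [r r0 rH] := gac e0; exists r => // l il nl len.
pose l' := map (clamp2 a b) l; pose x0 : R * R := (0, 0).
have il' := clamp2_ivl a b il; have nl' := clamp2_novl a b nl.
have := rH (size l') (fun j => (nth x0 l' j).1) (fun j => (nth x0 l' j).2).
rewrite -(big_mkord predT (fun j => (nth x0 l' j).2 - (nth x0 l' j).1)).
rewrite -(big_mkord predT (fun j => enorm (g (nth x0 l' j).2 - g (nth x0 l' j).1))).
rewrite -(big_nth x0 predT (fun p => p.2 - p.1)).
rewrite -(big_nth x0 predT (fun p => enorm (g p.2 - g p.1))).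
rewrite [\sum_(p <- l') enorm _]big_map; apply.
- move=> j jl; have jl' : (j < size l)%N by move: jl; rewrite size_map.
  rewrite (nth_map x0) //; split; [exact: clamp_ge| |exact: clamp_le].
  by apply: clamp_homo; move/allP: il => /(_ _ (mem_nth x0 jl')).
- have key i j : (i < size l')%N -> (j < size l')%N -> (i < j)%N ->
      novl (nth x0 l' i) (nth x0 l' j).
    by move=> il1 jl1 ij; move/(pairwiseP x0): nl' => /(_ i j); rewrite !inE; exact.
  move=> j k jl kl /eqP; rewrite neq_ltn => /orP[jk|kj].
    by have /orP := key _ _ jl kl jk.
  by have /orP := key _ _ kl jl kj; tauto.
- by apply: le_lt_trans len; exact: clamp2_len.
Qed.

(** All the real functions derived from a curve inherit absolute continuity from
    it. *)
Lemma abs_cont_dominated (f : R -> R) (C rho : R) : 0 < C -> 0 < rho ->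
  (forall s t, s <= t -> enorm (g (cl t) - g (cl s)) < rho ->
     `|f t - f s| <= C * enorm (g (cl t) - g (cl s))) -> abs_cont f.
Proof.
move=> C0 rho0 H e e0.
have h0 : 0 < Num.min (e / C) rho by rewrite lt_min divr_gt0.
have [r r0 rH] := abs_continuous_seq h0; exists r => // l il nl len.
have := rH l il nl len; rewrite lt_min => /andP[lC lr].
apply: (@le_trans _ _ (\sum_(p <- l) C * enorm (g (cl p.2) - g (cl p.1)))); last first.
  by rewrite -mulr_sumr mulrC -ler_pdivlMr // ltW.
rewrite big_seq [leRHS]big_seq; apply: ler_sum => p pl; apply: H.
  exact: (allP il).
apply: le_lt_trans lr; rewrite (big_rem p) //= lerDl; apply: sumr_ge0 => q _; exact: enorm_ge0.
Qed.

Lemma clO t : Omega (g (cl t)).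
Proof. by apply: gO; [exact: clamp_ge|exact: clamp_le]. Qed.

Lemma curve_cont t (e : R) : 0 < e -> exists2 r : R, 0 < r & forall s, `|s - t| < r ->
  enorm (g (cl s) - g (cl t)) < e.
Proof.
move=> e0; have [r r0 rH] := abs_continuous_seq e0; exists r => // s st.
have [ts|/ltW st'] := leP t s.
  have := rH [:: (t, s)]; rewrite /= !big_seq1 /ivl /= ts => ->//.
  by move: st; rewrite ger0_norm // subr_ge0.
have := rH [:: (s, t)]; rewrite /= !big_seq1 /ivl /= st' enormB => ->//.
by move: st; rewrite ler0_norm ?opprB // subr_le0.
Qed.

(** The image of the curve is compact, hence in a ball of the Kobayashi distance,
    which is at positive distance from the boundary. *)
Lemma curve_inball : exists2 rho : R, 0 < rho & forall t, inball Omega (g (cl t)) rho.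
Proof.
have Oa : Omega (g (cl a)) := clO a.
have gc : continuous (g \o cl).
  move=> t A /nbhs_enorm[e e0 eA]; have [r r0 rH] := curve_cont t e0.
  by exists r => //= s; rewrite /ball /= distrC => /rH; exact: eA.
have cC : compact ((g \o cl) @` `[a, b]).
  by apply: continuous_compact; [exact: continuous_subspaceT|exact: segment_compact].
have [|r Hr] := compact_Kbounded Hmet Hopen Oa cC.
  by move=> _ [t _ <-]; exact: clO.
have [e e0 He] := K_proper Hbd Hmet Hopen Hcomp Oa r.
exists e => // t; apply: (He (g (cl t)) (clO t)).
apply: Hr; exists (cl t) => /=; first by rewrite in_itv /= clamp_ge clamp_le.
by rewrite /cl clamp_id // ?clamp_ge ?clamp_le.
Qed.

End Curve.

Definition vec_derive (q : R -> V) t v := forall e : R, 0 < e -> exists2 r : R, 0 < r &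
  forall h, `|h| < r -> enorm (q (t + h) - q t - h%:C *: v) <= e * `|h|.

Lemma vec_derive_coord (q : R -> V) (t : R) :
  (forall j, derivable (fun s : R => complex.Re (q s ord0 j)) t 1) ->
  (forall j, derivable (fun s : R => complex.Im (q s ord0 j)) t 1) ->
  vec_derive q t (velocity q t).
Proof.
move=> DR DI e e0; pose e' := e / d.+1%:R / 2; have e'0 : 0 < e' by rewrite !divr_gt0.
have HR j : \forall h \near (0 : R), `|complex.Re (q (t + h) ord0 j) - complex.Re (q t ord0 j) -
    complex.Re (velocity q t ord0 j) * h| <= e' * `|h|.
  rewrite mxE /= derive1E.
  have [r r0 rH] := is_derive_eps (derivableP (DR j)) e'0.
  by exists r => //= h; rewrite /ball_ /= sub0r normrN; exact: rH.
have HI j : \forall h \near (0 : R), `|complex.Im (q (t + h) ord0 j) - complex.Im (q t ord0 j) -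
    complex.Im (velocity q t ord0 j) * h| <= e' * `|h|.
  rewrite mxE /= derive1E.
  have [r r0 rH] := is_derive_eps (derivableP (DI j)) e'0.
  by exists r => //= h; rewrite /ball_ /= sub0r normrN; exact: rH.
have [r /= r0 rH] := filterI (filter_forall _ HR) (filter_forall _ HI).
exists r => // h hr; have hr' : `|0 - h| < r by rewrite sub0r normrN.
have [hR hI] := rH h hr'.
apply: le_trans (enorm_le_sum _) _.
apply: (@le_trans _ _ (\sum_(i < d) (2 * (e' * `|h|)))).
  apply: ler_sum => j _; apply: le_trans (cabs_le_ReIm _) _.
  rewrite [leRHS]mulr_natl [leRHS]mulr2n; apply: lerD.
    apply: le_trans (hR j); rewrite !mxE !ReB /= mul0r subr0.
    by rewrite [h * _]mulrC.
  apply: le_trans (hI j); rewrite !mxE !ImB /= mul0r addr0.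
  by rewrite [h * _]mulrC.
rewrite sumr_const card_ord -[leLHS]mulr_natl /e' !mulrA; apply: ler_wpM2r => //.
rewrite (_ : d%:R * 2 * e / d.+1%:R / 2 = e * (d%:R / d.+1%:R)); last by field; rewrite nat1r pnatr_eq0.
apply: ler_piMr; first exact: ltW.
by rewrite ler_pdivrMr // mul1r ler_nat.
Qed.

Section CurveDerivative.
Variables (g : R -> V) (a b : R).
Hypothesis ab : a <= b.
Hypothesis gO : forall t, a <= t -> t <= b -> Omega (g t).
Hypothesis gac : abs_continuous a b g.

Let cl := clamp a b.

Lemma curve_ae_derive :
  {ae mu, forall t, a < t -> t < b -> vec_derive (g \o cl) t (velocity g t)}.
Proof.
have dom (f : R -> R) : (forall s t, s <= t -> `|f t - f s| <= enorm (g (cl t) - g (cl s))) ->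
    (forall t, t <= a -> f t = f a) -> (forall t, b <= t -> f t = f b) ->
    {ae mu, forall t, a < t -> derivable f t (1 : R)}.
  move=> H fa fb.
  have fac : abs_cont f.
    by apply: (abs_cont_dominated ab gac ltr01 ltr01) => s t st _; rewrite mul1r; exact: H.
  have [k [_ _]] := abs_cont_FTC ab fac fa fb.
  apply: filterS; first exact: (ae_filter_ringOfSetsType mu).
  by move=> t Ht /Ht [].
have AR : {ae mu, forall t (j : 'I_d), a < t -> derivable (fun s => complex.Re (g (cl s) ord0 j)) t (1 : R)}.
  apply: filter_forall => j; apply: dom.
  - move=> s t st; rewrite -ReB; apply: le_trans (Re_le_cabs _) _.
    by apply: le_trans (coord_le_enorm _ j); rewrite !mxE.
  - by move=> t ta; rewrite /cl !clamp_l.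
  - by move=> t bt; rewrite /cl !clamp_r.
have AI : {ae mu, forall t (j : 'I_d), a < t -> derivable (fun s => complex.Im (g (cl s) ord0 j)) t (1 : R)}.
  apply: filter_forall => j; apply: dom.
  - move=> s t st; rewrite -ImB; apply: le_trans (Im_le_cabs _) _.
    by apply: le_trans (coord_le_enorm _ j); rewrite !mxE.
  - by move=> t ta; rewrite /cl !clamp_l.
  - by move=> t bt; rewrite /cl !clamp_r.
move: AR AI; apply: filterS2; first exact: (ae_filter_ringOfSetsType mu).
move=> t DR DI at_ tb.
have -> : velocity g t = velocity (g \o cl) t.
  have r0 : 0 < Num.min (t - a) (b - t) by rewrite lt_min !subr_gt0 at_.
  apply: (velocity_near_eq r0) => s; rewrite lt_min !ltr_norml => /andP[/andP[h1 _] /andP[_ h2]] /=.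
  by rewrite /cl clamp_id //; move: h1 h2; lra.
by apply: vec_derive_coord => j; [exact: DR|exact: DI].
Qed.

(** Compare the curve near time t with a disc phi whose derivative at 0 times xi
    is the velocity: phi(h xi) is within o(h) of the curve, and its distance to
    its centre is at most h |xi| + o(h). *)
Lemma dist_derive_le t : a < t -> t < b -> vec_derive (g \o cl) t (velocity g t) ->
  forall y : R, is_derive t (1 : R) (fun s => K (g a) (g (cl s))) y ->
  y <= kobayashi_metric Omega (g t) (velocity g t).
Proof.
move=> at_ tb Dg y Dy.
have clt : cl t = t by rewrite /cl clamp_id // ltW.
have Ogt : Omega (g t) by apply: gO; exact: ltW.
have Ocl s : Omega (g (cl s)) by exact: clO.
have [rho rho0 Hrho] := open_inball Hopen Ogt.
set v := velocity g t in Dg *.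
apply: lb_le_inf.
  pose c := rho / (enorm v + 1).
  have v1 : 0 < enorm v + 1 by rewrite ltr_wpDl // enorm_ge0.
  have c0 : 0 < c by rewrite divr_gt0.
  have cv : enorm (c%:C *: v) <= rho.
    rewrite enormZ cabs_real (ger0_norm (ltW c0)) /c mulrAC -mulrA ler_piMr ?(ltW rho0) //.
    by rewrite ler_pdivrMr // mul1r lerDl.
  have [hd dE] := affine_disc rho0 Hrho cv.
  exists (cabs (c^-1)%:C); exists (c^-1)%:C => //.
  exists (fun s => g t + s *: (c%:C *: v)); split=> //; first by rewrite scale0r addr0.
  by rewrite dE scalerA -rmorphM mulVf ?gt_eqF // scale1r.
move=> _ [xi [phi [hphi phi0 phiv]] <-].
apply/ler_addgt0Pl => e e0; set X := cabs xi; have X0 : 0 <= X by exact: cabs_ge0.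
have e10 : 0 < e / 3 by rewrite divr_gt0.
set e1 := e / 3 in e10.
pose e2 := e1 * rho / 16; have e20 : 0 < e2 by rewrite !mulr_gt0.
have X1 : 0 < X + 1 by rewrite ltr_wpDl.
have e30 : 0 < e2 / (X + 1) by rewrite divr_gt0.
have [rF rF0 HF] := is_derive_eps Dy e10.
have [rg rg0 Hg] := Dg e2 e20.
have d0 : unit_disc (0 : R[i]) by rewrite /unit_disc /= cabs0.
have [rp rp0 Hp] := derivable_vdiffE (hphi.1 0 d0) e30.
have v0 := enorm_ge0 v.
have q0 : 0 < 2 * X ^+ 2 + 1 by rewrite ltr_wpDl // mulr_ge0 // sqr_ge0.
have w0 : 0 < enorm v + e2 by rewrite ltr_wpDl.
near (0 : R)^'+ => h.
have h0 : 0 < h by near: h; exact: nbhs_right_gt.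
have hF : h < rF by near: h; exact: nbhs_right_lt.
have hg : h < rg by near: h; exact: nbhs_right_lt.
have hp : h * (X + 1) < rp by rewrite -ltr_pdivlMr //; near: h; apply: nbhs_right_lt; rewrite divr_gt0.
have h2 : h * (X + 1) < 2^-1 by rewrite -ltr_pdivlMr //; near: h; apply: nbhs_right_lt; rewrite divr_gt0.
have h3 : h * (2 * X ^+ 2 + 1) < e1 by rewrite -ltr_pdivlMr //; near: h; apply: nbhs_right_lt; rewrite divr_gt0.
have h4 : h * (enorm v + e2) < rho / 2 by rewrite -ltr_pdivlMr //; near: h; apply: nbhs_right_lt; rewrite !divr_gt0.
have h5 : h * (2 * e2) < rho / 4 by rewrite -ltr_pdivlMr; [near: h; apply: nbhs_right_lt; rewrite !divr_gt0 // mulr_gt0|rewrite mulr_gt0].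
have hn : `|h| = h by rewrite ger0_norm // ltW.
pose z := h%:C * xi.
have zX : cabs z = h * X by rewrite cabsM cabs_real hn.
have hX : h * X <= h * (X + 1) by rewrite ler_pM2l // lerDl.
have z2 : cabs z < 2^-1 by rewrite zX; exact: le_lt_trans h2.
have z1 : cabs z < 1 by apply: lt_trans z2 _; rewrite invf_lt1 // ltr1n.
have gh : enorm (g (cl (t + h)) - g t - h%:C *: v) <= e2 * h.
  by have := Hg h; rewrite /= hn clt; apply.
have ph : enorm (phi z - g t - h%:C *: v) <= e2 * h.
  have := Hp z; rewrite add0r phi0 zX => /(_ (le_lt_trans hX hp)).
  rewrite /z -scalerA phiv => H; apply: le_trans H _.
  rewrite -subr_ge0 (_ : _ - _ = e2 * h / (X + 1)); last by field; exact: lt0r_neq0.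
  by rewrite divr_ge0 ?mulr_ge0 // ltW.
have pg : enorm (g (cl (t + h)) - phi z) <= h * (2 * e2).
  rewrite (_ : g (cl (t + h)) - phi z = (g (cl (t + h)) - g t - h%:C *: v) - (phi z - g t - h%:C *: v)); last first.
    by rewrite opprB addrA subrK opprB addrA subrK.
  apply: le_trans (enormD _ _) _; rewrite enormN.
  exact: add_slopes gh ph.
have pt : enorm (phi z - g t) <= rho / 2.
  apply: le_trans (ltW h4); rewrite -[X in enorm X](subrK (h%:C *: v)).
  apply: le_trans (enormD _ _) _; rewrite enormZ cabs_real hn.
  exact: add_drift ph.
have ib : inball Omega (phi z) (rho / 2).
  by apply: (inball_shift pt); rewrite -splitr.
have rr : rho / 2 / 2 = rho / 4 by field.
have K1 : K (phi z) (g (cl (t + h))) <= e1 * h.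
  have := @K_le_enorm _ _ _ Hmet (phi z) (rho / 2) (g (cl (t + h))) ib.
  rewrite rr => /(_ (divr_gt0 rho0 (ltr0n _ 2)) (le_trans pg (ltW h5))) H.
  apply: le_trans H _; apply: le_trans (ler_wpM2l _ pg) _; first by rewrite divr_ge0 // divr_ge0 // ltW.
  have -> : 4 / (rho / 2) * (h * (2 * e2)) = e1 * h by rewrite /e2; field; exact: lt0r_neq0.
  exact: lexx.
have Oz : Omega (phi z) by apply: hphi.2.
have Oa : Omega (g a) by apply: gO.
have K2 : K (g t) (phi z) <= h * (X + e1).
  have := K_le_plen hphi z1; rewrite phi0 => H; apply: le_trans H _.
  apply: le_trans (plen_le_frac (cabs_ge0 z) z1) _; rewrite zX in z1 z2 *.
  rewrite ler_pdivrMr ?subr_gt0 // -mulrA ler_pM2l //.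
  have hXX : h * X * X <= X / 2 by rewrite [leRHS]mulrC ler_wpM2r // ltW.
  have hX2 : h * X * X * 2 <= e1.
    by apply: le_trans (ltW h3); rewrite -subr_ge0 (_ : _ - _ = h) ?ltW // ; ring.
  have hXe : h * X * e1 <= e1 / 2 by rewrite [leRHS]mulrC ler_wpM2r // ltW.
  rewrite mulrBr mulr1 [(X + e1) * _]mulrC mulrDr; exact: plen_slope.
have D1 : y * h - e1 * h <= K (g a) (g (cl (t + h))) - K (g a) (g t).
  have := HF h; rewrite hn clt => /(_ hF); rewrite ler_norml => /andP[H _].
  exact: quotient_bound H.
have D2 := Ktri (y := g t) Oa Ogt (Ocl (t + h)).
have D3 := Ktri (y := phi z) Ogt Oz (Ocl (t + h)).
have : y * h <= (e + X) * h.
  have -> : e = e1 + e1 + e1 by rewrite /e1; field.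
  exact: slope_chain D1 D2 D3 K2 K1.
by rewrite ler_pM2r.
Unshelve. all: by end_near. Qed.

Lemma dist_abs_cont : abs_cont (fun s => K (g a) (g (cl s))).
Proof.
have [rho rho0 Hrho] := curve_inball ab gO gac.
have Oa : Omega (g a) by apply: gO.
have C0 : 0 < 4 / rho by rewrite divr_gt0.
have r20 : 0 < rho / 2 by rewrite divr_gt0.
have Ocl s : Omega (g (cl s)) by exact: clO.
apply: (abs_cont_dominated ab gac C0 r20) => s t st /ltW /(K_le_enorm Hmet (Hrho s) rho0).
apply: le_trans; rewrite ler_norml.
have h1 := Ktri (y := g (cl s)) Oa (Ocl s) (Ocl t).
have h2 := Ktri (y := g (cl t)) Oa (Ocl t) (Ocl s).
rewrite (Ksym (Ocl t) (Ocl s)) in h2.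
by rewrite lerBlDl h1 andbT lerNl opprB lerBlDl.
Qed.

(** The function K (g a) (g t) of t is absolutely continuous, and
    [dist_derive_le] bounds its derivative. *)
Lemma K_le_length : ((K (g a) (g b))%:E <=
  \int[mu]_(t in `]a, b]) (kobayashi_metric Omega (g t) (velocity g t))%:E)%E.
Proof.
have Oa : Omega (g a) by apply: gO.
pose F s := K (g a) (g (cl s)).
have Fl (x : R) : x <= a -> F x = F a by move=> xa; rewrite /F /cl !clamp_l.
have Fr (x : R) : b <= x -> F x = F b by move=> xb; rewrite /F /cl !clamp_r.
have := @abs_cont_le_integral _ F (fun t => kobayashi_metric Omega (g t) (velocity g t)) a b ab dist_abs_cont Fl Fr.
have -> : F a = 0 by rewrite /F /cl clamp_l // (Kxx Hmet).
have -> : F b = K (g a) (g b) by rewrite /F /cl clamp_r.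
rewrite subr0; apply.
- by move=> x; exact: kmetric_ge0.
- move: curve_ae_derive; apply: filterS; first exact: (ae_filter_ringOfSetsType mu).
  by move=> t Ht at_ tb; apply: dist_derive_le => //; exact: Ht.
Qed.

End CurveDerivative.

End KobayashiLength.

(** * Discretization of quasi-geodesics *)

Section QuasiGeodesics.
Variables (R : realType) (d : nat) (Omega : set 'rV[R[i]]_d) (M : R).
Local Notation V := 'rV[R[i]]_d.
Local Notation K := (kobayashi Omega).
Local Notation mu := (@lebesgue_measure R).
Hypothesis Hbd : forall z, Omega z -> enorm z <= M.
Hypothesis Hmet : metric_on Omega K.
Hypothesis Hopen : open Omega.
Hypothesis Hcomp : forall u : nat -> V, (forall n, Omega (u n)) ->
    (forall e : R, 0 < e -> exists N : nat, forall m n : nat,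
       (N <= m)%N -> (N <= n)%N -> K (u m) (u n) < e) ->
    exists2 l, Omega l & forall e : R, 0 < e -> exists N : nat, forall n : nat,
       (N <= n)%N -> K (u n) l < e.
Implicit Types (x y z w v : V).
Local Notation Ktri := (Ktri Hmet).
Local Notation Ksym := (Ksym Hmet).

Lemma abs_continuous_sub (g : R -> V) (a b a' b' : R) : a <= a' -> b' <= b ->
  abs_continuous a b g -> abs_continuous a' b' g.
Proof.
move=> aa bb H e e0; have [r r0 rH] := H e e0; exists r => // n s t st; apply: rH.
by move=> j /st[h1 h2 h3]; split=> //; [exact: le_trans h1|exact: le_trans bb].
Qed.

Lemma lipschitz_abs_continuous (g : R -> V) (a b C : R) : 0 < C ->
  (forall s t, a <= s -> s <= t -> t <= b -> enorm (g t - g s) <= C * (t - s)) ->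
  abs_continuous a b g.
Proof.
move=> C0 H e e0; exists (e / C); first by rewrite divr_gt0.
move=> n s t st _ len; apply: (@le_lt_trans _ _ (\sum_(j < n) C * (t j - s j))).
  by apply: ler_sum => j _; have [] := st j (ltn_ord j); exact: H.
by rewrite -mulr_sumr mulrC -ltr_pdivlMr.
Qed.

Lemma length_ge0 (g : R -> V) (D : set R) :
  (0 <= \int[mu]_(t in D) (kobayashi_metric Omega (g t) (velocity g t))%:E)%E.
Proof. by apply: integral_ge0 => t _; rewrite lee_fin; exact: kmetric_ge0. Qed.

(** [K_le_length] on each piece; the pieces are half-open intervals, hence disjoint,
    and superadditivity applies. *)
Lemma steps_le_length (g : R -> V) (a b : R) (c : nat -> R) (i n : nat) :
  (forall t, a <= t -> t <= b -> Omega (g t)) -> abs_continuous a b g ->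
  (forall k, a <= c k /\ c k <= b) -> (forall k, c k <= c k.+1) ->
  ((\sum_(i <= k < i + n) K (g (c k)) (g (c k.+1)))%:E <=
   \int[mu]_(t in `]c i, c (i + n)%N]) (kobayashi_metric Omega (g t) (velocity g t))%:E)%E.
Proof.
move=> gO gac cab ci; elim: n => [|n IH].
  by rewrite addn0 big_geq //; exact: length_ge0.
have cn : c i <= c (i + n)%N.
  by elim: n {IH} => [|n h]; rewrite ?addn0 // addnS; exact: le_trans (ci _).
rewrite addnS big_nat_recr ?leq_addr //=.
have [h1 h2] := cab (i + n)%N; have [h3 h4] := cab (i + n).+1.
have := @K_le_length _ _ _ _ Hbd Hmet Hopen Hcomp g (c (i + n)%N) (c (i + n).+1) (ci _).
move=> /(_ (fun t p q => gO t (le_trans h1 p) (le_trans q h4)) (abs_continuous_sub h1 h4 gac)) H.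
have := lower_integral_superadditive _ _ IH H.
rewrite -itv_bndbnd_setU ?bnd_simp //; apply.
  by move=> t; exact: kmetric_ge0.
by rewrite -subset0 => t [] /=; rewrite !in_itv /= => /andP[_ p] /andP[q _];
  have := lt_le_trans q p; rewrite ltxx.
Qed.

Lemma length_le_time (g : R -> V) (s t : R) (N : set R) : s <= t -> countable N ->
  (forall u, s < u -> u < t -> ~ N u -> kobayashi_metric Omega (g u) (velocity g u) <= 1) ->
  (kobayashi_length Omega g s t <= (t - s)%:E)%E.
Proof.
move=> st cN H; apply: (lower_integral_le_length st _ cN H).
by move=> u; exact: kmetric_ge0.
Qed.

Lemma quasi_geodesic_sub (g : R -> V) (A B a b a' b' : R) : a <= a' -> b' <= b ->
  quasi_geodesic Omega A B a b g -> quasi_geodesic Omega A B a' b' g.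
Proof.
move=> aa bb [h1 h2 h3]; split.
- by move=> t p q; apply: h1; [exact: le_trans p|exact: le_trans bb].
- exact: abs_continuous_sub h2.
- by move=> s t p q r; apply: h3 => //; [exact: le_trans p|exact: le_trans bb].
Qed.

Section Discretization.
Variables (A B r : R) (g : R -> V).
Hypothesis A0 : 0 <= A.
Hypothesis B0 : 0 <= B.
Hypothesis r0 : 0 <= r.
Hypothesis Hg : quasi_geodesic Omega A B 0 r g.

Let unit_step t s := [/\ t <= s, s <= r & K (g t) (g s) = 1].
Let next t := if pselect (exists s, unit_step t s) is left h then projT1 (cid h) else r.
Let tau k := iter k next 0.
Let stop t := ~ exists s, unit_step t s.

Let nextP t : t <= r -> t <= next t /\ next t <= r.
Proof. by move=> tr; rewrite /next; case: pselect => // h; case: (cid h) => s []. Qed.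

Let tau_in k : 0 <= tau k /\ tau k <= r.
Proof.
elim: k => [|k [h1 h2]]; first by rewrite lexx.
by have [p q] := nextP h2; split=> //; exact: le_trans p.
Qed.

Let tau_S k : tau k <= tau k.+1.
Proof. by have [_ h] := tau_in k; have [] := nextP h. Qed.

Let tau_O k : Omega (g (tau k)).
Proof. by have [h _ _] := Hg; apply: h; have [] := tau_in k. Qed.

Let step1 k : ~ stop (tau k) -> K (g (tau k)) (g (tau k.+1)) = 1.
Proof.
rewrite /stop => /contrapT h; rewrite [tau k.+1]/= -/(tau k) /next.
by case: pselect => // h'; case: (cid h') => s [].
Qed.

Let stop_le t : 0 <= t -> t <= r -> stop t -> K (g t) (g r) <= 1.
Proof.
move=> t0 tr st; rewrite leNgt; apply/negP => gt1; apply: st.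
have [gO gac _] := quasi_geodesic_sub t0 (lexx r) Hg.
have fac := dist_abs_cont Hbd Hmet Hopen Hcomp tr gO gac.
pose f s := K (g t) (g (clamp t r s)).
have fc : {within `[t, r], continuous f} by apply/continuous_subspaceT/abs_cont_cont.
have ft : f t = 0 by rewrite /f clamp_l // (Kxx Hmet) //; exact: gO.
have fr : f r = K (g t) (g r) by rewrite /f clamp_r.
have [|s] := @IVT _ f t r 1 tr fc.
  by rewrite ft fr ge_min le_max ler01 (ltW gt1) orbT.
rewrite in_itv /= => /andP[ts sr] fs; exists s; split=> //.
by rewrite -fs /f clamp_id.
Qed.

Let steps_le i n e : (forall k, (i <= k)%N -> (k < i + n)%N -> ~ stop (tau k)) ->
  tau (i + n)%N <= e -> e <= r -> n%:R <= A * K (g (tau i)) (g e) + B.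
Proof.
case: n => [|n] H te er.
  by apply: addr_ge0 => //; apply: mulr_ge0 => //; exact: K_ge0.
have [gO gac gl] := Hg.
have := steps_le_length i n.+1 gO gac tau_in tau_S.
rewrite (_ : \sum_(i <= k < i + n.+1) _ = n.+1%:R); last first.
  rewrite (eq_big_nat _ _ (F2 := fun=> 1)); last by move=> k /andP[h1 h2]; apply: step1; exact: H.
  by rewrite sumr_const_nat addKn.
move=> Hlen.
have lt : tau i < tau (i + n.+1)%N.
  have le1 : tau i < tau i.+1.
    rewrite lt_neqAle tau_S andbT; apply/eqP => E.
    have := step1 (H i (leqnn _) _); rewrite -E (Kxx Hmet) //.
    by rewrite addnS ltnS leq_addr => /(_ isT)/esym/eqP; rewrite oner_eq0.
  apply: lt_le_trans le1 _; rewrite addnS; elim: (n) => [|m]; rewrite ?addn0 // addnS => h.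
  exact: le_trans (tau_S _).
have [h1 _] := tau_in i.
have := gl _ _ h1 (lt_le_trans lt te) er; rewrite -lee_fin; apply: le_trans; apply: le_trans Hlen _.
apply: ge0_le_integral_nonmeasurable.
- by move=> t; rewrite lee_fin; exact: kmetric_ge0.
- by move=> t; rewrite lee_fin; exact: kmetric_ge0.
- move=> t; rewrite !patchE; case: ifPn; last by case: ifP => // _ _; rewrite lee_fin; exact: kmetric_ge0.
  rewrite inE /= in_itv /= => /andP[p q]; rewrite ifT //.
  by rewrite inE /= in_itv /= (ltW p) (le_trans q).
Qed.

(** Following the curve by unit steps yields a discrete quasi-geodesic: the
    number of steps between two times is at most the length, by
    [steps_le_length]. The last step may be shorter, whence B + 1. *)
Lemma discretization : exists (c : nat -> V) (n : nat),
  [/\ c 0%N = g 0 /\ c n = g r,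
      forall k, exists s, [/\ 0 <= s, s <= r & c k = g s],
      forall k, (k < n)%N -> K (c k) (c k.+1) <= 1 &
      forall i j, (i <= j)%N -> (j <= n)%N -> (j - i)%:R <= A * K (c i) (c j) + (B + 1)].
Proof.
have ex : exists k, `[< stop (tau k) >].
  apply: contrapT => nE; have ns k : ~ stop (tau k).
    by move=> h; apply: nE; exists k; exact/asboolP.
  set L := A * K (g 0) (g r) + B.
  have := @steps_le 0%N (Num.truncn L).+1 r (fun k _ _ => ns k) (tau_in _).2 (lexx r).
  by rewrite leNgt truncnS_gt.
case: (ex_minnP ex) => m /asboolP sm mmin.
have nst k : (k < m)%N -> ~ stop (tau k).
  by move=> km h; have := mmin k (asboolT h); rewrite leqNgt km.
pose c k := if (k <= m)%N then g (tau k) else g r.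
have cE k : (k <= m)%N -> c k = g (tau k) by rewrite /c => ->.
have cS : c m.+1 = g r by rewrite /c ltnn.
exists c, m.+1; split.
- by split; [rewrite cE|].
- move=> k; rewrite /c; case: ifP => _; last by exists r.
  by exists (tau k); have [h1 h2] := tau_in k.
- move=> k; rewrite ltnS leq_eqVlt => /predU1P[->|km].
    by rewrite cS cE //; apply: stop_le => //; have [] := tau_in m.
  by rewrite cE 1?ltnW // cE // step1 //; exact: nst.
- move=> i j ij; rewrite leq_eqVlt => /predU1P[E|].
    move: ij; rewrite E leq_eqVlt => /predU1P[->|im].
      by rewrite subnn addr_ge0 ?addr_ge0 ?mulr_ge0 ?ler01 //; exact: K_ge0.
    rewrite ltnS in im; rewrite subSn // -natr1 addrA lerD2r cS cE //.
    apply: steps_le => //; last by rewrite subnKC //; have [] := tau_in m.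
    by move=> k _; rewrite subnKC //; exact: nst.
  rewrite ltnS => jm; rewrite !cE //; last exact: leq_trans jm.
  rewrite addrA ler_wpDr //; apply: steps_le; last by have [] := tau_in j.
    by move=> k _; rewrite subnKC // => kj; apply: nst; exact: leq_trans jm.
  by rewrite subnKC.
Qed.

End Discretization.

End QuasiGeodesics.

(** * Gromov products in a hyperbolic domain *)

Section HyperbolicDomain.
Variables (R : realType) (d : nat) (Omega : set 'rV[R[i]]_d) (M : R).
Local Notation V := 'rV[R[i]]_d.
Local Notation K := (kobayashi Omega).
Local Notation mu := (@lebesgue_measure R).
Hypothesis Hbd : forall z, Omega z -> enorm z <= M.
Hypothesis Hmet : metric_on Omega K.
Hypothesis Hopen : open Omega.
Hypothesis Hcomp : forall u : nat -> V, (forall n, Omega (u n)) ->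
    (forall e : R, 0 < e -> exists N : nat, forall m n : nat,
       (N <= m)%N -> (N <= n)%N -> K (u m) (u n) < e) ->
    exists2 l, Omega l & forall e : R, 0 < e -> exists N : nat, forall n : nat,
       (N <= n)%N -> K (u n) l < e.
Implicit Types (x y z w v : V).
Local Notation Ktri := (Ktri Hmet).
Local Notation Ksym := (Ksym Hmet).

Local Notation Kgeo := (geo Omega K).

Lemma Kgeo_ex x y : Omega x -> Omega y -> exists g, Kgeo g (K x y) x y.
Proof.
move=> Ox Oy; have [g [[gO gK] g0 gL]] := geodesic_ex Hbd Hmet Hopen Hcomp Ox Ox Oy.
exists g; split=> //; first exact: K_ge0.
by move=> s t s0 sL t0 tL; split; [apply: gO|apply: gK]; rewrite /= in_itv /= ?s0 ?t0.
Qed.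

Lemma Kgeo_segment g (L : R) x y : Kgeo g L x y -> geodesic_segment Omega x y (g @` `[0, L]).
Proof.
move=> [L0 g0 gL H]; exists 0, L, g; split=> //; split.
  by move=> t /=; rewrite in_itv /= => /andP[h1 h2]; have [] := H t t h1 h2 h1 h2.
move=> s t /=; rewrite !in_itv /= => /andP[h1 h2] /andP[h3 h4].
by have [] := H s t h1 h2 h3 h4.
Qed.

Lemma segment_Kgeo S x y : geodesic_segment Omega x y S ->
  exists g (L : R), Kgeo g L x y /\ forall t, 0 <= t -> t <= L -> S (g t).
Proof.
move=> [a [b [g [ab [gO gK] ga gb ->]]]].
have itv (t : R) : 0 <= t -> t <= b - a -> `[a, b]%classic (a + t).
  by move=> t0 tb; rewrite /= in_itv /= lerDl t0 -lerBrDl.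
exists (fun t => g (a + t)), (b - a); split.
  split; rewrite ?subr_ge0 ?addr0 //; first by rewrite addrC subrK.
  move=> s t s0 sL t0 tL; split; first by apply: gO; exact: itv.
  by rewrite gK; [rewrite opprD addrACA subrr add0r|exact: itv|exact: itv].
by move=> t t0 tL; exists (a + t) => //; exact: itv.
Qed.

Lemma gromov_slim : gromov_hyperbolic Omega -> exists2 delta : R, 0 < delta &
  forall x y z g1 g2 g3 (L1 L2 L3 : R), Kgeo g1 L1 x y -> Kgeo g2 L2 y z -> Kgeo g3 L3 z x ->
  forall t, 0 <= t -> t <= L1 ->
  exists s, (0 <= s /\ s <= L2 /\ K (g1 t) (g2 s) <= delta) \/
            (0 <= s /\ s <= L3 /\ K (g1 t) (g3 s) <= delta).
Proof.
move=> [delta delta0 H]; exists delta => // x y z g1 g2 g3 L1 L2 L3 G1 G2 G3 t t0 tL.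
have [Ox Oy] := geo_end G1; have [_ Oz] := geo_end G2.
have [slim _ _] := H x y z _ _ _ Ox Oy Oz (Kgeo_segment G1) (Kgeo_segment G2) (Kgeo_segment G3).
have [|q [[s + <-]|[s + <-]] Kq] := slim (g1 t).
- by exists t => //=; rewrite in_itv /= t0.
- by rewrite /= in_itv /= => /andP[s0 sL]; exists s; left.
- by rewrite /= in_itv /= => /andP[s0 sL]; exists s; right.
Qed.

Variable delta : R.
Hypothesis delta0 : 0 < delta.
Hypothesis Hslim : forall x y z g1 g2 g3 (L1 L2 L3 : R),
  Kgeo g1 L1 x y -> Kgeo g2 L2 y z -> Kgeo g3 L3 z x ->
  forall t, 0 <= t -> t <= L1 ->
  exists s, (0 <= s /\ s <= L2 /\ K (g1 t) (g2 s) <= delta) \/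
            (0 <= s /\ s <= L3 /\ K (g1 t) (g3 s) <= delta).
Hypothesis Hdisc : no_nontrivial_analytic_discs (boundary Omega).
Variable o : V.
Hypothesis Oo : Omega o.

Local Notation gp := (gromov_prod K).

(** The Morse lemma for curves, through their discretizations. *)
Lemma quasi_morse (A B r : R) (g al : R -> V) (L : R) : 0 <= A -> 0 <= B -> 0 <= r ->
  quasi_geodesic Omega A B 0 r g -> Kgeo al L (g 0) (g r) ->
  forall t, 0 <= t -> t <= L -> exists s, [/\ 0 <= s, s <= r &
    K (al t) (g s) <= morse_const delta A (B + 1)].
Proof.
move=> A0 B0 r0 Hg G t t0 tL.
have [c [n [[c0 cn] cs c1 cq]]] := discretization Hbd Hmet Hopen Hcomp A0 B0 r0 Hg.
rewrite -c0 -cn in G; have [gO _ _] := Hg.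
have cO k : (k <= n)%N -> Omega (c k).
  by move=> _; have [s [s0 sr ->]] := cs k; exact: gO.
have B1 : 0 <= B + 1 by rewrite addr_ge0.
have [i _ Hi] := morse Hmet delta0 Kgeo_ex Hslim A0 B1 cO c1 cq G t0 tL.
by have [s [s0 sr E]] := cs i; exists s; rewrite -E.
Qed.

(** At time T the two points have Gromov products about T with the ends, hence with
    each other by the four-point inequality, while their distances to o are
    about T. *)
Lemma geodesics_close (rho T L1 L2 : R) a b w w' al be : K o a <= rho -> K o b <= rho ->
  Kgeo al L1 a w -> Kgeo be L2 b w' -> 0 <= T -> T <= L1 -> T <= L2 -> T - rho <= gp o w w' ->
  K (al T) (be T) <= 4 * rho + 20 * delta.
Proof.
move=> oa ob Ga Gb T0 T1 T2 ww.
have [Oa Ow] := geo_end Ga; have [Ob Ow'] := geo_end Gb.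
have OaT := geo_in Ga T0 T1; have ObT := geo_in Gb T0 T2.
have far (L : R) x y g : Omega x -> Omega y -> K o x <= rho -> Kgeo g L x y -> T <= L -> Omega (g T) ->
    T - rho <= gp o (g T) y /\ K o (g T) <= T + rho.
  move=> Ox Oy ox G TL OT; rewrite /gromov_prod (geo_r G T0 TL).
  have h1 := Ktri Oo Ox OT; have h2 := Ktri Ox Oo OT; have h3 := Ktri Ox Oo Oy.
  rewrite (Ksym Ox Oo) (geo_l G T0 TL) in h1 h2 *; rewrite (Ksym Ox Oo) (geo_len G) in h3.
  by move: h1 h2 h3 ox; rewrite ler_pdivlMr //; split; lra.
have [h1 k1] := far _ _ _ _ Oa Ow oa Ga T1 OaT.
have [h2 k2] := far _ _ _ _ Ob Ow' ob Gb T2 ObT.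
have f1 := four_point Hmet delta0 Kgeo_ex Hslim Oo OaT Ow Ow'.
have f2 := four_point Hmet delta0 Kgeo_ex Hslim Oo OaT Ow' ObT.
have h4 : T - rho - 5 * delta <= gp o (al T) w'.
  by apply: le_trans f1; rewrite lerD2r le_min h1 ww.
have h5 : T - rho - 10 * delta <= gp o (al T) (be T).
  apply: le_trans f2; rewrite (_ : T - rho - 10 * delta = T - rho - 5 * delta - 5 * delta); last by ring.
  rewrite lerD2r le_min h4 (gp_sym Hmet) // (le_trans _ h2) //.
  by rewrite lerBlDr lerDl mulr_ge0 // ltW.
by move: h5 k1 k2; rewrite /gromov_prod ler_pdivlMr //; lra.
Qed.

Lemma gp_perturb x y w w' : Omega x -> Omega y -> Omega w -> Omega w' ->
  gp o x y - K x w - K y w' <= gp o w w'.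
Proof.
move=> Ox Oy Ow Ow'; rewrite /gromov_prod ler_pdivlMr //.
have h1 := Ktri Oo Ow Ox; have h2 := Ktri Oo Ow' Oy.
have h3 := Ktri Ow Ox Ow'; have h4 := Ktri Ox Oy Ow'.
rewrite (Ksym Ow Ox) in h1 h3; rewrite (Ksym Ow' Oy) in h2.
by move: h1 h2 h3 h4; lra.
Qed.

Lemma gp_le_dist x y : Omega x -> Omega y -> gp o x y <= K o x.
Proof.
move=> Ox Oy; have := Ktri Oo Ox Oy; rewrite /gromov_prod ler_pdivrMr //; lra.
Qed.

(** Where visibility fails, geodesics from points near p to points near q avoid
    arbitrarily large balls, so the Gromov products of their ends are unbounded. *)
Lemma not_visible_escape (p q : V) : p <> q ->
  ~ (exists (Vp Vq C : set V),
    [/\ nbhs p Vp, nbhs q Vq, Vp `&` Vq = set0, compact C /\ C `<=` Omega &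
        forall x y S, (Vp `&` Omega) x -> (Vq `&` Omega) y ->
          geodesic_segment Omega x y S -> S `&` C !=set0]) ->
  forall n : nat, exists x y, [/\ Omega x, Omega y, enorm (x - p) < n.+1%:R^-1,
    enorm (y - q) < n.+1%:R^-1 & n%:R - 4 * delta <= gp o x y].
Proof.
move=> pq nv n; apply: contrapT => nE; apply: nv.
have pq0 : 0 < enorm (p - q).
  rewrite lt_neqAle enorm_ge0 andbT eq_sym; apply/eqP => /enorm_eq0/eqP.
  by rewrite subr_eq0 => /eqP.
pose r := Num.min n.+1%:R^-1 (enorm (p - q) / 2).
have r0 : 0 < r by rewrite lt_min invr_gt0 ltr0Sn divr_gt0.
exists [set x | enorm (x - p) < r], [set y | enorm (y - q) < r], [set z | Omega z /\ K o z <= n%:R].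
split.
- by apply/nbhs_enorm; exists r.
- by apply/nbhs_enorm; exists r.
- rewrite -subset0 => z [/= h1 h2].
  have := enorm_triangle z p q; rewrite (enormB p z) leNgt => /negP; apply.
  by rewrite [ltRHS]splitr; apply: ltrD; [apply: lt_le_trans h1 _|apply: lt_le_trans h2 _]; rewrite ge_min lexx orbT.
- by split; [exact: (Kball_compact Hbd Hmet Hopen Hcomp Oo)|by move=> z []].
- move=> x y S [xp Ox] [yq Oy] /segment_Kgeo[g [L [G gS]]].
  apply: contrapT => nS; apply: nE; exists x, y.
  have [t [t0 tL Ht]] := gp_ge_geo Hmet delta0 Kgeo_ex Hslim Oo G.
  split=> //.
  + by apply: lt_le_trans xp _; rewrite ge_min lexx.
  + by apply: lt_le_trans yq _; rewrite ge_min lexx.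
  + apply: le_trans Ht; rewrite lerD2r leNgt; apply/negP => lt; apply: nS; exists (g t).
    by split; [exact: gS|split; [exact: geo_in G _ _|exact: ltW]].
Qed.

End HyperbolicDomain.

(** * A domain with a frame is visible *)

Section FrameVisible.
Variables (R : realType) (d : nat) (Omega : set 'rV[R[i]]_d) (M : R).
Local Notation V := 'rV[R[i]]_d.
Local Notation K := (kobayashi Omega).
Local Notation mu := (@lebesgue_measure R).
Hypothesis Hbd : forall z, Omega z -> enorm z <= M.
Hypothesis Hmet : metric_on Omega K.
Hypothesis Hopen : open Omega.
Hypothesis Hcomp : forall u : nat -> V, (forall n, Omega (u n)) ->
    (forall e : R, 0 < e -> exists N : nat, forall m n : nat,
       (N <= m)%N -> (N <= n)%N -> K (u m) (u n) < e) ->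
    exists2 l, Omega l & forall e : R, 0 < e -> exists N : nat, forall n : nat,
       (N <= n)%N -> K (u n) l < e.
Implicit Types (x y z w v : V).
Local Notation Ktri := (Ktri Hmet).
Local Notation Ksym := (Ksym Hmet).

Local Notation Kgeo := (geo Omega K).

Variable delta : R.
Hypothesis delta0 : 0 < delta.
Hypothesis Hslim : forall x y z g1 g2 g3 (L1 L2 L3 : R),
  Kgeo g1 L1 x y -> Kgeo g2 L2 y z -> Kgeo g3 L3 z x ->
  forall t, 0 <= t -> t <= L1 ->
  exists s, (0 <= s /\ s <= L2 /\ K (g1 t) (g2 s) <= delta) \/
            (0 <= s /\ s <= L3 /\ K (g1 t) (g3 s) <= delta).
Hypothesis Hdisc : no_nontrivial_analytic_discs (boundary Omega).
Variable o : V.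
Hypothesis Oo : Omega o.

Local Notation gp := (gromov_prod K).

(** A compact part of a curve neither leaves a ball nor approaches the boundary;
    hence points far from o on nearby curves occur at large times. *)
Lemma curve_Kbounded (g : R -> V) (A B b : R) : 0 <= b -> quasi_geodesic Omega A B 0 b g ->
  exists e r, [/\ 0 < e, forall t, 0 <= t -> t <= b -> inball Omega (g t) e &
    forall t, 0 <= t -> t <= b -> K o (g t) <= r].
Proof.
move=> b0 [gO gac _].
have [e e0 He] := curve_inball Hbd Hmet Hopen Hcomp b0 gO gac.
have [r Hr] : exists r, forall t, 0 <= t -> t <= b -> K o (g t) <= r.
  have fac := dist_abs_cont Hbd Hmet Hopen Hcomp b0 gO gac.
  have fc : {within `[0, b], continuous (fun s => K (g 0) (g (clamp 0 b s)))}.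
    exact/continuous_subspaceT/abs_cont_cont.
  have [c _ Hc] := EVT_max b0 fc.
  exists (K o (g 0) + K (g 0) (g (clamp 0 b c))) => t t0 tb.
  have Og0 : Omega (g 0) by apply: gO.
  apply: le_trans (Ktri Oo Og0 (gO t t0 tb)) _; rewrite lerD2l.
  by have := Hc t; rewrite in_itv /= t0 tb clamp_id //; apply.
exists e, r; split=> // t t0 tb.
by have := He t; rewrite clamp_id.
Qed.

Section Frame.
Variables (A B : R) (F : set (curve R d)).
Hypothesis A0 : 0 <= A.
Hypothesis B0 : 0 <= B.
Hypothesis Fq : forall c, F c ->
        [/\ (0 < cend c)%E,
            forall r : R, cend c = r%:E -> quasi_geodesic Omega A B 0 r c &
            cend c = +oo%E -> quasi_geodesic_ray Omega A B c].

Lemma frame_quasi (c : curve R d) (T : R) : F c -> 0 <= T -> (T%:E <= cend c)%E ->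
  quasi_geodesic Omega A B 0 T c.
Proof.
move=> Fc T0; have [_ h1 h2] := Fq Fc.
case E : (cend c) => [r| |] //.
  by rewrite lee_fin => Tr; apply: quasi_geodesic_sub (h1 r E).
by move=> _; apply: h2.
Qed.

(** Points c_ k (s k) that tend to infinity in the Kobayashi distance, on curves
    that converge uniformly to c, tend to the end point of c. Uniform
    convergence up to the end point is essential: the times s k are unbounded. *)
Section Limit.
Variables (c_ : nat -> curve R d) (c : curve R d) (s : nat -> R).
Hypothesis Fc : F c.
Hypothesis Cc : forall theta : R, 0 < theta -> exists k0 : nat, forall k : nat, (k0 <= k)%N ->
    forall t : \bar R, (0 <= t)%E -> (t <= cend (c_ k))%E ->
      (t <= cend c)%E /\ enorm (ceval (c_ k) t - ceval c t) <= theta.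
Hypothesis s0 : forall k, 0 <= s k.
Hypothesis sc : forall k, ((s k)%:E <= cend (c_ k))%E.
Hypothesis sO : forall k, Omega (c_ k (s k)).
Hypothesis sK : forall r, exists k0 : nat, forall k, (k0 <= k)%N -> r < K o (c_ k (s k)).

Let close theta : 0 < theta -> exists k0 : nat, forall k : nat, (k0 <= k)%N ->
  ((s k)%:E <= cend c)%E /\ enorm (c_ k (s k) - c (s k)) <= theta.
Proof.
move=> /Cc[k0 H]; exists k0 => k k0k.
by have := H k k0k (s k)%:E; apply; rewrite ?lee_fin.
Qed.

Let leaves (T : R) : 0 <= T -> (T%:E <= cend c)%E -> exists k0 : nat, forall k, (k0 <= k)%N -> T < s k.
Proof.
move=> T0 Tc; have [e [r [e0 He Hr]]] := curve_Kbounded T0 (frame_quasi Fc T0 Tc).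
have e2 : 0 < e / 2 by rewrite divr_gt0.
have [k1 H1] := close e2; have [k2 H2] := sK (r + 2).
exists (maxn k1 k2) => k; rewrite geq_max => /andP[h1 h2].
rewrite ltNge; apply/negP => sT; have [_ cl] := H1 k h1; have := H2 k h2.
rewrite ltNge => /negP; apply.
have ib := He _ (s0 k) sT; have Oc : Omega (c (s k)) by apply: inball_in ib.
apply: le_trans (Ktri Oo Oc (sO k)) _; apply: lerD; first exact: Hr.
apply: le_trans (K_le_enorm Hmet ib e0 cl) _.
apply: le_trans (ler_wpM2l _ cl) _; first by rewrite divr_ge0 // ltW.
by rewrite (_ : 4 / e * (e / 2) = 2) //; field; exact: lt0r_neq0.
Qed.

Lemma limit_is_ray : cend c = +oo%E.
Proof.
have [c0 _ _] := Fq Fc; case E : (cend c) c0 => [r| |] // r0.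
have r0' : 0 <= r by rewrite -lee_fin ltW.
have rc : (r%:E <= cend c)%E by rewrite E.
have [k1 H1] := leaves r0' rc.
have [k2 H2] := close ltr01.
have [+ _] := H2 _ (leq_maxr k1 k2); have := H1 _ (leq_maxl k1 k2).
by rewrite E lee_fin leNgt => ->.
Qed.

Lemma limit_at_end (p : V) : c t @[t --> +oo] --> p ->
  forall e : R, 0 < e -> exists k0 : nat, forall k, (k0 <= k)%N -> enorm (c_ k (s k) - p) < e.
Proof.
move=> cp e e0; have e2 : 0 < e / 2 by rewrite divr_gt0.
have : nbhs p [set z | enorm (z - p) < e / 2] by apply/nbhs_enorm; exists (e / 2).
move=> /cp [T [_ HT]]; have [k1 H1] := close e2.
have T0 : 0 <= Num.max T 0 by rewrite le_max lexx orbT.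
have Tc : ((Num.max T 0)%:E <= cend c)%E by rewrite limit_is_ray leey.
have [k2 H2] := leaves T0 Tc.
exists (maxn k1 k2) => k; rewrite geq_max => /andP[h1 h2].
have [_ h3] := H1 k h1; have := H2 k h2; rewrite gt_max => /andP[h4 _].
apply: le_lt_trans (enorm_triangle (c (s k)) _ _) _.
by rewrite [ltRHS]splitr; apply: ler_ltD => //; exact: HT.
Qed.

End Limit.

Definition near_curve (p : V) (eta : R) (n : nat) (x : V) (c : curve R d) (t : R) :=
  [/\ Omega x, enorm (x - p) < n.+1%:R^-1, F c, (0 <= t /\ (t%:E <= cend c)%E) &
      K x (c t) < eta].

Section Fellow.
Variables (rho eta : R).
Hypothesis Hrho : forall c, F c -> K o (c 0) <= rho.
Let kap := 4 * delta + 2 * eta + rho.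
Let Mo := morse_const delta A (B + 1).

Lemma near_curve_in p n x c t : near_curve p eta n x c t -> Omega (c t).
Proof.
move=> [_ _ Fc [t0 tc] _]; have [gO _ _] := frame_quasi Fc t0 tc.
by apply: gO.
Qed.

(** The curves shadow geodesics to points near x and y, by [quasi_morse]; take the
    points at time about n on these geodesics. *)
Lemma curves_meet_far (p q x y : V) n c c' t t' :
  near_curve p eta n x c t -> near_curve q eta n y c' t' ->
  n%:R - 4 * delta <= gp o x y -> kap <= n%:R ->
  exists s s', [/\ 0 <= s /\ s <= t, 0 <= s' /\ s' <= t',
    K (c s) (c' s') <= 2 * Mo + 4 * rho + 20 * delta,
    n%:R - kap - rho - Mo <= K o (c s) & n%:R - kap - rho - Mo <= K o (c' s')].
Proof.
move=> H1 H2; have Ow := near_curve_in H1; have Ow' := near_curve_in H2.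
move: H1 H2 => [Ox _ Fc [t0 tc] xw] [Oy _ Fc' [t0' tc'] yw] Hgp kn.
have Q1 := frame_quasi Fc t0 tc; have Q2 := frame_quasi Fc' t0' tc'.
have Oa : Omega (c 0) by have [gO _ _] := Q1; apply: gO.
have Ob : Omega (c' 0) by have [gO _ _] := Q2; apply: gO.
have oa := Hrho Fc; have ob := Hrho Fc'.
have rho0 : 0 <= rho by apply: le_trans oa; exact: K_ge0.
pose T : R := n%:R - kap; have T0 : 0 <= T by rewrite subr_ge0.
have gw : T + rho <= gp o (c t) (c' t').
  apply: le_trans (gp_perturb Hmet Oo Ox Oy Ow Ow').
  by rewrite /T /kap; move: Hgp xw yw; lra.
have gw1 := le_trans gw (gp_le_dist Hmet Oo Ow Ow').
have gw2 : T + rho <= K o (c' t').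
  by apply: le_trans (gp_le_dist Hmet Oo Ow' Ow); rewrite (gp_sym Hmet).
have [al G1] := Kgeo_ex Hbd Hmet Hopen Hcomp Oa Ow.
have [be G2] := Kgeo_ex Hbd Hmet Hopen Hcomp Ob Ow'.
have T1 : T <= K (c 0) (c t).
  have := le_trans gw1 (Ktri Oo Oa Ow) => h; move: h oa; lra.
have T2 : T <= K (c' 0) (c' t').
  have := le_trans gw2 (Ktri Oo Ob Ow') => h; move: h ob; lra.
have Tg : T - rho <= gp o (c t) (c' t') by move: gw rho0; lra.
have cl := geodesics_close Hbd Hmet Hopen Hcomp delta0 Hslim Oo oa ob G1 G2 T0 T1 T2 Tg.
have [s [s0 st Hs]] := quasi_morse Hbd Hmet Hopen Hcomp delta0 Hslim A0 B0 t0 Q1 G1 T0 T1.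
have [s' [s0' st' Hs']] := quasi_morse Hbd Hmet Hopen Hcomp delta0 Hslim A0 B0 t0' Q2 G2 T0 T2.
have Oal := geo_in G1 T0 T1; have Obe := geo_in G2 T0 T2.
have Os : Omega (c s) by have [gO _ _] := Q1; apply: gO.
have Os' : Omega (c' s') by have [gO _ _] := Q2; apply: gO.
exists s, s'; split=> //.
- have h1 := Ktri Os Oal Os'; have h2 := Ktri Oal Obe Os'.
  rewrite (Ksym Os Oal) in h1; rewrite -/Mo in Hs Hs'.
  by move: h1 h2 Hs Hs' cl; lra.
- have h1 := Ktri Oa Oo Oal; have h2 := Ktri Oo Os Oal.
  rewrite (geo_l G1 T0 T1) (Ksym Oa Oo) in h1; rewrite (Ksym Os Oal) in h2.
  by rewrite -/T; rewrite -/Mo in Hs; move: h1 h2 Hs oa; lra.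
- have h1 := Ktri Ob Oo Obe; have h2 := Ktri Oo Os' Obe.
  rewrite (geo_l G2 T0 T2) (Ksym Ob Oo) in h1; rewrite (Ksym Os' Obe) in h2.
  by rewrite -/T; rewrite -/Mo in Hs'; move: h1 h2 Hs' ob; lra.
Qed.

End Fellow.

End Frame.

Lemma large_index (a r : R) (N : nat) (f : nat -> R) (m : nat -> nat) :
  (forall k, (k <= m k)%N) -> (forall n, (n + N)%N%:R - a <= f n) ->
  exists k0 : nat, forall k, (k0 <= k)%N -> r < f (m k).
Proof.
move=> mk Hf; exists (Num.truncn (r + a)).+1 => k k0.
apply: lt_le_trans (Hf (m k)); rewrite ltrBrDr.
apply: lt_le_trans (truncnS_gt _) _; rewrite ler_nat.
by apply: leq_trans k0 _; apply: leq_trans (mk k) _; exact: leq_addr.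
Qed.

Definition tends (u : nat -> V) (p : V) := forall e : R, 0 < e ->
  exists k0 : nat, forall k, (k0 <= k)%N -> enorm (u k - p) < e.

Lemma tends_uniq u p q : tends u p -> tends u q -> p = q.
Proof.
move=> up uq; apply/eqP; rewrite -subr_eq0; apply/eqP/enorm_eq0/eqP.
rewrite eq_le enorm_ge0 andbT; apply/ler_addgt0Pl => e e0; rewrite addr0.
have e2 : 0 < e / 2 by rewrite divr_gt0.
have [k1 H1] := up _ e2; have [k2 H2] := uq _ e2.
have h1 := H1 _ (leq_maxl k1 k2); have h2 := H2 _ (leq_maxr k1 k2).
apply: le_trans (enorm_triangle (u (maxn k1 k2)) _ _) _; rewrite enormB.
by rewrite [leRHS]splitr; apply: lerD; exact: ltW.
Qed.

Lemma tends_contraction (u v : nat -> V) p (r : R) : 0 <= r -> (forall k, Omega (u k)) -> (forall k, Omega (v k)) ->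
  (forall k, K (u k) (v k) <= r) ->
  (forall r' : R, exists k0 : nat, forall k, (k0 <= k)%N -> r' < K o (u k)) ->
  tends u p -> tends v p.
Proof.
move=> r0 Ou Ov uv uK up e e0; have e2 : 0 < e / 2 by rewrite divr_gt0.
have [rho Hrho] := no_disc_contraction Hbd Hmet Hopen Hdisc Oo r0 e2.
have [k1 H1] := uK rho; have [k2 H2] := up _ e2.
exists (maxn k1 k2) => k; rewrite geq_max => /andP[h1 h2].
apply: le_lt_trans (enorm_triangle (u k) _ _) _; rewrite enormB.
rewrite [ltRHS]splitr; apply: ler_ltD; last exact: H2.
by apply: Hrho => //; exact/ltW/H1.
Qed.

(** If visibility fails at p and q, the points x n and y n of
    [not_visible_escape] lie near curves c n and c' n of the frame. By
    [curves_meet_far] these curves come within a bounded distance of each other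
    at points far from o. Along a subsequence the curves converge to rays that
    end at p and q respectively, and by the contraction property the points where
    they are close tend to p as well as to q. *)
Lemma frame_visible (A B : R) F : 0 <= A -> 0 <= B -> frame Omega A B F -> visible Omega.
Proof.
move=> A0 B0 [Fq Flim [C [cC CO FC]] Fseq [eps [eta [eps0 eta0 Fdense]]]].
move=> p q bp bq pq; apply: contrapT => nv; apply: (pq).
have esc := not_visible_escape Hbd Hmet Hopen Hcomp delta0 Hslim Oo pq nv.
have [N1 HN1] := inv_small eps0.
have [rho HrhoC] := compact_Kbounded Hmet Hopen Oo cC CO.
have Hrho c : F c -> K o (c 0) <= rho by move=> /FC; exact: HrhoC.
pose kap := 4 * delta + 2 * eta + rho.
pose N := maxn N1 (Num.truncn kap).+1.
have Nkap n : kap <= (n + N)%N%:R.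
  apply: (@le_trans _ _ (Num.truncn kap).+1%:R); first by apply: ltW; exact: truncnS_gt.
  by rewrite ler_nat; apply: leq_trans (leq_maxr N1 _) _; exact: leq_addl.
have near (x p' : V) n : boundary Omega p' -> Omega x -> enorm (x - p') < (n + N).+1%:R^-1 ->
    exists c t, near_curve F p' eta (n + N) x c t.
  move=> bp' Ox xp; have [|c [t [Fc t0 tc Oc Kc]]] := Fdense x Ox; last by exists c, t.
  apply: (@le_lt_trans _ _ (enorm (x - p'))%:E); first by apply: ereal_inf_lbound; exists p'.
  rewrite lte_fin; apply: lt_trans xp _; apply: HN1.
  by apply: leq_trans (leq_maxl N1 (Num.truncn kap).+1) _; exact: leq_addl.
pose Mo := morse_const delta A (B + 1).
pose D1 := 2 * Mo + 4 * rho + 20 * delta.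
have /choice[D HD] (n : nat) : exists D : (V * curve R d * R * R) * (V * curve R d * R * R),
    [/\ near_curve F p eta (n + N) D.1.1.1.1 D.1.1.1.2 D.1.1.2,
        near_curve F q eta (n + N) D.2.1.1.1 D.2.1.1.2 D.2.1.2,
        (0 <= D.1.2 /\ D.1.2 <= D.1.1.2) /\ (0 <= D.2.2 /\ D.2.2 <= D.2.1.2),
        K (D.1.1.1.2 D.1.2) (D.2.1.1.2 D.2.2) <= D1 &
        [/\ (n + N)%N%:R - 4 * delta <= K o D.1.1.1.1, (n + N)%N%:R - 4 * delta <= K o D.2.1.1.1,
         (n + N)%N%:R - kap - rho - Mo <= K o (D.1.1.1.2 D.1.2) &
         (n + N)%N%:R - kap - rho - Mo <= K o (D.2.1.1.2 D.2.2)]].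
  have [x [y [Ox Oy xp yq gxy]]] := esc (n + N)%N.
  have [c [t H1]] := near x p n bp Ox xp; have [c' [t' H2]] := near y q n bq Oy yq.
  have [s [s' [h1 h2 h3 h4 h5]]] := curves_meet_far A0 B0 Fq Hrho H1 H2 gxy (Nkap n).
  exists ((x, c, t, s), (y, c', t', s')); split=> //; split=> //.
    exact: le_trans gxy (gp_le_dist Hmet Oo Ox Oy).
  by apply: le_trans gxy _; rewrite (gp_sym Hmet) //; exact: gp_le_dist.
pose x n := (D n).1.1.1.1; pose c n := (D n).1.1.1.2; pose t n := (D n).1.1.2; pose s n := (D n).1.2.
pose y n := (D n).2.1.1.1; pose c' n := (D n).2.1.1.2; pose t' n := (D n).2.1.2; pose s' n := (D n).2.2.
have X1 n : near_curve F p eta (n + N) (x n) (c n) (t n) by have [] := HD n.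
have X2 n : near_curve F q eta (n + N) (y n) (c' n) (t' n) by have [] := HD n.
have Fc n : F (c n) by have [] := X1 n.
have Fc' n : F (c' n) by have [] := X2 n.
have [m [ci [mm Fci [_ Cc]]]] := Fseq c Fc.
have [m' [ci' [mm' Fci' [_ Cc']]]] := Fseq (c' \o m) (fun k => Fc' (m k)).
have ge_id (f : nat -> nat) : (forall j k, (j < k)%N -> (f j < f k)%N) -> forall k, (k <= f k)%N.
  by move=> H; elim=> // k IH; apply: leq_ltn_trans IH _; exact: H.
pose i k := m (m' k); have ik k : (k <= i k)%N by apply: leq_trans (ge_id _ mm' k) (ge_id _ mm _).
have C1 theta : 0 < theta -> exists k0 : nat, forall k : nat, (k0 <= k)%N ->
    forall u : \bar R, (0 <= u)%E -> (u <= cend (c (i k)))%E ->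
      (u <= cend ci)%E /\ enorm (ceval (c (i k)) u - ceval ci u) <= theta.
  move=> /Cc[k0 H]; exists k0 => k k0k; apply: H.
  exact: leq_trans k0k (ge_id _ mm' k).
have C2 theta : 0 < theta -> exists k0 : nat, forall k : nat, (k0 <= k)%N ->
    forall u : \bar R, (0 <= u)%E -> (u <= cend (c' (i k)))%E ->
      (u <= cend ci')%E /\ enorm (ceval (c' (i k)) u - ceval ci' u) <= theta.
  by move=> /Cc'[k0 H]; exists k0 => k k0k; exact: H.
have t0 k : 0 <= t k by have [_ _ _ [] ] := X1 k.
have t0' k : 0 <= t' k by have [_ _ _ [] ] := X2 k.
have tc k : ((t k)%:E <= cend (c k))%E by have [_ _ _ [] ] := X1 k.
have tc' k : ((t' k)%:E <= cend (c' k))%E by have [_ _ _ [] ] := X2 k.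
have s0 k : 0 <= s k by have [_ _ [[] ] ] := HD k.
have s0' k : 0 <= s' k by have [_ _ [_ [] ] ] := HD k.
have st k : s k <= t k by have [_ _ [[] ] ] := HD k.
have st' k : s' k <= t' k by have [_ _ [_ [] ] ] := HD k.
have sc k : ((s k)%:E <= cend (c k))%E by apply: le_trans (tc k); rewrite lee_fin.
have sc' k : ((s' k)%:E <= cend (c' k))%E by apply: le_trans (tc' k); rewrite lee_fin.
have inO f (u : R) : F f -> 0 <= u -> (u%:E <= cend f)%E -> Omega (f u).
  by move=> Ff u0 uc; have [gO _ _] := frame_quasi Fq Ff u0 uc; apply: gO.
have Ox k : Omega (x k) by have [] := X1 k.
have Oy k : Omega (y k) by have [] := X2 k.
have Ot k : Omega (c k (t k)) by exact: inO.
have Ot' k : Omega (c' k (t' k)) by exact: inO.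
have Os k : Omega (c k (s k)) by exact: inO.
have Os' k : Omega (c' k (s' k)) by exact: inO.
have xK k : K (x k) (c k (t k)) <= eta by have [_ _ _ _ /ltW] := X1 k.
have yK k : K (y k) (c' k (t' k)) <= eta by have [_ _ _ _ /ltW] := X2 k.
have Lx := large_index (a := 4 * delta) (N := N) (f := fun n => K o (x n)) _ ik.
have Ly := large_index (a := 4 * delta) (N := N) (f := fun n => K o (y n)) _ ik.
have Lt := large_index (a := 4 * delta + eta) (N := N) (f := fun n => K o (c n (t n))) _ ik.
have Lt' := large_index (a := 4 * delta + eta) (N := N) (f := fun n => K o (c' n (t' n))) _ ik.
have Ls := large_index (a := kap + rho + Mo) (N := N) (f := fun n => K o (c n (s n))) _ ik.
have Ls' := large_index (a := kap + rho + Mo) (N := N) (f := fun n => K o (c' n (s' n))) _ ik.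
have {}Lx r : exists k0 : nat, forall k, (k0 <= k)%N -> r < K o (x (i k)).
  by apply: Lx => n; have [_ _ _ _ []] := HD n.
have {}Ly r : exists k0 : nat, forall k, (k0 <= k)%N -> r < K o (y (i k)).
  by apply: Ly => n; have [_ _ _ _ []] := HD n.
have {}Lt r : exists k0 : nat, forall k, (k0 <= k)%N -> r < K o (c (i k) (t (i k))).
  apply: Lt => n; have [_ _ _ _ [h _ _ _]] := HD n.
  by have := Ktri Oo (Ot n) (Ox n); rewrite (Ksym (Ot n) (Ox n)); move: h (xK n); rewrite -/(x n); lra.
have {}Lt' r : exists k0 : nat, forall k, (k0 <= k)%N -> r < K o (c' (i k) (t' (i k))).
  apply: Lt' => n; have [_ _ _ _ [_ h _ _]] := HD n.
  by have := Ktri Oo (Ot' n) (Oy n); rewrite (Ksym (Ot' n) (Oy n)); move: h (yK n); rewrite -/(y n); lra.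
have {}Ls r : exists k0 : nat, forall k, (k0 <= k)%N -> r < K o (c (i k) (s (i k))).
  by apply: Ls => n; have [_ _ _ _ [_ _ h _]] := HD n; apply: le_trans h; rewrite (opprD (kap + rho)) (opprD kap) !addrA.
have {}Ls' r : exists k0 : nat, forall k, (k0 <= k)%N -> r < K o (c' (i k) (s' (i k))).
  by apply: Ls' => n; have [_ _ _ _ [_ _ _ h]] := HD n; apply: le_trans h; rewrite (opprD (kap + rho)) (opprD kap) !addrA.
have ray : cend ci = +oo%E.
  exact: (limit_is_ray Fq Fci C1 (s := t \o i) (fun k => t0 (i k)) (fun k => tc (i k)) (fun k => Ot (i k)) Lt).
have ray' : cend ci' = +oo%E.
  exact: (limit_is_ray Fq Fci' C2 (s := t' \o i) (fun k => t0' (i k)) (fun k => tc' (i k)) (fun k => Ot' (i k)) Lt').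
have [p0 _ cp0] := Flim _ Fci ray; have [q0 _ cq0] := Flim _ Fci' ray'.
have T1 : tends (fun k => c (i k) (t (i k))) p0.
  exact: (limit_at_end Fq Fci C1 (s := t \o i) (fun k => t0 (i k)) (fun k => tc (i k)) (fun k => Ot (i k)) Lt cp0).
have S1 : tends (fun k => c (i k) (s (i k))) p0.
  exact: (limit_at_end Fq Fci C1 (s := s \o i) (fun k => s0 (i k)) (fun k => sc (i k)) (fun k => Os (i k)) Ls cp0).
have T2 : tends (fun k => c' (i k) (t' (i k))) q0.
  exact: (limit_at_end Fq Fci' C2 (s := t' \o i) (fun k => t0' (i k)) (fun k => tc' (i k)) (fun k => Ot' (i k)) Lt' cq0).
have S2 : tends (fun k => c' (i k) (s' (i k))) q0.
  exact: (limit_at_end Fq Fci' C2 (s := s' \o i) (fun k => s0' (i k)) (fun k => sc' (i k)) (fun k => Os' (i k)) Ls' cq0).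
have xto (z : nat -> V) (p' : V) : (forall n, enorm (z n - p') < (n + N).+1%:R^-1) -> tends (z \o i) p'.
  move=> H e /inv_small[k0 Hk0]; exists k0 => k k0k; apply: lt_trans (H _) (Hk0 _ _).
  by apply: leq_trans k0k _; apply: leq_trans (ik k) (leq_addr _ _).
have xp : tends (x \o i) p by apply: xto => n; have [] := X1 n.
have yq : tends (y \o i) q by apply: xto => n; have [] := X2 n.
have {}xp := tends_contraction (ltW eta0) (fun k => Ox (i k)) (fun k => Ot (i k)) (fun k => xK (i k)) Lx xp.
have {}yq := tends_contraction (ltW eta0) (fun k => Oy (i k)) (fun k => Ot' (i k)) (fun k => yK (i k)) Ly yq.
have close k : K (c (i k) (s (i k))) (c' (i k) (s' (i k))) <= D1 by have [] := HD (i k).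
have D10 : 0 <= D1 by apply: le_trans (close 0%N); exact: K_ge0.
have {}S1 := tends_contraction D10 (fun k => Os (i k)) (fun k => Os' (i k)) close Ls S1.
by rewrite (tends_uniq xp T1) (tends_uniq S1 S2) (tends_uniq T2 yq).
Qed.

End FrameVisible.

(** * Nets and ultrafilters; visibility and Gromov products *)

Section UltraSequences.
Variable U : set_system nat.
Hypothesis UU : UltraFilter U.
Hypothesis UN : forall N, U [set n | (N <= n)%N].

(** Pigeonhole principle. *)
Lemma ultra_finite (T : eqType) (f : nat -> T) (s : seq T) : U [set k | f k \in s] ->
  exists2 a, a \in s & U [set k | f k = a].
Proof.
elim: s => [H|a s IH H].
  by have [k] := filter_ex H.
have [h|h] := ultra_dichotomy UU [set k | f k = a].
  by exists a => //; rewrite mem_head.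
have [|b bs Hb] := IH.
  apply: filterS (filterI H h) => k /= [+ ne]; rewrite inE => /predU1P[]//.
by exists b => //; rewrite inE bs orbT.
Qed.

Lemma ultra_subseq (A : nat -> set nat) : (forall n, U (A n)) ->
  exists m : nat -> nat, (forall j k, (j < k)%N -> (m j < m k)%N) /\ forall n, A n (m n).
Proof.
move=> UA.
have /choice[pick Hp] (nl : nat * nat) : exists k, (nl.2 < k)%N /\ A nl.1 k.
  by have [k [h1 h2]] := filter_ex (filterI (UN nl.2.+1) (UA nl.1)); exists k.
pose m := fix m n := if n is n'.+1 then pick (n, m n') else pick (0%N, 0%N).
exists m; split; last by case=> [|n]; [have [] := Hp (0%N, 0%N)|have [] := Hp (n.+1, m n)].
have mS n : (m n < m n.+1)%N by have [] := Hp (n.+1, m n).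
by move=> j; elim=> // k IH; rewrite ltnS leq_eqVlt => /predU1P[->//|/IH h]; exact: ltn_trans h (mS k).
Qed.

End UltraSequences.
Section VisibleFrame.
Variables (R : realType) (d : nat) (Omega : set 'rV[R[i]]_d) (M : R).
Local Notation V := 'rV[R[i]]_d.
Local Notation K := (kobayashi Omega).
Local Notation mu := (@lebesgue_measure R).
Hypothesis Hbd : forall z, Omega z -> enorm z <= M.
Hypothesis Hmet : metric_on Omega K.
Hypothesis Hopen : open Omega.
Hypothesis Hcomp : forall u : nat -> V, (forall n, Omega (u n)) ->
    (forall e : R, 0 < e -> exists N : nat, forall m n : nat,
       (N <= m)%N -> (N <= n)%N -> K (u m) (u n) < e) ->
    exists2 l, Omega l & forall e : R, 0 < e -> exists N : nat, forall n : nat,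
       (N <= n)%N -> K (u n) l < e.
Implicit Types (x y z w v : V).
Local Notation Ktri := (Ktri Hmet).
Local Notation Ksym := (Ksym Hmet).

Local Notation Kgeo := (geo Omega K).

Variable delta : R.
Hypothesis delta0 : 0 < delta.
Hypothesis Hslim : forall x y z g1 g2 g3 (L1 L2 L3 : R),
  Kgeo g1 L1 x y -> Kgeo g2 L2 y z -> Kgeo g3 L3 z x ->
  forall t, 0 <= t -> t <= L1 ->
  exists s, (0 <= s /\ s <= L2 /\ K (g1 t) (g2 s) <= delta) \/
            (0 <= s /\ s <= L3 /\ K (g1 t) (g3 s) <= delta).
Hypothesis Hdisc : no_nontrivial_analytic_discs (boundary Omega).
Variable o : V.
Hypothesis Oo : Omega o.

Local Notation gp := (gromov_prod K).

Definition sphere (r : R) := [set z | Omega z /\ K o z = r].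

(** A maximal set of points at mutual distance more than 1 is finite, because a
    sequence of such points has no limit. *)
Lemma sphere_net (r : R) : exists s : seq V, (forall v, v \in s -> sphere r v) /\
  forall z, sphere r z -> exists2 v, v \in s & K z v <= 1.
Proof.
apply: contrapT => nE.
have /choice[f Hf] (s : seq V) : exists z, (forall v, v \in s -> sphere r v) ->
    sphere r z /\ forall v, v \in s -> 1 < K z v.
  have [h|h] := pselect (forall v, v \in s -> sphere r v); last by exists 0.
  apply: contrapT => nz; apply: nE; exists s; split=> // z Sz.
  apply: contrapT => nv; apply: nz; exists z => _; split=> // v vs.
  by rewrite ltNge; apply/negP => Kzv; apply: nv; exists v.
pose s := fix s n := if n is n'.+1 then f (s n') :: s n' else [::].
have sS n : forall v, v \in s n -> sphere r v.
  elim: n => //= n IH v; rewrite inE => /predU1P[->|]; last exact: IH.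
  by have [] := Hf _ IH.
have fS n := (Hf _ (sS n)).1.
have sep m n : (m < n)%N -> 1 < K (f (s n)) (f (s m)).
  move=> mn; apply: (Hf _ (sS n)).2; elim: n mn => // n IH; rewrite ltnS leq_eqVlt /= inE.
  by move=> /predU1P[->|/IH ->]; rewrite ?eqxx ?orbT.
have [U [UU UN]] := nat_ultra.
have [|l Ol Hl] := ultra_Klim Hbd Hmet Hopen Hcomp Oo UU (f := fun n => f (s n)) (r := r).
  by apply: filterE => n /=; have [h ->] := fS n.
have h2 : 0 < (2^-1 : R) by rewrite invr_gt0.
have [m [Om Km]] := filter_ex (Hl _ h2).
have [n [mn [On Kn]]] := filter_ex (filterI (UN m.+1) (Hl _ h2)).
have := sep m n mn; rewrite ltNge => /negP; apply.
apply: le_trans (Ktri On Ol Om) _; rewrite (Ksym Ol Om) [leRHS]splitr mul1r.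
by apply: lerD; exact: ltW.
Qed.

(** Otherwise two sequences with unbounded Gromov products tend to distinct
    points of the boundary, and the geodesics joining them leave every compact
    set. *)
Lemma visible_close : visible Omega -> forall theta : R, 0 < theta ->
  exists T : R, forall x y, Omega x -> Omega y -> T <= gp o x y -> enorm (x - y) <= theta.
Proof.
move=> vis theta theta0; apply: contrapT => nE.
have /choice[xy Hxy] (n : nat) : exists xy : V * V, [/\ Omega xy.1, Omega xy.2,
    n%:R <= gp o xy.1 xy.2 & theta < enorm (xy.1 - xy.2)].
  apply: contrapT => nn; apply: nE; exists n%:R => x y Ox Oy gxy.
  by rewrite leNgt; apply/negP => lt; apply: nn; exists (x, y).
pose x n := (xy n).1; pose y n := (xy n).2.
have Ox n : Omega (x n) by have [] := Hxy n.
have Oy n : Omega (y n) by have [] := Hxy n.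
have [U [UU UN]] := nat_ultra.
have lim (u : nat -> V) : (forall n, Omega (u n)) -> (forall n, n%:R <= K o (u n)) ->
    exists2 p, boundary Omega p & forall e : R, 0 < e -> U [set k | enorm (u k - p) < e].
  move=> Ou Ku; have [|p Hp] := ultra_limit UU (f := u) (M := M).
    by apply: filterE => k; exact: Hbd.
  exists p => //; apply: (ultra_boundary Hmet Hopen Oo UU Ou) => // r.
  apply: filterS (UN (Num.truncn r).+1) => k /= rk; apply: lt_le_trans (Ku k).
  by apply: lt_le_trans (truncnS_gt r) _; rewrite ler_nat.
have [|p bp Hp] := lim x Ox.
  by move=> n; have [h1 h2 h3 _] := Hxy n; apply: le_trans h3 (gp_le_dist Hmet Oo h1 h2).
have [|q bq Hq] := lim y Oy.
  by move=> n; have [h1 h2 h3 _] := Hxy n; apply: le_trans h3 _; rewrite (gp_sym Hmet) //; exact: gp_le_dist.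
have pq : p <> q.
  move=> E; have t2 : 0 < theta / 2 by rewrite divr_gt0.
  have [k [h1 h2]] := filter_ex (filterI (Hp _ t2) (Hq _ t2)).
  have [_ _ _] := Hxy k; rewrite ltNge => /negP; apply.
  apply: le_trans (enorm_triangle p _ _) _; rewrite (enormB p) {2}E [leRHS]splitr.
  by apply: lerD; apply: ltW.
have [Vp [Vq [C [/nbhs_enorm[e1 e10 He1] /nbhs_enorm[e2 e20 He2] _ [cC CO] Hvis]]]] := vis p q bp bq pq.
have [r Hr] := compact_Kbounded Hmet Hopen Oo cC CO.
have [k [kr [h1 h2]]] := filter_ex (filterI (UN (Num.truncn r).+1) (filterI (Hp _ e10) (Hq _ e20))).
have [g G] := Kgeo_ex Hbd Hmet Hopen Hcomp (Ox k) (Oy k).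
have [|| w [[t + <-] Cw]] := Hvis (x k) (y k) _ _ _ (Kgeo_segment G).
- by split=> //; apply: He1.
- by split=> //; apply: He2.
rewrite /= in_itv /= => /andP[t0 tL].
have := gp_le_geo Hmet Oo G t0 tL; have := Hr _ Cw; have [_ _ + _] := Hxy k.
rewrite -/(x k) -/(y k) => a1 a2 a3.
have : k%:R <= r by apply: le_trans a1 (le_trans a3 a2).
rewrite leNgt => /negP; apply; apply: lt_le_trans (truncnS_gt r) _; rewrite ler_nat.
exact: kr.
Qed.

End VisibleFrame.

(** * The frame of a visible domain *)

Section NetFrame.
Variables (R : realType) (d : nat) (Omega : set 'rV[R[i]]_d) (M : R).
Local Notation V := 'rV[R[i]]_d.
Local Notation K := (kobayashi Omega).
Local Notation mu := (@lebesgue_measure R).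
Hypothesis Hbd : forall z, Omega z -> enorm z <= M.
Hypothesis Hmet : metric_on Omega K.
Hypothesis Hopen : open Omega.
Hypothesis Hcomp : forall u : nat -> V, (forall n, Omega (u n)) ->
    (forall e : R, 0 < e -> exists N : nat, forall m n : nat,
       (N <= m)%N -> (N <= n)%N -> K (u m) (u n) < e) ->
    exists2 l, Omega l & forall e : R, 0 < e -> exists N : nat, forall n : nat,
       (N <= n)%N -> K (u n) l < e.
Implicit Types (x y z : V) (v : nat -> V).
Local Notation Ktri := (Ktri Hmet).
Local Notation Ksym := (Ksym Hmet).

Local Notation Kgeo := (geo Omega K).

Variable delta : R.
Hypothesis delta0 : 0 < delta.
Hypothesis Hslim : forall x y z g1 g2 g3 (L1 L2 L3 : R),
  Kgeo g1 L1 x y -> Kgeo g2 L2 y z -> Kgeo g3 L3 z x ->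
  forall t, 0 <= t -> t <= L1 ->
  exists s, (0 <= s /\ s <= L2 /\ K (g1 t) (g2 s) <= delta) \/
            (0 <= s /\ s <= L3 /\ K (g1 t) (g3 s) <= delta).
Hypothesis Hdisc : no_nontrivial_analytic_discs (boundary Omega).
Variable o : V.
Hypothesis Oo : Omega o.

Local Notation gp := (gromov_prod K).

Variable L : R.
Hypothesis L0 : 0 < L.
Hypothesis Ldelta : 5 * delta <= L.
Let l := L + 3.

Variable net : nat -> seq V.
Hypothesis net_in : forall n (a : V), a \in net n -> sphere Omega o (n%:R * L) a.
Hypothesis net_dense : forall n z, sphere Omega o (n%:R * L) z -> exists2 a, a \in net n & K z a <= 1.

Variables (arc : V -> V -> R -> V) (bad : V -> V -> seq R).
Hypothesis arcP : forall x y, Omega x -> Omega y -> K x y < l ->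
  unit_speed_path Omega x y l (arc x y) (bad x y).

(* imposed on all arcs, so that a finite path ends at its last node whatever
   the value of v at the next index *)
Hypothesis arc0 : forall x y, arc x y 0 = x.

Let l0 : 0 < l. Proof. by rewrite addr_gt0. Qed.

(** Paths in the graph whose vertices are the points of the nets. *)
Definition is_path (n : nat) (v : nat -> V) :=
  (forall i, (i <= n)%N -> v i \in net i) /\ (forall i, (i < n)%N -> K (v i) (v i.+1) <= L + 2).

(** The arcs are concatenated with the same duration l for all edges, so that
    convergence of paths becomes pointwise agreement on longer and longer
    intervals. *)
Definition crv (v : nat -> V) (t : R) : V :=
  let i := Num.truncn (t / l) in arc (v i) (v i.+1) (t - i%:R * l).

Lemma is_path_le m n (v : nat -> V) : (m <= n)%N -> is_path n v -> is_path m v.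
Proof.
by move=> mn [h1 h2]; split=> i im; [apply: h1|apply: h2]; exact: leq_trans im mn.
Qed.

Lemma natS_l (i : nat) : i.+1%:R * l = i%:R * l + l.
Proof. by rewrite -natr1 mulrDl mul1r. Qed.

Lemma trunc_piece (i : nat) (t : R) : i%:R * l <= t -> t < i.+1%:R * l -> Num.truncn (t / l) = i.
Proof.
by move=> h1 h2; apply: truncn_def; rewrite ler_pdivlMr // ltr_pdivrMr // h1.
Qed.

Lemma crv_node (v : nat -> V) i : crv v (i%:R * l) = v i.
Proof.
by rewrite /crv (trunc_piece (lexx _)) ?subrr ?arc0 // natS_l ltrDl.
Qed.

Section Path.
Variables (n : nat) (v : nat -> V).
Hypothesis vP : is_path n v.

Lemma path_sphere i : (i <= n)%N -> Omega (v i) /\ K o (v i) = i%:R * L.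
Proof. by move=> /vP.1/net_in. Qed.

Lemma path_arc i : (i < n)%N -> unit_speed_path Omega (v i) (v i.+1) l (arc (v i) (v i.+1)) (bad (v i) (v i.+1)).
Proof.
move=> i_n; apply: arcP; [exact: (path_sphere (ltnW i_n)).1|exact: (path_sphere i_n).1|].
by apply: le_lt_trans (vP.2 _ i_n) _; rewrite ltrD2l ltr_nat.
Qed.

Lemma crv_arc i t : (i < n)%N -> i%:R * l <= t -> t <= i.+1%:R * l ->
  crv v t = arc (v i) (v i.+1) (t - i%:R * l).
Proof.
move=> i_n h1; rewrite le_eqVlt => /predU1P[->|h2]; last by rewrite /crv (trunc_piece h1 h2).
have [_ + _ _] := path_arc i_n.
by rewrite crv_node natS_l addrAC subrr add0r => ->.
Qed.

Lemma crv_lipschitz m s t : (m <= n)%N -> 0 <= s -> s <= t -> t <= m%:R * l ->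
  Omega (crv v s) /\ (Omega (crv v t) /\ K (crv v s) (crv v t) <= t - s).
Proof.
have local i s' t' : (i < n)%N -> i%:R * l <= s' -> s' <= t' -> t' <= i.+1%:R * l ->
    Omega (crv v s') /\ (Omega (crv v t') /\ K (crv v s') (crv v t') <= t' - s').
  move=> i_n h1 h2 h3; have h4 : s' <= i.+1%:R * l by exact: le_trans h3.
  have h5 : i%:R * l <= t' by exact: le_trans h2.
  rewrite !(crv_arc i_n) //; have [_ _ H _] := path_arc i_n.
  have k1 : 0 <= s' - i%:R * l by rewrite subr_ge0.
  have k2 : 0 <= t' - i%:R * l by rewrite subr_ge0.
  have k3 : s' - i%:R * l <= t' - i%:R * l by rewrite lerD2r.
  have k4 : t' - i%:R * l <= l by rewrite lerBlDl -natS_l.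
  have [p1 p2] := H _ _ k1 k3 k4; have [p3 _] := H _ _ k2 (lexx _) k4.
  by split=> //; split=> //; apply: le_trans p2 _; rewrite opprB addrA subrK.
elim: m s t => [|m IH] s t mn s0 st tm.
  have -> : s = 0%:R * l by apply/eqP; rewrite eq_le !mul0r in tm *; rewrite s0 (le_trans st).
  have -> : t = 0%:R * l by apply/eqP; rewrite eq_le !mul0r in tm *; rewrite tm (le_trans s0).
  by rewrite crv_node subrr Kxx //; have [] := path_sphere (leq0n n).
have [sm|ms] := leP s (m%:R * l); last exact: (local m s t mn (ltW ms) st tm).
have [tm'|mt] := leP t (m%:R * l); first exact: IH (ltnW mn) s0 st tm'.
have [Q1 [Q2 K1]] := IH _ _ (ltnW mn) s0 sm (lexx _).
have [_ [Q3 K2]] := local m _ _ mn (lexx _) (ltW mt) tm.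
split=> //; split=> //; apply: le_trans (Ktri Q1 Q2 Q3) _.
by apply: le_trans (lerD K1 K2) _; rewrite addrC addrA subrK.
Qed.

Lemma crv_O t : 0 <= t -> t <= n%:R * l -> Omega (crv v t).
Proof. by move=> t0 tn; have [] := crv_lipschitz (leqnn n) t0 (lexx _) tn. Qed.

Lemma near_node t : 0 <= t -> t <= n%:R * l -> exists i, [/\ (i <= n)%N, i%:R * l <= t,
  t < i%:R * l + l & K (v i) (crv v t) <= l].
Proof.
move=> t0 tn; pose i := Num.truncn (t / l).
have tl : 0 <= t / l by rewrite divr_ge0 // ltW.
have /andP[] := truncn_itv tl; rewrite -/i ler_pdivlMr // ltr_pdivrMr // natS_l => h1 h2.
have il : (i <= n)%N by rewrite -(ler_nat R) -(ler_pM2r l0); exact: le_trans tn.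
exists i; split=> //.
have i0 : 0 <= i%:R * l by rewrite mulr_ge0 // ltW.
have [_ [_]] := crv_lipschitz (leqnn n) i0 h1 tn.
rewrite crv_node => H; apply: le_trans H _; rewrite lerBlDl; exact: ltW.
Qed.

Lemma node_dist i j : (i <= j)%N -> (j <= n)%N -> (j%:R - i%:R) * L <= K (v i) (v j).
Proof.
move=> ij jn; have [Oi Ki] := path_sphere (leq_trans ij jn); have [Oj Kj] := path_sphere jn.
by have := Ktri Oo Oi Oj; rewrite Ki Kj mulrBl lerBlDl.
Qed.

(** Distances to o grow by L at every node, so a path of n edges moves by at
    least n L, while it lasts n l. *)
Lemma crv_quasi s t : 0 <= s -> s <= t -> t <= n%:R * l ->
  t - s <= l / L * K (crv v s) (crv v t) + (2 * l ^+ 2 / L + l).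
Proof.
move=> s0 st tn; have t0 := le_trans s0 st; have sn := le_trans st tn.
have [i [i_n h1 h2 h3]] := near_node s0 sn; have [j [jn k1 k2 k3]] := near_node t0 tn.
have Os := crv_O s0 sn; have Ot := crv_O t0 tn.
have [Oi _] := path_sphere i_n; have [Oj _] := path_sphere jn.
have KK : (j%:R - i%:R) * L <= K (crv v s) (crv v t) + 2 * l.
  have [ij|ji] := leqP i j.
    have n1 := node_dist ij jn; have n2 := Ktri Oi Os Oj; have n3 := Ktri Os Ot Oj.
    rewrite (Ksym Ot Oj) in n3; move: n1 n2 n3 h3 k3; lra.
  apply: (@le_trans _ _ 0).
    by apply: mulr_le0_ge0; [rewrite subr_le0 ler_nat ltnW|exact: ltW].
  by rewrite addr_ge0 ?K_ge0 // mulr_ge0 // ltW.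
have -> : l / L * K (crv v s) (crv v t) + (2 * l ^+ 2 / L + l) =
    (K (crv v s) (crv v t) + 2 * l) / L * l + l by field; exact: lt0r_neq0.
have : (j%:R - i%:R) * l <= (K (crv v s) (crv v t) + 2 * l) / L * l.
  by rewrite ler_pM2r // ler_pdivlMr.
by move: h1 k2; rewrite mulrBl; move: (i%:R * l) (j%:R * l) (_ / L * l) => a b c; lra.
Qed.

Lemma crv_bad : exists2 N : set R, countable N & forall u, 0 < u -> u < n%:R * l -> ~ N u ->
  kobayashi_metric Omega (crv v u) (velocity (crv v) u) <= 1.
Proof.
pose badi i := [set i%:R * l + b | b in [set` 0 :: bad (v i) (v i.+1)]].
exists (\bigcup_i badi i).
  apply: bigcup_countable => // i _; apply: finite_set_countable; apply: finite_image.
  exact: finite_seq.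
move=> u u0 un nb; pose i := Num.truncn (u / l).
have ul : 0 <= u / l by rewrite divr_ge0 // ltW.
have /andP[] := truncn_itv ul; rewrite -/i ler_pdivlMr // ltr_pdivrMr // => h1 h2.
have i_n : (i < n)%N by rewrite -(ltr_nat R) -(ltr_pM2r l0); exact: le_lt_trans un.
have [_ _ _ H] := path_arc i_n.
have h1' : i%:R * l < u.
  rewrite lt_neqAle h1 andbT; apply/eqP => E; apply: nb; exists i => //.
  by exists 0; rewrite /= ?mem_head // addr0.
have r0 : 0 < Num.min (u - i%:R * l) (i.+1%:R * l - u) by rewrite lt_min !subr_gt0 h1'.
have E (s : R) : `|s - u| < Num.min (u - i%:R * l) (i.+1%:R * l - u) ->
    crv v s = arc (v i) (v i.+1) (s - i%:R * l).
  rewrite lt_min !ltr_norml => /andP[/andP[p _] /andP[_ q]].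
  by apply: crv_arc => //; [rewrite ltrBrDr opprB subrK in p|rewrite ltrBlDr subrK in q]; exact: ltW.
rewrite (velocity_near_eq r0 E) velocity_shift (E u) ?subrr ?normr0 //.
apply: H; rewrite ?subr_gt0 ?ltrBlDl -?natS_l //.
apply/negP => hb; apply: nb; exists i => //; exists (u - i%:R * l); last by rewrite addrC subrK.
by rewrite /= inE hb orbT.
Qed.

Let A := l / L.
Let B := 2 * l ^+ 2 / L + l.

Lemma crv_quasi_geodesic : quasi_geodesic Omega A B 0 (n%:R * l) (crv v).
Proof.
split; first exact: crv_O.
- apply: (lipschitz_abs_continuous (C := Klip d M)); first exact: Klip_gt0.
  move=> s t s0 st tn; have [Os [Ot Kst]] := crv_lipschitz (leqnn n) s0 st tn.
  rewrite enormB; apply: le_trans (enorm_le_K Hbd Hmet Os Ot) _.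
  by apply: ler_wpM2l Kst; exact/ltW/Klip_gt0.
- move=> s t s0 st tn; have [N cN HN] := crv_bad.
  apply: le_trans (length_le_time (ltW st) cN _) _.
    move=> u su ut; apply: HN; first exact: le_lt_trans su.
    exact: lt_le_trans tn.
  by rewrite lee_fin; apply: crv_quasi => //; exact: ltW.
Qed.

(** Backward induction with the four-point inequality. The loss 5 delta at each
    step is compensated by the growth L of the distance to o, so it does not
    accumulate. *)
Lemma node_gp i j : (i <= j)%N -> (j <= n)%N -> i%:R * L - 2 - 5 * delta <= gp o (v i) (v j).
Proof.
move=> ij jn; have [m E] : exists m, (j = i + m)%N by exists (j - i)%N; rewrite subnKC.
elim: m i ij E => [|m IH] i ij E.
  have [Oi Ki] := path_sphere jn; rewrite addn0 in E; rewrite -E.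
  have := gp_ge_l Hmet Oo Oi Oi; rewrite Kxx // Ki subr0; apply: le_trans.
  by rewrite -addrA gerDl -opprD oppr_le0 addr_ge0 // mulr_ge0 // ltW.
have ij' : (i < j)%N by rewrite E addnS ltnS leq_addr.
have i_n := leq_trans ij' jn.
have [Oi _] := path_sphere (ltnW i_n); have [Oi' Ki'] := path_sphere i_n; have [Oj _] := path_sphere jn.
have h1 := gp_ge_l Hmet Oo Oi' Oi; rewrite (gp_sym Hmet) // (Ksym Oi' Oi) Ki' in h1.
have h2 := vP.2 _ i_n.
have h3 := IH _ ij' (etrans E (esym (addSnnS _ _))).
apply: le_trans (four_point Hmet delta0 (Kgeo_ex Hbd Hmet Hopen Hcomp) Hslim Oo Oi Oi' Oj).
rewrite -natr1 mulrDl mul1r in h1 h3; rewrite lerD2r le_min.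
apply/andP; split.
  by move: h1 h2; lra.
by apply: le_trans h3; move: Ldelta delta0; lra.
Qed.

Lemma crv_gp m s t : (m <= n)%N -> m%:R * l <= s -> s <= n%:R * l -> m%:R * l <= t -> t <= n%:R * l ->
  m%:R * L - 2 - 5 * delta - 2 * l <= gp o (crv v s) (crv v t).
Proof.
move=> mn; have m0 : 0 <= m%:R * l by rewrite mulr_ge0 // ltW.
wlog st : s t / s <= t => [H ms sn mt tn|].
  have [st|/ltW ts] := leP s t; first exact: H.
  have Os := crv_O (le_trans m0 ms) sn; have Ot := crv_O (le_trans m0 mt) tn.
  by rewrite (gp_sym Hmet) //; exact: H.
move=> ms sn mt tn; have s0 := le_trans m0 ms; have t0 := le_trans m0 mt.
have [i [i_n h1 h2 h3]] := near_node s0 sn; have [j [jn k1 k2 k3]] := near_node t0 tn.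
have Os := crv_O s0 sn; have Ot := crv_O t0 tn.
have [Oi _] := path_sphere i_n; have [Oj _] := path_sphere jn.
rewrite -natS_l in h2; rewrite -natS_l in k2.
have mi : (m <= i)%N.
  by rewrite -ltnS -(ltr_nat R) -(ltr_pM2r l0); exact: (le_lt_trans ms h2).
have ij : (i <= j)%N.
  by rewrite -ltnS -(ltr_nat R) -(ltr_pM2r l0); exact: (le_lt_trans (le_trans h1 st) k2).
apply: le_trans (gp_perturb Hmet Oo Oi Oj Os Ot).
have := node_gp ij jn; have : m%:R * L <= i%:R * L by rewrite ler_pM2r // ler_nat.
by move: h3 k3; move: (m%:R * L) (i%:R * L) => a b; lra.
Qed.

End Path.

Lemma crv_agree (v w : nat -> V) n t : (forall i, (i <= n)%N -> v i = w i) -> 0 <= t ->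
  t <= n%:R * l -> crv v t = crv w t.
Proof.
move=> vw t0; rewrite le_eqVlt => /predU1P[->|tn]; first by rewrite !crv_node vw.
have tl : 0 <= t / l by rewrite divr_ge0 // ltW.
have /andP[+ _] := truncn_itv tl; rewrite ler_pdivlMr // => h1.
have i_n : (Num.truncn (t / l) < n)%N by rewrite -(ltr_nat R) -(ltr_pM2r l0); exact: le_lt_trans tn.
by rewrite /crv !vw // ltnW.
Qed.

Definition path_curve (c : curve R d) (v : nat -> V) := cfun c = crv v /\
  ((cend c = +oo%E /\ forall n, is_path n v) \/
   exists n, [/\ (0 < n)%N, cend c = (n%:R * l)%:E & is_path n v]).

Definition path_curves := [set c : curve R d | exists v, path_curve c v].

Lemma nat_above (t : R) : exists n : nat, t <= n%:R * l.
Proof.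
exists (Num.truncn (t / l)).+1; rewrite -ler_pdivrMr //; apply: ltW; exact: truncnS_gt.
Qed.

Lemma path_curve_reach c v t : path_curve c v -> (t%:E <= cend c)%E ->
  exists2 n, is_path n v & t <= n%:R * l.
Proof.
move=> [_ [[_ vP]|[n [_ -> vP]]]].
  by move=> _; have [n tn] := nat_above t; exists n.
by rewrite lee_fin => tn; exists n.
Qed.

Lemma path_curve_path c v n : path_curve c v -> ((n%:R * l)%:E <= cend c)%E -> is_path n v.
Proof.
move=> pc /(path_curve_reach pc)[m vP]; rewrite ler_pM2r // ler_nat => nm.
exact: is_path_le vP.
Qed.

Lemma path_curve_quasi c : path_curves c -> [/\ (0 < cend c)%E,
  forall r : R, cend c = r%:E -> quasi_geodesic Omega (l / L) (2 * l ^+ 2 / L + l) 0 r c &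
  cend c = +oo%E -> quasi_geodesic_ray Omega (l / L) (2 * l ^+ 2 / L + l) c].
Proof.
move=> [v [cE cv]]; rewrite /quasi_geodesic_ray cE; case: cv => [[-> vP]|[n [n0 -> vP]]].
  split=> // _ a b a0 _; have [n bn] := nat_above b.
  exact: quasi_geodesic_sub a0 bn (crv_quasi_geodesic (vP n)).
split=> // [|r [<-]]; last exact: crv_quasi_geodesic.
by rewrite lte_fin mulr_gt0 // ltr0n.
Qed.

Hypothesis Hclose : forall theta : R, 0 < theta ->
  exists T : R, forall x y, Omega x -> Omega y -> T <= gp o x y -> enorm (x - y) <= theta.

Let ltail (m : nat) := m%:R * L - 2 - 5 * delta - 2 * l.

Lemma ltail_large (T : R) : exists m, T <= ltail m.
Proof.
exists (Num.truncn ((T + 2 * l + 5 * delta + 2) / L)).+1.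
have := truncnS_gt ((T + 2 * l + 5 * delta + 2) / L); rewrite ltr_pdivrMr // => /ltW.
by rewrite /ltail !lerBrDr.
Qed.

(** The tails of all the paths are uniformly small in the Euclidean sense:
    this is where visibility enters. *)
Lemma tail_small (theta : R) : 0 < theta -> exists m : nat, forall n v, is_path n v ->
  forall s t, m%:R * l <= s -> s <= n%:R * l -> m%:R * l <= t -> t <= n%:R * l ->
  enorm (crv v s - crv v t) <= theta.
Proof.
move=> /Hclose[T HT]; have [m Tm] := ltail_large T; exists m => n v vP s t ms sn mt tn.
have m0 : 0 <= m%:R * l by rewrite mulr_ge0 // ltW.
apply: HT; [exact: crv_O (le_trans m0 ms) sn|exact: crv_O (le_trans m0 mt) tn|].
apply: le_trans Tm _; apply: (crv_gp vP) => //.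
by rewrite -(ler_nat R) -(ler_pM2r l0); exact: le_trans sn.
Qed.

Lemma ray_limit (v : nat -> V) : (forall n, is_path n v) ->
  exists2 p, boundary Omega p & crv v t @[t --> +oo] --> p.
Proof.
move=> vP; have [U [UU UN]] := nat_ultra.
pose f k := crv v (k%:R * l).
have k0 (k : nat) : 0 <= k%:R * l by rewrite mulr_ge0 // ltW.
have fO k : Omega (f k) by apply: (crv_O (vP k)).
have [|p Hp] := ultra_limit UU (f := f) (M := M).
  by apply: filterE => k; exact: Hbd.
exists p.
  apply: (ultra_boundary Hmet Hopen Oo UU fO) => // r.
  have [m Hm] := ltail_large (r + 1); apply: filterS (UN m) => k /= mk.
  apply: lt_le_trans (gp_le_dist Hmet Oo (fO k) (fO k)).
  have mkl : m%:R * l <= k%:R * l by rewrite ler_pM2r // ler_nat.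
  apply: lt_le_trans (crv_gp (vP k) mk mkl (lexx _) mkl (lexx _)).
  by apply: lt_le_trans Hm; rewrite ltrDl.
move=> S /nbhs_enorm[e e0 eS]; have e2 : 0 < e / 2 by rewrite divr_gt0.
have [m Hm] := tail_small e2.
have [k [mk pk]] := filter_ex (filterI (UN m) (Hp _ e2)).
exists (m%:R * l); split; first exact: num_real.
move=> t mt /=; apply: eS; apply: le_lt_trans (enorm_triangle (f k) _ _) _.
rewrite [ltRHS]splitr; apply: ler_ltD pk.
have [n tn] := nat_above t.
apply: (Hm (maxn n k) v (vP _)); rewrite ?(ltW mt) ?ler_pM2r ?ler_nat ?leq_maxr //.
by apply: le_trans tn _; rewrite ler_pM2r // ler_nat leq_maxl.
Qed.

Lemma ray_tail (v : nat -> V) (p : V) (m : nat) (theta : R) : (forall n, is_path n v) ->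
  crv v t @[t --> +oo] --> p ->
  (forall n, forall s t, m%:R * l <= s -> s <= n%:R * l -> m%:R * l <= t -> t <= n%:R * l ->
     enorm (crv v s - crv v t) <= theta) ->
  forall s, m%:R * l <= s -> enorm (crv v s - p) <= theta.
Proof.
move=> vP cp H s ms; apply/ler_addgt0Pl => e e0.
have : nbhs p [set z | enorm (z - p) < e] by apply/nbhs_enorm; exists e.
move=> /cp[T [_ HT]]; pose t := Num.max (T + 1) s.
have tT : T < t by rewrite lt_max ltrDl ltr01.
have st : s <= t by rewrite le_max lexx orbT.
have [n tn] := nat_above t.
apply: le_trans (enorm_triangle (crv v t) _ _) _; rewrite addrC.
apply: lerD; first exact/ltW/HT.
by apply: (H n) => //; [exact: le_trans st tn|exact: le_trans st].
Qed.

(** A diagonal argument, in which the finiteness of the nets provides the limit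
    nodes. The curves agree with their limit up to a large time, and their
    remaining parts are small by [tail_small]. *)
Section Compactness.
Variable U : set_system nat.
Hypothesis UU : UltraFilter U.
Hypothesis UN : forall N, U [set n | (N <= n)%N].
Variables (c_ : nat -> curve R d) (v : nat -> nat -> V).
Hypothesis cv : forall k, path_curve (c_ k) (v k).

Let agree (w : nat -> V) n : (forall i, (i <= n)%N -> U [set k | v k i = w i]) ->
  U [set k | forall i, (i <= n)%N -> v k i = w i].
Proof.
elim: n => [|n IH] H.
  by apply: filterS (H 0%N (leqnn _)) => k /= vk i; rewrite leqn0 => /eqP ->.
have h1 := IH (fun i i_n => H i (leqW i_n)).
apply: filterS (filterI h1 (H n.+1 (leqnn _))) => k /= [h2 h3] i.
by rewrite leq_eqVlt ltnS => /predU1P[->|/h2].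
Qed.

Let limit_node i : U [set k | is_path i (v k)] -> exists a, U [set k | v k i = a].
Proof.
move=> H; have [|a _ Ha] := ultra_finite UU (f := fun k => v k i) (s := net i).
  by apply: filterS H => k [h _]; apply: h.
by exists a.
Qed.

(* infinitely many of the curves have the same finite length *)
Let compact_finite N : U [set k | cend (c_ k) = (N%:R * l)%:E] ->
  exists m c, [/\ forall j k, (j < k)%N -> (m j < m k)%N, path_curves c &
    converges_uniformly (c_ \o m) c].
Proof.
move=> HN.
have /choice[w Hw] i : exists a, (i <= N)%N -> U [set k | v k i = a].
  have [iN|Ni] := leqP i N; last by exists 0.
  have [|a Ha] := @limit_node i; last by exists a.
  apply: filterS HN => k /= Nk; apply: (path_curve_path (cv k)).
  by rewrite Nk lee_fin ler_pM2r // ler_nat.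
have [m [mm Hm]] := ultra_subseq UU UN (fun _ => filterI HN (agree Hw)).
exists m, (c_ (m 0%N)); split=> //; first by exists (v (m 0%N)); exact: cv.
split; first by rewrite (_ : (fun k => cend ((c_ \o m) k)) = fun=> cend (c_ (m 0%N)));
  [exact: cvg_cst|apply/funext => k /=; rewrite (Hm k).1 (Hm 0%N).1].
move=> theta theta0; exists 0%N => k _ t t0; rewrite /comp (Hm k).1 (Hm 0%N).1 => tN.
split=> //; case: t t0 tN => [t| |] //; rewrite !lee_fin => t0 tN /=.
rewrite (cv (m k)).1 (cv (m 0%N)).1 (crv_agree (w := v (m 0%N)) _ t0 tN).
  by rewrite subrr enorm0 ltW.
by move=> i iN; rewrite (Hm k).2 // (Hm 0%N).2.
Qed.

(* the lengths tend to infinity *)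
Let compact_infinite : (forall N, ~ U [set k | cend (c_ k) = (N%:R * l)%:E]) ->
  exists m c, [/\ forall j k, (j < k)%N -> (m j < m k)%N, path_curves c &
    converges_uniformly (c_ \o m) c].
Proof.
move=> nU.
have long n : U [set k | ((n%:R * l)%:E <= cend (c_ k))%E].
  elim: n => [|n IH].
    apply: filterE => k /=; rewrite mul0r; apply: ltW.
    by have [] := @path_curve_quasi (c_ k) (ex_intro _ _ (cv k)).
  have [h|h] := ultra_dichotomy UU [set k | cend (c_ k) = (n%:R * l)%:E]; first by have := nU n h.
  apply: filterS (filterI IH h) => k /= [h1 h2].
  have [_ [[-> _]|[N [_ E _]]]] := cv k; first by rewrite leey.
  rewrite E in h1 h2 *; move: h1; rewrite !lee_fin !ler_pM2r // !ler_nat leq_eqVlt => /predU1P[E'|//].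
  by exfalso; apply: h2; rewrite E'.
have paths n : U [set k | is_path n (v k)].
  by apply: filterS (long n) => k; exact: path_curve_path.
have /choice[w Hw] i := limit_node (paths i).
have wP n : is_path n w.
  have [k [[h1 h2] h3]] := filter_ex (filterI (paths n) (agree (fun i _ => Hw i) (n := n))).
  split=> i i_n; first by rewrite -h3 //; exact: h1.
  by rewrite -!h3 //; [exact: h2|exact: ltnW].
have [m [mm Hm]] := ultra_subseq UU UN (fun n => filterI (long n) (agree (fun i _ => Hw i) (n := n))).
pose c := Curve +oo%E (crv w).
have pc : path_curve c w by split=> //; left.
exists m, c; split=> //; first by exists w.
split.
  apply/cvgeyPge => B; have [n Bn] := nat_above B; exists n => // k /= nk.
  apply: le_trans (Hm k).1; rewrite lee_fin; apply: le_trans Bn _.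
  by rewrite ler_pM2r // ler_nat.
move=> theta theta0; have t2 : 0 < theta / 2 by rewrite divr_gt0.
have [m0 Hm0] := tail_small t2; exists m0 => k m0k t t0 tc; split; first by rewrite leey.
have m00 : 0 <= m0%:R * l by rewrite mulr_ge0 // ltW.
have same s : 0 <= s -> s <= m0%:R * l -> crv (v (m k)) s = crv w s.
  by move=> s0 sm; apply: (crv_agree _ s0 sm) => i im; apply: (Hm k).2; exact: leq_trans m0k.
have split_ (x y : V) : enorm (x - crv (v (m k)) (m0%:R * l)) <= theta / 2 ->
    enorm (y - crv w (m0%:R * l)) <= theta / 2 -> enorm (x - y) <= theta.
  rewrite (same _ m00 (lexx _)) => h1 h2.
  apply: le_trans (enorm_triangle (crv w (m0%:R * l)) _ _) _.
  by rewrite [leRHS]splitr; apply: lerD => //; rewrite enormB.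
case: t t0 tc => [t| |] // t0 tc.
  rewrite lee_fin in t0; rewrite /= (cv (m k)).1.
  have [tm|mt] := leP t (m0%:R * l); first by rewrite same // subrr enorm0 ltW.
  have [n vP tn] := path_curve_reach (cv (m k)) tc.
  have mn : m0%:R * l <= n%:R * l by exact: le_trans (ltW mt) tn.
  have [n' tn'] := nat_above t.
  have mn' : m0%:R * l <= n'%:R * l by exact: le_trans (ltW mt) tn'.
  by apply: split_; [apply: (Hm0 n)|apply: (Hm0 n' w)] => //; exact: ltW.
have ray : cend (c_ (m k)) = +oo%E by move: tc; rewrite /= leye_eq => /eqP.
have vP n : is_path n (v (m k)) by apply: (path_curve_path (cv (m k))); rewrite ray leey.
have [p _ cp] := ray_limit vP; have [q _ cq] := ray_limit wP.
rewrite /= (cv (m k)).1 (cvg_lim (@norm_hausdorff _ _) cp) (cvg_lim (@norm_hausdorff _ _) cq).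
apply: split_; rewrite enormB.
  by apply: (ray_tail vP cp (theta := theta / 2)) => // n; exact: Hm0.
by apply: (ray_tail wP cq (theta := theta / 2)) => // n; exact: Hm0.
Qed.

Lemma path_curves_compact : exists m c, [/\ forall j k, (j < k)%N -> (m j < m k)%N, path_curves c &
    converges_uniformly (c_ \o m) c].
Proof.
have [[N HN]|H] := pselect (exists N, U [set k | cend (c_ k) = (N%:R * l)%:E]).
  exact: compact_finite HN.
by apply: compact_infinite => N HN; apply: H; exists N.
Qed.

End Compactness.

(** The nodes approximate a geodesic from o to z at the times i L. *)
Lemma path_curves_dense : exists2 eps : R, 0 < eps & forall z, Omega z ->
  (dist_to_set z (boundary Omega) < eps%:E)%E -> exists c (t : R),
    [/\ path_curves c, 0 <= t, (t%:E <= cend c)%E, Omega (c t) & K z (c t) < L + 2].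
Proof.
have [e e0 He] := K_proper Hbd Hmet Hopen Hcomp Oo L.
exists e => // z Oz dz.
have zL : L < K o z.
  rewrite ltNge; apply/negP => Kz; have ib := He z Oz Kz.
  move: dz => /ereal_inf_lt[_ [q bq <-]]; rewrite lte_fin enormB => /ib.
  by have [_ nq] := (boundaryP Hopen q).1 bq.
have [g G] := Kgeo_ex Hbd Hmet Hopen Hcomp Oo Oz.
have zl0 : 0 <= K o z / L by rewrite divr_ge0 ?K_ge0 // ltW.
have /andP[] := truncn_itv zl0; set N := Num.truncn _; rewrite ler_pdivlMr // ltr_pdivrMr // => h1 h2.
have N0 : (0 < N)%N.
  rewrite lt0n; apply/eqP => E; move: h2; rewrite E mul1r => h2.
  by have := lt_trans zL h2; rewrite ltxx.
have iL i : (i <= N)%N -> 0 <= i%:R * L /\ i%:R * L <= K o z.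
  move=> iN; split; first by rewrite mulr_ge0 // ltW.
  by apply: le_trans h1; rewrite ler_pM2r // ler_nat.
have Og i : (i <= N)%N -> Omega (g (i%:R * L)) by move=> /iL[p q]; exact: geo_in G p q.
have /choice[v Hv] i : exists a, (i <= N)%N -> a \in net i /\ K (g (i%:R * L)) a <= 1.
  have [iN|Ni] := leqP i N; last by exists 0.
  have [p q] := iL i iN; have [|a an Ka] := @net_dense i (g (i%:R * L)).
    by split; [exact: Og|exact: geo_l G p q].
  by exists a.
have vO i : (i <= N)%N -> Omega (v i) by move=> /Hv[/net_in[]].
have vP : is_path N v.
  split=> i iN; first by have [] := Hv i iN.
  have [p1 q1] := Hv i (ltnW iN); have [p2 q2] := Hv _ iN.
  have O1' := Og i (ltnW iN); have O2' := Og _ iN; have O3' := vO i (ltnW iN); have O4' := vO _ iN.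
  have t1 := Ktri O3' O1' O4'; have t2 := Ktri O1' O2' O4'.
  rewrite (Ksym O3' O1') in t1.
  have [_ _ _ H] := G; have [a1 a2] := iL i (ltnW iN); have [a3 a4] := iL _ iN.
  have [_ E] := H _ _ a1 a2 a3 a4.
  have E' : `|i%:R * L - i.+1%:R * L| = L.
    by rewrite -natr1 mulrDl mul1r opprD addrA subrr sub0r normrN gtr0_norm.
  rewrite E E' in t2.
  by move: t1 t2 q1 q2; lra.
exists (Curve (N%:R * l)%:E (crv v)), (N%:R * l); split.
- by exists v; split=> //; right; exists N.
- by rewrite mulr_ge0 // ltW.
- by rewrite lexx.
- by rewrite /= crv_node; exact: vO.
- rewrite /= crv_node; have [_ q1] := Hv N (leqnn N); have [a1 a2] := iL N (leqnn N).
  have t1 := Ktri Oz (Og N (leqnn N)) (vO N (leqnn N)).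
  rewrite (Ksym Oz (Og N (leqnn N))) (geo_r G a1 a2) in t1.
  move: h2; rewrite -natr1 mulrDl mul1r; move: t1 q1; lra.
Qed.

Lemma path_curves_frame : frame Omega (l / L) (2 * l ^+ 2 / L + l) path_curves.
Proof.
split.
- exact: path_curve_quasi.
- move=> c [v [-> [[_ vP]|[n [_ -> _]]]]] // _; exact: ray_limit.
- exists [set o]; split; [exact: compact_set1|by move=> _ ->|].
  move=> c [v pc]; have vP : is_path 0 v.
    apply: (path_curve_path pc); rewrite mul0r; apply: ltW.
    by have [] := @path_curve_quasi c (ex_intro _ _ pc).
  have [Ov] := path_sphere vP (leqnn 0); rewrite mul0r => /(K_eq0 Hmet Oo Ov) ->.
  by rewrite pc.1; have := crv_node v 0; rewrite mul0r => ->.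
- move=> c_ /choice[v cv]; have [U [UU UN]] := nat_ultra.
  have H := path_curves_compact UU UN cv; exact H.
- have [eps eps0 H] := path_curves_dense; exists eps, (L + 2); split=> //.
  by rewrite addr_gt0.
Qed.

End NetFrame.

(** * The equivalence *)

(** The arcs are chosen once and for all: two paths with the same nodes give the
    same curve. *)
Lemma arcs_ex (R : realType) (d : nat) (Omega : set 'rV[R[i]]_d) (l : R) :
  metric_on Omega (kobayashi Omega) ->
  exists (arc : 'rV[R[i]]_d -> 'rV[R[i]]_d -> R -> 'rV[R[i]]_d) (bad : 'rV[R[i]]_d -> 'rV[R[i]]_d -> seq R),
    (forall x y, Omega x -> Omega y -> kobayashi Omega x y < l ->
       unit_speed_path Omega x y l (arc x y) (bad x y)) /\
    (forall x y, arc x y 0 = x).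
Proof.
move=> Hmet.
have /choice[f Hf] (xy : 'rV[R[i]]_d * 'rV[R[i]]_d) : exists qB : (R -> 'rV[R[i]]_d) * seq R,
    (Omega xy.1 -> Omega xy.2 -> kobayashi Omega xy.1 xy.2 < l ->
       unit_speed_path Omega xy.1 xy.2 l qB.1 qB.2) /\ qB.1 0 = xy.1.
  have [[h1 [h2 h3]]|h] := pselect (Omega xy.1 /\ (Omega xy.2 /\ kobayashi Omega xy.1 xy.2 < l)).
    have [q [B H]] := unit_speed_path_ex Hmet h1 h2 h3.
    by exists (q, B); split=> //; have [] := H.
  by exists (fun=> xy.1, [::]); split=> // h1 h2 h3; exfalso; apply: h.
exists (fun x y => (f (x, y)).1), (fun x y => (f (x, y)).2); split=> x y.
  exact: (Hf (x, y)).1.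
exact: (Hf (x, y)).2.
Qed.

Theorem theorem1p2 (R : realType) (d : nat) (Omega : set 'rV[R[i]]_d)
  (Omega_domain : domain Omega)
  (Omega_bounded : exists M : R, forall z, Omega z -> enorm z <= M)
  (Omega_complete : complete_metric_on Omega (kobayashi Omega))
  (Omega_hyperbolic : gromov_hyperbolic Omega)
  (Omega_discs : no_nontrivial_analytic_discs (boundary Omega)) :
  visible Omega <->
  exists A B : R, [/\ 1 <= A, 0 <= B &
    exists F : set (curve R d), frame Omega A B F].
Proof.
have [Hopen _ [base Obase]] := Omega_domain; have [M Hbd] := Omega_bounded.
have [Hmet Hcomp] := Omega_complete.
have [delta delta0 Hslim] := gromov_slim Omega_hyperbolic.
split=> [vis|[A [B [A1 B0 [F HF]]]]]; last first.
  exact: (frame_visible Hbd Hmet Hopen Hcomp delta0 Hslim Omega_discs Obase (le_trans ler01 A1) B0 HF).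
pose L := 5 * delta + 1.
have d5 : 0 <= 5 * delta by rewrite mulr_ge0 // ltW.
have L0 : 0 < L by rewrite ltr_wpDl.
have dL : 5 * delta <= L by rewrite lerDl.
have Hclose := visible_close Hbd Hmet Hopen Hcomp Obase vis.
have /choice[net Hnet] (n : nat) := sphere_net Hbd Hmet Hopen Hcomp Obase (n%:R * L).
have [arc [bad [arcP arc0]]] := arcs_ex (L + 3) Hmet.
exists ((L + 3) / L), (2 * (L + 3) ^+ 2 / L + (L + 3)); split.
- by rewrite ler_pdivlMr // mul1r lerDl.
- by rewrite addr_ge0 ?divr_ge0 ?mulr_ge0 ?sqr_ge0 ?addr_ge0 // ltW.
- exists (path_curves Omega L net arc).
  exact: (path_curves_frame Hbd Hmet Hopen Hcomp delta0 Hslim Obase L0 dL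
    (fun n => (Hnet n).1) (fun n => (Hnet n).2) arcP arc0 Hclose).
Qed.
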